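(* Let $q\in(0,1)$ and $\alpha>-1$. The Hamburger moment problem for the modified $q$-Laguerre polynomials is determinate or, equivalently, the Jacobi operator $\tilde J^{(\alpha)}$ is self-adjoint. Moreover, $\tilde J^{(\alpha)}$ is positive, and the inverse $(\tilde J^{(\alpha)})^{-1}$ exists and belongs to the trace class.
   Context: Fix $q\in(0,1)$ and $\alpha>-1$. $(a;q)_n=\prod_{k=0}^{n-1}(1-aq^k)$ for $n\in\mathbb{N}_0\cup\{\infty\}$. Put $$\gamma(u,v;q)=\frac{(q^u;q)_\infty}{(q^{u+v};q)_\infty},\qquad r_n^{(\alpha)}=\frac{1-\gamma(n+1,\alpha+1;q)}{1-\gamma(n,\alpha+1;q)},\quad n\ge0$$ (note $\gamma(0,\alpha+1;q)=0$), and $$\tilde\lambda_n^{(\alpha)}=\frac{q^{-2n-\alpha-1}(1-q^{n+\alpha+1})}{r_n^{(\alpha)}},\qquad\tilde\mu_n^{(\alpha)}=q^{-2n-\alpha}(1-q^n)\,r_n^{(\alpha)},\quad n\ge0 .$$ The Jacobi operator $\tilde J^{(\alpha)}$ is the closure in $\ell^2(\mathbb{N}_0)$ of the action on finitely supported sequences of the infinite symmetric tridiagonal matrix with diagonal entries $\tilde b_n^{(\alpha)}=\tilde\lambda_n^{(\alpha)}+\tilde\mu_n^{(\alpha)}$ and off-diagonal entries $\tilde a_n^{(\alpha)}=\sqrt{\tilde\lambda_n^{(\alpha)}\tilde\mu_{n+1}^{(\alpha)}}$. For $\beta>-1$ the monic $q$-Laguerre polynomials are $$p_n^{(\beta)}(x;q)=(-1)^nq^{-n(n+\beta)}(q^{\beta+1};q)_n\sum_{k=0}^n\frac{(q^{-n};q)_k}{(q^{\beta+1};q)_k(q;q)_k}\,q^{k(k-1)/2}(q^{n+\beta+1}x)^k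 .$$ The modified $q$-Laguerre polynomials, in monic form, are $\tilde p_n^{(\alpha)}(x;q)=r_n^{(\alpha)}p_n^{(\alpha)}(x;q)+(1-r_n^{(\alpha)})p_n^{(\alpha+1)}(x;q)$; they are the monic orthogonal polynomials associated with the infinite symmetric tridiagonal (Jacobi) matrix with diagonal entries $\tilde b_n^{(\alpha)}=\tilde\lambda_n^{(\alpha)}+\tilde\mu_n^{(\alpha)}$ and off-diagonal entries $\tilde a_n^{(\alpha)}=\sqrt{\tilde\lambda_n^{(\alpha)}\tilde\mu_{n+1}^{(\alpha)}}$, $n\ge0$, i.e. $\tilde p_{n+1}^{(\alpha)}=(x-\tilde b_n^{(\alpha)})\tilde p_n^{(\alpha)}-(\tilde a_{n-1}^{(\alpha)})^2\tilde p_{n-1}^{(\alpha)}$ with $\tilde p_{-1}^{(\alpha)}=0$, $\tilde p_0^{(\alpha)}=1$. The Hamburger moment problem for an orthogonal polynomial sequence is determinate if the sequence is orthogonal with respect to a unique Borel probability measure on $\mathbb{R}$. *)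

(* Defs.v *)
From HB Require Import structures.
From mathcomp Require Import all_boot all_order all_algebra.
From mathcomp Require Import complex.
From mathcomp Require Import all_classical all_reals all_analysis.
From mathcomp Require Import ring.

Set Implicit Arguments.
Unset Strict Implicit.
Unset Printing Implicit Defensive.

Import Order.TTheory GRing.Theory Num.Theory numFieldNormedType.Exports.

Local Open Scope classical_set_scope.
Local Open Scope complex_scope.
Local Open Scope ring_scope.

Definition sqsum {R : realType} (x : nat -> R[i]) : nat -> R :=
  series (fun n => Normc.normc (x n) ^+ 2).

Definition square_summable {R : realType} : {pred (nat -> R[i])} :=
  fun x => `[< cvgn (sqsum x) >].

Section SquareSummable.
Variable R : realType.
Implicit Types (x y : nat -> R[i]) (c : R[i]) (t : R).

Lemma sqsum_nondecreasing x : nondecreasing_seq (sqsum x).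
Proof. by apply: nondecreasing_series => n _ _; exact: sqr_ge0. Qed.

Lemma lim_sqsum_ge0 x : cvgn (sqsum x) -> 0 <= limn (sqsum x).
Proof.
move=> cx; apply: limr_ge => //; near=> n; rewrite /sqsum /series/=.
by apply: sumr_ge0 => i _; exact: sqr_ge0.
Unshelve. all: by end_near. Qed.

Lemma square_summableP x M : (forall n, sqsum x n <= M) -> cvgn (sqsum x).
Proof.
move=> H; apply: nondecreasing_is_cvgn; first exact: sqsum_nondecreasing.
by exists M => _ [n _ <-].
Qed.

Lemma normcD x y n :
  Normc.normc (x n + y n) <= Normc.normc (x n) + Normc.normc (y n).
Proof.
have := ler_normD (x n) (y n).
by rewrite /Num.norm/= -rmorphD/= lecR.
Qed.

Lemma normc_ge0 c : 0 <= Normc.normc c.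
Proof. by case: c => a b; exact: sqrtr_ge0. Qed.

(* The bound |x + y|^2 <= (1 + t) |x|^2 + (1 + 1/t) |y|^2, summed over n,
   gives the triangle inequality for the best choice of t. *)
Lemma sqsumD x y t n : 0 < t ->
  sqsum (x + y) n <= (1 + t) * sqsum x n + (1 + t^-1) * sqsum y n.
Proof.
move=> t0; rewrite /sqsum /series/= !mulr_sumr -big_split/=.
apply: ler_sum => i _.
set a := Normc.normc (x i); set b := Normc.normc (y i).
have a0 : 0 <= a := normc_ge0 _.
have b0 : 0 <= b := normc_ge0 _.
apply: (@le_trans _ _ ((a + b) ^+ 2)).
  by rewrite lerXn2r ?nnegrE ?normc_ge0 ?addr_ge0//; exact: normcD.
rewrite -subr_ge0.
have -> : (1 + t) * a ^+ 2 + (1 + t^-1) * b ^+ 2 - (a + b) ^+ 2 =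
          (t * a - b) ^+ 2 / t by field; rewrite gt_eqF.
by rewrite mulr_ge0 ?sqr_ge0// invr_ge0 ltW.
Qed.

Lemma sqsumZ c x n : sqsum (c *: x) n = Normc.normc c ^+ 2 * sqsum x n.
Proof.
rewrite /sqsum /series/= mulr_sumr; apply: eq_bigr => i _.
by rewrite [(c *: x) i]/(c * x i) Normc.normcM exprMn.
Qed.

Lemma square_summable_closed : GRing.submod_closed (@square_summable R).
Proof.
split => [|c x y /asboolP cx /asboolP cy]; apply/asboolP.
  apply: (@square_summableP _ 0) => n; rewrite /sqsum /series/= big1// => i _.
  by rewrite [X in X ^+ 2](Normc.normc0 R) expr0n.
have cz : cvgn (sqsum (c *: x)).
  apply: (@square_summableP _ (Normc.normc c ^+ 2 * limn (sqsum x))) => n.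
  rewrite sqsumZ ler_wpM2l ?sqr_ge0//.
  by apply: nondecreasing_cvgn_le => //; exact: sqsum_nondecreasing.
apply: (@square_summableP _ ((1 + 1) * limn (sqsum (c *: x)) +
                             (1 + 1^-1) * limn (sqsum y))) => n.
apply: (le_trans (sqsumD _ _ n ltr01)).
by apply: lerD; (rewrite ler_wpM2l ?addr_ge0 ?invr_ge0//;
  apply: nondecreasing_cvgn_le => //; exact: sqsum_nondecreasing).
Qed.

HB.instance Definition _ := GRing.isSubmodClosed.Build R[i] (nat -> R[i])
  square_summable square_summable_closed.

End SquareSummable.

Record l2 (R : realType) := L2 {
  l2_seq :> nat -> R[i] ;
  l2_seqP : l2_seq \in square_summable }.

HB.instance Definition _ (R : realType) := [isSub for @l2_seq R].
HB.instance Definition _ (R : realType) := [Choice of l2 R by <:].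
HB.instance Definition _ (R : realType) :=
  [SubChoice_isSubLmodule of l2 R by <:].

(* The norm takes its values in the scalar field R[i]. *)
Definition l2_norm {R : realType} (x : l2 R) : R[i] :=
  (Num.sqrt (limn (sqsum x)))%:C.

Section L2Norm.
Variable R : realType.
Implicit Types (x y : l2 R) (c : R[i]).

Lemma l2_cvg x : cvgn (sqsum x).
Proof. by apply/asboolP; exact: (l2_seqP x). Qed.

Lemma l2_norm_eq0 x : l2_norm x = 0 -> x = 0.
Proof.
move=> /complexI/eqP; rewrite sqrtr_eq0 => l0; apply/val_inj/funext => n /=.
apply: Normc.eq0_normc; apply/eqP; rewrite -sqrf_eq0 eq_le sqr_ge0 andbT.
have := nondecreasing_cvgn_le (sqsum_nondecreasing x) (@l2_cvg x) n.+1.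
move=> /le_trans/(_ l0); apply: le_trans; rewrite /sqsum /series/=.
by rewrite big_nat_recr//= ler_wpDl// sumr_ge0// => i _; exact: sqr_ge0.
Qed.

Lemma l2_normZ c x : l2_norm (c *: x) = `|c| * l2_norm x.
Proof.
transitivity ((Normc.normc c * Num.sqrt (limn (sqsum x)))%:C); last first.
  exact: (rmorphM (real_complex R)).
congr (_%:C).
have -> : sqsum (c *: x : l2 R) = Normc.normc c ^+ 2 *: sqsum x.
  by apply/funext => n; exact: sqsumZ.
have -> : limn (Normc.normc c ^+ 2 *: sqsum x) =
          Normc.normc c ^+ 2 * limn (sqsum x).
  by apply: cvg_lim => //; apply: cvgZr; exact: l2_cvg.
by rewrite sqrtrM ?sqr_ge0// sqrtr_sqr ger0_norm// normc_ge0.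
Qed.

Lemma l2_normD x y : l2_norm (x + y) <= l2_norm x + l2_norm y.
Proof.
have [/l2_norm_eq0 ->|x0] := eqVneq (l2_norm x) 0.
  by rewrite add0r lerDr lecR sqrtr_ge0.
have [/l2_norm_eq0 ->|y0] := eqVneq (l2_norm y) 0.
  by rewrite addr0 lerDl lecR sqrtr_ge0.
move: x0 y0; rewrite /l2_norm -rmorphD/= lecR.
rewrite -!(rmorph0 (real_complex R)) !(inj_eq (@complexI R)).
set X := limn (sqsum x); set Y := limn (sqsum y).
set a := Num.sqrt X; set b := Num.sqrt Y => a0 b0.
have {}a0 : 0 < a by rewrite lt_def a0 sqrtr_ge0.
have {}b0 : 0 < b by rewrite lt_def b0 sqrtr_ge0.
have t0 : 0 < b / a by rewrite divr_gt0.
rewrite -[leRHS]ger0_norm; last by rewrite addr_ge0 ?sqrtr_ge0.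
rewrite -sqrtr_sqr ler_wsqrtr//.
have -> : (a + b) ^+ 2 = (1 + b / a) * X + (1 + (b / a)^-1) * Y.
  have <- : a ^+ 2 = X by rewrite sqr_sqrtr// lim_sqsum_ge0//; exact: l2_cvg.
  have <- : b ^+ 2 = Y by rewrite sqr_sqrtr// lim_sqsum_ge0//; exact: l2_cvg.
  by field; rewrite !gt_eqF.
apply: limr_le; first exact: (@l2_cvg (x + y)).
near=> n; apply: (le_trans (sqsumD _ _ n t0)).
apply: lerD; (rewrite ler_wpM2l ?addr_ge0 ?invr_ge0 ?(ltW t0)//;
  apply: nondecreasing_cvgn_le; [exact: sqsum_nondecreasing|exact: l2_cvg]).
Unshelve. all: by end_near. Qed.

End L2Norm.

HB.instance Definition _ (R : realType) := Lmodule_isNormed.Build R[i] (l2 R)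
  (@l2_normD R) (@l2_normZ R) (@l2_norm_eq0 R).

(* The series is taken in R[i] with its usual topology, carried by R[i]^o. *)
Definition l2_dot {R : realType} (x y : l2 R) : R[i] :=
  limn (series (fun n => x n * (y n)^* : R[i]^o)).

Lemma l2_basis_subproof {R : realType} (n : nat) :
  (fun k => (k == n)%:R : R[i]) \in square_summable.
Proof.
apply/asboolP; apply: (@square_summableP _ _ 1) => m.
rewrite /sqsum /series/= big_mkord.
have [nm|mn] := ltnP n m.
  rewrite (bigD1 (Ordinal nm))//= eqxx Normc.normc1 expr1n big1 ?addr0// => i.
  by rewrite -val_eqE/= => /negbTE ->; rewrite Normc.normc0 expr0n.
rewrite big1 ?ler01// => i _; rewrite ltn_eqF ?(leq_trans (ltn_ord i))//.
by rewrite Normc.normc0 expr0n.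
Qed.

Definition l2_basis {R : realType} (n : nat) : l2 R := L2 (l2_basis_subproof n).

(* A possibly unbounded operator is identified with its graph, the set of
   pairs (x, T x) for x in the domain of T. *)
Definition operator (R : realType) := set (l2 R * l2 R).

Section Operators.
Variable R : realType.
Implicit Types (T : operator R) (A B : {linear l2 R -> l2 R}).

Definition op_dom T : set (l2 R) := [set x | exists y, T (x, y)].

(* This is the graph of a map precisely when the domain of T is dense. *)
Definition op_adjoint T : operator R :=
  [set yz | forall x w, T (x, w) -> l2_dot w yz.1 = l2_dot x yz.2].

Definition self_adjoint T := dense (op_dom T) /\ op_adjoint T = T.

(* In the order of R[i], 0 <= z means that z is a nonnegative real. *)
Definition positive_op T := forall x y, T (x, y) -> 0 <= l2_dot y x.

Definition op_inverse T A := forall x y, T (x, y) <-> x = A y.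

Definition adjoint_map A B := forall x y, l2_dot (A x) y = l2_dot x (B y).

(* B is the absolute value (A^* A)^(1/2) of the bounded map A, i.e. the bounded
   positive square root of A^* A. *)
Definition op_abs A B :=
  [/\ continuous B, forall x, 0 <= l2_dot (B x) x &
      exists2 A' : {linear l2 R -> l2 R},
        adjoint_map A A' & forall x, B (B x) = A' (A x)].

(* The trace of a positive operator does not depend on the orthonormal basis,
   so the canonical one is used. *)
Definition trace_class A :=
  continuous A /\
  exists2 B : {linear l2 R -> l2 R}, op_abs A B &
    cvgn (series (fun n => l2_dot (B (l2_basis n)) (l2_basis n) : R[i]^o)).

End Operators.

Section Jacobi.
Variables (R : realType) (a b : nat -> R).

Definition finitely_supported (x : nat -> R[i]) :=
  exists N, forall n, (N <= n)%N -> x n = 0.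

Definition jacobi_action (x : nat -> R[i]) (n : nat) : R[i] :=
  (if n is m.+1 then (a m)%:C * x m else 0) + (b n)%:C * x n
  + (a n)%:C * x n.+1.

Definition jacobi_operator : operator R :=
  closure [set xy : l2 R * l2 R |
    finitely_supported xy.1 /\ l2_seq xy.2 = jacobi_action xy.1].

End Jacobi.

Section MomentProblem.
Variable R : realType.
Implicit Types (P : nat -> {poly R}) (mu : probability R R).

Definition orthogonal_wrt P mu :=
  [/\ forall m n, mu.-integrable setT (fun x => ((P m * P n).[x])%:E),
      forall m n, m != n -> (\int[mu]_x ((P m * P n).[x])%:E = 0)%E &
      forall n, (0 < \int[mu]_x ((P n * P n).[x])%:E)%E].

Definition hamburger_determinate P :=
  exists2 mu : probability R R, orthogonal_wrt P mu &
    forall nu : probability R R, orthogonal_wrt P nu ->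
      forall X, measurable X -> nu X = mu X.

End MomentProblem.

Section ModifiedQLaguerre.
Variables (R : realType) (q : R).

Definition qpoch (a : R) (n : nat) : R := \prod_(0 <= k < n) (1 - a * q ^+ k).

Definition qpoch_inf (a : R) : R := limn (qpoch a).

Definition qlaguerre_gamma (u v : R) : R :=
  qpoch_inf (q `^ u) / qpoch_inf (q `^ (u + v)).

Definition qlaguerre (beta : R) (n : nat) : {poly R} :=
  ((-1) ^+ n * q `^ (- (n%:R * (n%:R + beta))) * qpoch (q `^ (beta + 1)) n) *:
  \sum_(0 <= k < n.+1)
    (qpoch (q ^- n) k / (qpoch (q `^ (beta + 1)) k * qpoch q k)
     * q ^+ (k * k.-1)./2) *: (q `^ (n%:R + beta + 1) *: 'X) ^+ k.

Variable alpha : R.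

Definition qlag_r (n : nat) : R :=
  (1 - qlaguerre_gamma (n.+1)%:R (alpha + 1)) /
  (1 - qlaguerre_gamma n%:R (alpha + 1)).

Definition qlag_lambda (n : nat) : R :=
  q `^ (- 2 * n%:R - alpha - 1) * (1 - q `^ (n%:R + alpha + 1)) / qlag_r n.

Definition qlag_mu (n : nat) : R :=
  q `^ (- 2 * n%:R - alpha) * (1 - q ^+ n) * qlag_r n.

Definition qlag_b (n : nat) : R := qlag_lambda n + qlag_mu n.

Definition qlag_a (n : nat) : R := Num.sqrt (qlag_lambda n * qlag_mu n.+1).

Definition modified_qlaguerre (n : nat) : {poly R} :=
  qlag_r n *: qlaguerre alpha n + (1 - qlag_r n) *: qlaguerre (alpha + 1) n.

Definition modified_qlaguerre_jacobi : operator R :=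
  jacobi_operator qlag_a qlag_b.

End ModifiedQLaguerre.

(* Main.v *)
(**
The Jacobi matrix factors as [L L^T], with [L] lower bidiagonal with entries [sqrt lambda_n] at [(n, n)] and [sqrt mu_n]
at [(n, n - 1)]. With [g_n = 1 - gamma(n, alpha + 1)] one has [r_n = g_(n+1) / g_n],
[0 < r_n <= 1] and [g_n <= q^n / (1 - q)]; hence [mu_n <= q lambda_n] and
[1 / lambda_n = O(q^(2n))], so [T = L^-1] is Hilbert-Schmidt, and the products
of [mu_(j+1) / lambda_j], which telescope, tend to [0]. The latter makes the
range of the matrix on finitely supported sequences dense, so the closure is
the graph of the inverse of [G = T^* T], a positive trace-class operator.

Uniqueness: if [mu] and [nu] are orthogonality measures and [mu{x} > 0], then
[phi = sqrt (mu{x}) (P_n(x))_n] has norm at most [1] by Christoffel's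
inequality and is an eigenvector of the self-adjoint operator. Approximating
[(phi, x phi)] in the graph by finitely supported sequences [c], the
polynomials [sum c_n P_n] concentrate at [x] in [L^2(nu)], which forces
[mu{x} <= nu{x}]. If [mu] is purely atomic, then [mu = nu].

Existence of an atomic measure: the truncated matrices have Gauss quadratures
with nodes [1 / e_j], where the [e_j] are the eigenvalues of the truncations of
[T^T T], whose sum is at most [tau], the squared Hilbert-Schmidt norm of [T]. So
[e_j <= tau / (j + 1)] uniformly in the size, and the quadratures converge
along an ultrafilter without loss of mass.

The recurrence follows from
[p_(n+1)^(alpha) = p_(n+1)^(alpha+1) + c_(n+1) p_n^(alpha+1)] and
[x p_n^(alpha+1) = p_(n+1)^(alpha) + d_n p_n^(alpha)], since [mu_n = c_n r_n]
and [lambda_n = d_n / r_n].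
*)
From HB Require Import structures.
Require Import Defs.
From mathcomp Require Import all_boot all_order all_algebra.
From mathcomp Require Import complex.
From mathcomp Require Import all_classical all_reals all_analysis.
From mathcomp Require Import measurable_realfun.
From mathcomp Require Import ring lra.

Set Implicit Arguments.
Unset Strict Implicit.
Unset Printing Implicit Defensive.

Import Order.TTheory GRing.Theory Num.Theory numFieldNormedType.Exports.

Local Open Scope classical_set_scope.
Local Open Scope complex_scope.
Local Open Scope ring_scope.

Local Notation Re := complex.Re.
Local Notation Im := complex.Im.

(** * The Hilbert space of square-summable sequences *)

Section Prelim.
Variable R : realType.

(** By induction: the new cross term [2 * s * (x * y)] has square at most
    [(A * y ^+ 2 + B * x ^+ 2) ^+ 2], because [s ^+ 2 <= A * B]. *)
Lemma sum_mul_le_sqr (a b : nat -> R) n :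
  (\sum_(0 <= i < n) a i * b i) ^+ 2 <=
  (\sum_(0 <= i < n) a i ^+ 2) * (\sum_(0 <= i < n) b i ^+ 2).
Proof.
elim: n => [|n IH]; first by rewrite !big_geq// expr0n mul0r.
rewrite !big_nat_recr//=.
have A0 : 0 <= \sum_(0 <= i < n) a i ^+ 2 by apply: sumr_ge0 => i _; exact: sqr_ge0.
have B0 : 0 <= \sum_(0 <= i < n) b i ^+ 2 by apply: sumr_ge0 => i _; exact: sqr_ge0.
move: IH A0 B0; set s := \sum_(0 <= i < n) a i * b i.
set A := \sum_(0 <= i < n) a i ^+ 2; set B := \sum_(0 <= i < n) b i ^+ 2.
move: s A B (a n) (b n) => s A B x y IH A0 B0.
have X : 2 * s * (x * y) <= A * y ^+ 2 + B * x ^+ 2.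
  have P0 : 0 <= A * y ^+ 2 + B * x ^+ 2.
    by rewrite addr_ge0// mulr_ge0// sqr_ge0.
  apply: le_trans (ler_norm _) _.
  rewrite -(@ler_pXn2r _ 2)// ?nnegrE//.
  rewrite real_normK ?num_real//.
  have : 4 * (x * y) ^+ 2 * s ^+ 2 <= 4 * (x * y) ^+ 2 * (A * B).
    by rewrite ler_wpM2l// mulr_ge0// sqr_ge0.
  have := sqr_ge0 (A * y ^+ 2 - B * x ^+ 2).
  nra.
nra.
Qed.

(** A polynomial in the two parts, so that limits and real inequalities avoid the square root in
    [Normc.normc]. *)
Definition normc2 (c : R[i]) : R := Re c ^+ 2 + Im c ^+ 2.

Lemma normc2E c : Normc.normc c ^+ 2 = normc2 c.
Proof.
by case: c => a b; rewrite /normc2/= sqr_sqrtr// addr_ge0// sqr_ge0.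
Qed.

Lemma normr_normc (c : R[i]) : `|c| = (Normc.normc c)%:C.
Proof. by []. Qed.

Lemma normc2_ge0 c : 0 <= normc2 c.
Proof. by rewrite -normc2E sqr_ge0. Qed.

Lemma normc2J c : normc2 (c^*) = normc2 c.
Proof. by case: c => a b; rewrite /normc2/= sqrrN. Qed.

Lemma cvg_complex (u : nat -> R[i]) (l : R[i]) :
  (fun n => Re (u n)) @ \oo --> Re l -> (fun n => Im (u n)) @ \oo --> Im l ->
  (u : nat -> R[i]^o) @ \oo --> (l : R[i]^o).
Proof.
move=> ur ui; apply/(@cvgrPdist_lt _ R[i]^o) => e e0.
have e0' : 0 < Re e by move: e0; rewrite ltcE => /andP[].
have ee : e = (Re e)%:C by rewrite RRe_real// gtr0_real.
have h : 0 < Re e / 2 by rewrite divr_gt0.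
near=> n.
rewrite ee normc_def ltcR.
have H1 : `|Re (l - u n)| < Re e / 2.
  rewrite raddfB/=; near: n; exact: (cvgrPdist_lt _ _ ).1 ur _ h.
have H2 : `|Im (l - u n)| < Re e / 2.
  rewrite raddfB/=; near: n; exact: (cvgrPdist_lt _ _ ).1 ui _ h.
rewrite -(ger0_norm (ltW e0')) -sqrtr_sqr ltr_sqrt ?exprn_gt0//.
rewrite -[Re (l - u n) ^+ 2]real_normK ?num_real//.
rewrite -[Im (l - u n) ^+ 2]real_normK ?num_real//.
move: (normr_ge0 (Re (l - u n))) (normr_ge0 (Im (l - u n))) H1 H2.
set p := `|_|; set r := `|_| => p0 r0 H1 H2.
nra.
Unshelve. all: by end_near. Qed.

Lemma Re_sum (u : nat -> R[i]) n :
  Re (\sum_(0 <= k < n) u k) = \sum_(0 <= k < n) Re (u k).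
Proof. by elim: n => [|n IH]; [rewrite !big_geq|rewrite !big_nat_recr//= raddfD/= IH]. Qed.

Lemma Im_sum (u : nat -> R[i]) n :
  Im (\sum_(0 <= k < n) u k) = \sum_(0 <= k < n) Im (u k).
Proof. by elim: n => [|n IH]; [rewrite !big_geq|rewrite !big_nat_recr//= raddfD/= IH]. Qed.

End Prelim.

(** * Inner product, Cauchy-Schwarz inequality and truncations *)

Section L2Dot.
Variable R : realType.
Implicit Types (x y z : l2 R) (c : R[i]).

(** The squared norm as a real number; the norm of [l2 R] is complex-valued and carries a square
    root. *)
Definition l2_sq x : R := limn (sqsum x).

Lemma sqsumE (u : nat -> R[i]) n : sqsum u n = \sum_(0 <= k < n) normc2 (u k).
Proof. by apply: eq_bigr => i _; rewrite normc2E. Qed.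

Lemma l2_sq_cvg x : sqsum x @ \oo --> l2_sq x.
Proof. exact: l2_cvg. Qed.

Lemma sqsum_le x n : sqsum x n <= l2_sq x.
Proof. exact: (nondecreasing_cvgn_le (sqsum_nondecreasing x) (@l2_cvg R x)). Qed.

Lemma l2_sq_ge0 x : 0 <= l2_sq x.
Proof. exact: lim_sqsum_ge0 (@l2_cvg R x). Qed.

Lemma l2_sq_le x M : (forall n, sqsum x n <= M) -> l2_sq x <= M.
Proof.
by move=> H; apply: limr_le; [exact: l2_cvg|near=> n; exact: H].
Unshelve. all: by end_near. Qed.

Lemma l2_normE x : `|x| = (Num.sqrt (l2_sq x))%:C.
Proof. by []. Qed.

Lemma l2_norm_lt x (e : R) : 0 < e -> (`|x| < e%:C) = (l2_sq x < e ^+ 2).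
Proof.
move=> e0; rewrite l2_normE ltcR -{1}(ger0_norm (ltW e0)) -sqrtr_sqr.
by rewrite ltr_sqrt// exprn_gt0.
Qed.

Lemma l2_dot_norm_cvg x y :
  cvgn (series (fun n => Normc.normc (x n) * Normc.normc (y n))).
Proof.
apply: nondecreasing_is_cvgn.
  by apply: nondecreasing_series => n _ _; rewrite mulr_ge0// normc_ge0.
exists (l2_sq x + l2_sq y) => _ [n _ <-].
apply: (@le_trans _ _ (sqsum x n + sqsum y n)); last by rewrite lerD// sqsum_le.
rewrite /sqsum /series/= -big_split/=; apply: ler_sum => i _.
have := sqr_ge0 (Normc.normc (x i) - Normc.normc (y i)).
have := normc_ge0 (x i); have := normc_ge0 (y i).
nra.
Qed.

Lemma norm_Re_le c : `|Re c| <= Normc.normc c.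
Proof. by have := normc_ge_Re c; rewrite normr_normc lecR. Qed.

Lemma norm_Im_le c : `|Im c| <= Normc.normc c.
Proof.
case: c => a b /=; rewrite -sqrtr_sqr ler_wsqrtr// lerDr; exact: sqr_ge0.
Qed.

Lemma normcJ_real c : Normc.normc (c^*) = Normc.normc c.
Proof. by case: c => a b /=; rewrite sqrrN. Qed.

Lemma Re_dot_is_cvg x y : cvgn (series (fun n => Re (x n * (y n)^*))).
Proof.
apply: normed_cvg.
apply: (@series_le_cvg R (fun n => `|Re (x n * (y n)^*)|) _ _ _ _
  (@l2_dot_norm_cvg x y)) => n; first exact: normr_ge0.
  by rewrite mulr_ge0// normc_ge0.
by rewrite (le_trans (norm_Re_le _))// Normc.normcM normcJ_real.
Qed.

Lemma Im_dot_is_cvg x y : cvgn (series (fun n => Im (x n * (y n)^*))).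
Proof.
apply: normed_cvg.
apply: (@series_le_cvg R (fun n => `|Im (x n * (y n)^*)|) _ _ _ _
  (@l2_dot_norm_cvg x y)) => n; first exact: normr_ge0.
  by rewrite mulr_ge0// normc_ge0.
by rewrite (le_trans (norm_Im_le _))// Normc.normcM normcJ_real.
Qed.

Let dot_cvg_aux x y :
  (series (fun n => x n * (y n)^* : R[i]^o)) @ \oo -->
  (limn (series (fun n => Re (x n * (y n)^*)))
   +i* limn (series (fun n => Im (x n * (y n)^*))) : R[i]^o).
Proof.
apply: cvg_complex => /=.
- rewrite (_ : (fun n => _) = series (fun n => Re (x n * (y n)^*))).
    exact: Re_dot_is_cvg.
  by apply/funext => n; exact: Re_sum.
- rewrite (_ : (fun n => _) = series (fun n => Im (x n * (y n)^*))).
    exact: Im_dot_is_cvg.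
  by apply/funext => n; exact: Im_sum.
Qed.

Lemma l2_dot_cvg x y :
  series (fun n => x n * (y n)^* : R[i]^o) @ \oo --> (l2_dot x y : R[i]^o).
Proof. by apply/cvg_ex; eexists; exact: dot_cvg_aux. Qed.

Lemma l2_dotE x y : l2_dot x y =
  limn (series (fun n => Re (x n * (y n)^*)))
   +i* limn (series (fun n => Im (x n * (y n)^*))).
Proof. by apply: (@cvg_lim R[i]^o); [exact: norm_hausdorff|exact: dot_cvg_aux]. Qed.

Lemma Re_dot_cvg x y :
  (fun n => Re (\sum_(0 <= k < n) x k * (y k)^*)) @ \oo --> Re (l2_dot x y).
Proof.
rewrite l2_dotE/= (_ : (fun n => _) = series (fun n => Re (x n * (y n)^*))).
  exact: Re_dot_is_cvg.
by apply/funext => n; exact: Re_sum.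
Qed.

Lemma Im_dot_cvg x y :
  (fun n => Im (\sum_(0 <= k < n) x k * (y k)^*)) @ \oo --> Im (l2_dot x y).
Proof.
rewrite l2_dotE/= (_ : (fun n => _) = series (fun n => Im (x n * (y n)^*))).
  exact: Im_dot_is_cvg.
by apply/funext => n; exact: Im_sum.
Qed.

Lemma l2_dotP c x y :
  (fun n => Re (\sum_(0 <= k < n) x k * (y k)^*)) @ \oo --> Re c ->
  (fun n => Im (\sum_(0 <= k < n) x k * (y k)^*)) @ \oo --> Im c ->
  l2_dot x y = c.
Proof.
move=> h1 h2; have /(cvg_lim (@Rhausdorff R)) e1 := h1.
have /(cvg_lim (@Rhausdorff R)) e2 := h2.
have /(cvg_lim (@Rhausdorff R)) e3 := @Re_dot_cvg x y.
have /(cvg_lim (@Rhausdorff R)) e4 := @Im_dot_cvg x y.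
apply/eqP; rewrite eq_complex -e3 -e4 e1 e2; exact/andP.
Qed.

Lemma l2_dot_linearl c x y z : l2_dot (c *: x + y) z = c * l2_dot x z + l2_dot y z.
Proof.
apply: (@cvg_lim R[i]^o); first exact: norm_hausdorff.
rewrite (_ : series _ = (fun n => c *: (series (fun n => x n * (z n)^* : R[i]^o) n : R[i]^o)
  + (series (fun n => y n * (z n)^* : R[i]^o) n))); last first.
  apply/funext => n; rewrite /series/=.
  rewrite [c *: _]mulr_sumr -big_split; apply: eq_bigr => i _ /=.
  by rewrite mulrDl mulrA.
apply: cvgD; last exact: l2_dot_cvg.
by apply: cvgZr; exact: l2_dot_cvg.
Qed.

Lemma l2_dotC x y : l2_dot y x = (l2_dot x y)^*.
Proof.
have E n : \sum_(0 <= k < n) y k * (x k)^* = (\sum_(0 <= k < n) x k * (y k)^*)^*.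
  rewrite rmorph_sum/=; apply: eq_bigr => i _.
  by rewrite rmorphM/= conjCK mulrC.
apply: l2_dotP; under eq_fun do rewrite E.
- rewrite (_ : Re (l2_dot x y)^* = Re (l2_dot x y)); last by case: (l2_dot x y).
  rewrite (_ : (fun _ => _) = (fun n => Re (\sum_(0 <= k < n) x k * (y k)^*))).
    exact: Re_dot_cvg.
  by apply/funext => n; case: (\sum_(_ <= _ < _) _).
- rewrite (_ : Im (l2_dot x y)^* = - Im (l2_dot x y)); last by case: (l2_dot x y).
  rewrite (_ : (fun _ => _) = (fun n => - Im (\sum_(0 <= k < n) x k * (y k)^*))).
    by apply: cvgN; exact: Im_dot_cvg.
  by apply/funext => n; case: (\sum_(_ <= _ < _) _).
Qed.

Lemma l2_dotxx x : l2_dot x x = (l2_sq x)%:C.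
Proof.
have E k : x k * (x k)^* = (normc2 (x k))%:C.
  by case: (x k) => a b; rewrite /normc2/=; simpc; congr (_ +i* _); ring.
have E2 n : \sum_(0 <= k < n) x k * (x k)^* = (sqsum x n)%:C.
  by rewrite sqsumE rmorph_sum/=; apply: eq_bigr => i _; rewrite E.
apply: l2_dotP; under eq_fun do rewrite E2 /=; last exact: cvg_cst.
exact: l2_sq_cvg.
Qed.

Lemma normc2_sum_le (u v : nat -> R[i]) n :
  normc2 (\sum_(0 <= k < n) u k * (v k)^*) <= sqsum u n * sqsum v n.
Proof.
rewrite -normc2E.
apply: (@le_trans _ _ ((\sum_(0 <= k < n) Normc.normc (u k) * Normc.normc (v k)) ^+ 2)).
  rewrite lerXn2r ?nnegrE ?normc_ge0//.
    by apply: sumr_ge0 => i _; rewrite mulr_ge0// normc_ge0.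
  rewrite -lecR -normr_normc rmorph_sum/= (le_trans (ler_norm_sum _ _ _))//.
  by apply: ler_sum => i _; rewrite normr_normc Normc.normcM normcJ_real.
exact: sum_mul_le_sqr.
Qed.

(** Cauchy-Schwarz passes from partial sums to the limit because [normc2] is a polynomial in the
    real and imaginary parts. *)
Lemma l2_dot_le x y : normc2 (l2_dot x y) <= l2_sq x * l2_sq y.
Proof.
have H : (fun n => normc2 (\sum_(0 <= k < n) x k * (y k)^*)) @ \oo --> normc2 (l2_dot x y).
  rewrite /normc2 !expr2; under eq_fun do rewrite !expr2.
  by apply: cvgD; apply: cvgM; (exact: Re_dot_cvg || exact: Im_dot_cvg).
rewrite -(cvg_lim (@Rhausdorff R) H); apply: limr_le.
  by apply/cvg_ex; eexists; exact: H.
near=> n; apply: le_trans (normc2_sum_le _ _ _) _.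
apply: ler_pM; rewrite ?sqsum_le// sqsumE;
 by apply: sumr_ge0 => i _; exact: normc2_ge0.
Unshelve. all: by end_near. Qed.

Lemma l2_dot_fin x y N : (forall n, (N <= n)%N -> x n = 0) ->
  l2_dot x y = \sum_(0 <= k < N) x k * (y k)^*.
Proof.
move=> x0.
have E n : (N <= n)%N -> \sum_(0 <= k < n) x k * (y k)^* = \sum_(0 <= k < N) x k * (y k)^*.
  move=> Nn; rewrite (@big_cat_nat _ _ _ N)//= [X in _ + X]big_nat_cond.
  rewrite [X in _ + X]big1 ?addr0//.
  by move=> i /andP[/andP[Ni _] _]; rewrite x0// mul0r.
apply: l2_dotP; apply/cvgrPdist_lt => e e0; near=> n;
  (rewrite E ?subrr ?normr0//; near: n; exact: nbhs_infty_ge).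
Unshelve. all: by end_near. Qed.

Lemma l2_dot_basisl n y : l2_dot (l2_basis n) y = (y n)^*.
Proof.
rewrite (@l2_dot_fin _ _ n.+1); last by move=> k nk; rewrite /= gtn_eqF.
rewrite big_nat_recr//= eqxx mul1r big_nat_cond big1 ?add0r// => i.
by move=> /andP[/andP[_ h] _]; rewrite ltn_eqF// mul0r.
Qed.

Lemma l2_dot_basisr n y : l2_dot y (l2_basis n) = y n.
Proof. by rewrite l2_dotC l2_dot_basisl conjCK. Qed.

Lemma l2_ext x y : (forall n, x n = y n) -> x = y.
Proof. by move=> H; apply: val_inj; apply/funext => n; exact: H. Qed.

Lemma l2DE x y n : (x + y) n = x n + y n. Proof. by []. Qed.
Lemma l2BE x y n : (x - y) n = x n - y n. Proof. by []. Qed.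
Lemma l2ZE c x n : (c *: x) n = c * x n. Proof. by []. Qed.
Lemma l2_dotDl x y z : l2_dot (x + y) z = l2_dot x z + l2_dot y z.
Proof. by rewrite -[x]scale1r l2_dot_linearl mul1r scale1r. Qed.

Lemma l2_dot0l z : l2_dot 0 z = 0.
Proof. by rewrite (@l2_dot_fin _ _ 0)// big_geq. Qed.

Lemma l2_dotZl c x z : l2_dot (c *: x) z = c * l2_dot x z.
Proof. by rewrite -[c *: x]addr0 l2_dot_linearl l2_dot0l addr0. Qed.

Lemma l2_dotBl x y z : l2_dot (x - y) z = l2_dot x z - l2_dot y z.
Proof. by rewrite -scaleN1r addrC l2_dot_linearl mulN1r addrC. Qed.

Lemma l2_dotDr x y z : l2_dot z (x + y) = l2_dot z x + l2_dot z y.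
Proof. by rewrite l2_dotC l2_dotDl rmorphD/= -!l2_dotC. Qed.

Lemma l2_dotBr x y z : l2_dot z (x - y) = l2_dot z x - l2_dot z y.
Proof. by rewrite l2_dotC l2_dotBl rmorphB/= -!l2_dotC. Qed.

Lemma l2_dotZr c x z : l2_dot z (c *: x) = c^* * l2_dot z x.
Proof. by rewrite l2_dotC l2_dotZl rmorphM/= -!l2_dotC. Qed.

Lemma l2_sqZ c x : l2_sq (c *: x) = normc2 c * l2_sq x.
Proof.
apply: (@cvg_lim R); first exact: Rhausdorff.
rewrite (_ : sqsum _ = normc2 c *: sqsum x); first exact: cvgZr (@l2_sq_cvg x).
by apply/funext => n; rewrite sqsumZ normc2E.
Qed.

Lemma l2_sqD_le x y : l2_sq (x + y) <= 2 * (l2_sq x + l2_sq y).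
Proof.
apply: l2_sq_le => n; apply: le_trans (sqsumD _ _ _ ltr01) _.
by rewrite invr1 -mulrDr ler_wpM2l// lerD// sqsum_le.
Qed.

Lemma l2_sq_eq0 x : l2_sq x = 0 -> x = 0.
Proof. by move=> h; apply: l2_norm_eq0; rewrite /l2_norm -/(l2_sq x) h sqrtr0. Qed.

Lemma l2_sq_fin x N : (forall n, (N <= n)%N -> x n = 0) ->
  l2_sq x = \sum_(0 <= k < N) normc2 (x k).
Proof.
move=> x0; apply: (@cvg_lim R); first exact: Rhausdorff.
apply/cvgrPdist_lt => e e0; near=> n.
have Nn : (N <= n)%N by near: n; exact: nbhs_infty_ge.
rewrite sqsumE [X in _ - X](@big_cat_nat _ _ _ N)//=.
rewrite [X in _ - (_ + X)]big_nat_cond [X in _ - (_ + X)]big1.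
  by rewrite addr0 subrr normr0.
by move=> i /andP[/andP[Ni _] _]; rewrite x0// /normc2 expr0n addr0.
Unshelve. all: by end_near. Qed.

Lemma l2_trunc_subproof N x :
  (fun n => if (n < N)%N then x n else 0) \in square_summable.
Proof.
apply/asboolP; apply: (@square_summableP _ _ (l2_sq x)) => m.
apply: le_trans (sqsum_le x m); rewrite !sqsumE; apply: ler_sum => i _.
by case: ifP => // _; rewrite {1}/normc2 expr0n addr0 normc2_ge0.
Qed.

Definition l2_trunc N x : l2 R := L2 (l2_trunc_subproof N x).

Lemma l2_truncE N x n : l2_trunc N x n = if (n < N)%N then x n else 0.
Proof. by []. Qed.

Lemma l2_trunc_cvg x (e : R) : 0 < e -> \forall N \near \oo, l2_sq (x - l2_trunc N x) < e.
Proof.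
move=> e0.
have e2 : 0 < e / 2 by rewrite divr_gt0.
near=> N.
have : `|l2_sq x - sqsum x N| < e / 2.
  by near: N; exact: (cvgrPdist_lt _ _).1 (@l2_sq_cvg x) _ e2.
rewrite ger0_norm ?subr_ge0 ?sqsum_le// => H.
apply: (@le_lt_trans _ _ (e / 2)); last by rewrite ltr_pdivrMr// ltr_pMr// ltr1n.
apply: l2_sq_le => n.
apply: le_trans (ltW H); rewrite lerBrDr.
(* With [maxn n N] the partial sum contains the first [N] terms even if [n < N]; they cancel against
   [sqsum x N]. *)
apply: le_trans (sqsum_le x (maxn n N)); rewrite !sqsumE.
rewrite [leRHS](@big_cat_nat _ _ _ N) ?leq_maxr// [leLHS]addrC lerD2l.
have [nN|Nn] := leqP n N.
  apply: (@le_trans _ _ 0); last by apply: sumr_ge0 => i _; exact: normc2_ge0.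
  rewrite big_nat_cond big1// => i /andP[/andP[_ ni] _].
  rewrite l2BE l2_truncE (leq_trans ni nN) subrr.
  by rewrite /normc2 expr0n addr0.
rewrite [leLHS](@big_cat_nat _ _ _ N) ?(ltnW Nn)//.
rewrite [X in X + _ <= _]big_nat_cond [X in X + _ <= _]big1 ?add0r; last first.
  move=> i /andP[/andP[_ ni] _]; rewrite l2BE l2_truncE ni subrr.
  by rewrite /normc2 expr0n addr0.
rewrite le_eqVlt; apply/orP; left; apply/eqP.
rewrite big_nat_cond [RHS]big_nat_cond; apply: eq_bigr => i /andP[/andP[Ni _] _].
by rewrite l2BE l2_truncE ltnNge Ni subr0.
Unshelve. all: by end_near. Qed.

Lemma l2_trunc_sum N x : l2_trunc N x = \sum_(0 <= k < N) x k *: l2_basis k.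
Proof.
apply: l2_ext => n; rewrite l2_truncE.
have -> : (\sum_(0 <= k < N) x k *: l2_basis k : l2 R) n =
   \sum_(0 <= k < N) x k * (n == k)%:R.
  elim: N => [|N IH]; first by rewrite !big_geq.
  by rewrite !big_nat_recr// l2DE IH.
elim: N => [|N IH]; first by rewrite big_geq.
rewrite big_nat_recr//= -IH ltnS leq_eqVlt.
by have [->|] := eqVneq n N; rewrite ?ltnn ?mulr1 ?add0r ?mulr0 ?addr0.
Qed.

Lemma l2_dot_basis_inj x y :
  (forall n, l2_dot x (l2_basis n) = l2_dot y (l2_basis n)) -> x = y.
Proof. by move=> H; apply: l2_ext => n; rewrite -!l2_dot_basisr. Qed.

End L2Dot.

(** * Hilbert-Schmidt operators *)

Section HilbertSchmidt.
Variable R : realType.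
Implicit Types (x y z : l2 R) (c : R[i]).

(** The squared Hilbert-Schmidt norm is at most [tau], stated on finite rectangles so that
    transposing only exchanges finite sums. *)
Definition hs_bound (K : nat -> nat -> R) (tau : R) := forall M N,
  \sum_(0 <= m < M) \sum_(0 <= n < N) K m n ^+ 2 <= tau.

Lemma hs_boundT (K : nat -> nat -> R) tau :
  hs_bound K tau -> hs_bound (fun m n => K n m) tau.
Proof. by move=> H M N; rewrite exchange_big_nat. Qed.

Lemma normc2_real (a : R) : normc2 a%:C = a ^+ 2.
Proof. by rewrite /normc2/= expr0n addr0. Qed.

Lemma hs_row_subproof (K : nat -> nat -> R) tau (HK : hs_bound K tau) m :
  (fun n => (K m n)%:C) \in square_summable.
Proof.
apply/asboolP; apply: (@square_summableP _ _ tau) => n.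
apply: le_trans (HK m.+1 n); rewrite sqsumE big_nat_recr//=.
under eq_bigr do rewrite normc2_real.
by rewrite lerDr; apply: sumr_ge0 => i _; apply: sumr_ge0 => j _; exact: sqr_ge0.
Qed.

Definition hs_row K tau (HK : hs_bound K tau) m : l2 R := L2 (hs_row_subproof HK m).

Lemma hs_row_sum_le K tau (HK : hs_bound K tau) M :
  \sum_(0 <= m < M) l2_sq (hs_row HK m) <= tau.
Proof.
have C : (fun n => \sum_(0 <= m < M) sqsum (hs_row HK m) n) @ \oo -->
    \sum_(0 <= m < M) l2_sq (hs_row HK m).
  apply: cvg_big => [|m _]; [exact: add_continuous|exact: l2_sq_cvg].
rewrite -(cvg_lim (@Rhausdorff R) C); apply: limr_le.
  by apply/cvg_ex; eexists; exact: C.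
near=> N; apply: le_trans (HK M N); apply: ler_sum => i _.
by rewrite sqsumE; apply: ler_sum => j _; rewrite normc2_real.
Unshelve. all: by end_near. Qed.

Lemma hs_sqsum_le K tau (HK : hs_bound K tau) x n :
  sqsum (fun m => l2_dot x (hs_row HK m)) n <= tau * l2_sq x.
Proof.
rewrite sqsumE; apply: (@le_trans _ _ (\sum_(0 <= m < n) l2_sq x * l2_sq (hs_row HK m))).
  by apply: ler_sum => i _; exact: l2_dot_le.
by rewrite -mulr_sumr mulrC ler_wpM2r ?l2_sq_ge0// hs_row_sum_le.
Qed.

Lemma hs_map_subproof K tau (HK : hs_bound K tau) x :
  (fun m => l2_dot x (hs_row HK m)) \in square_summable.
Proof. by apply/asboolP; apply: square_summableP; exact: hs_sqsum_le. Qed.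

(** The matrix-vector product with [K]: the entries are real, so the conjugation in [l2_dot] leaves
    them unchanged. *)
Definition hs_map K tau (HK : hs_bound K tau) x : l2 R := L2 (hs_map_subproof HK x).

Lemma hs_map_linear K tau (HK : hs_bound K tau) : linear (hs_map HK).
Proof. by move=> c x y; apply: l2_ext => n; rewrite /= l2_dot_linearl. Qed.

HB.instance Definition _ K tau (HK : hs_bound K tau) :=
  GRing.isLinear.Build _ _ _ _ (hs_map HK) (hs_map_linear HK).

Lemma l2_sq_hs_map K tau (HK : hs_bound K tau) x :
  l2_sq (hs_map HK x) <= tau * l2_sq x.
Proof. by apply: l2_sq_le => n; exact: hs_sqsum_le. Qed.

Lemma hs_bound_ge0 K tau : hs_bound K tau -> 0 <= tau.
Proof. by move=> /(_ 0 0); rewrite big_geq. Qed.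

Lemma l2_bounded_continuous (A : {linear l2 R -> l2 R}) (C : R) :
  (forall x, l2_sq (A x) <= C * l2_sq x) -> continuous A.
Proof.
move=> H x; apply/(@cvgrPdist_lt _ _ _ (nbhs x)) => e e0.
have e0' : 0 < Re e by move: e0; rewrite ltcE => /andP[].
have -> : e = (Re e)%:C by rewrite RRe_real// gtr0_real.
(* [C] may have any sign; [|C| + 1] is positive and its square dominates [C]. *)
have C1 : 0 < `|C| + 1 by rewrite ltr_wpDl.
have d0 : 0 < Re e / (`|C| + 1) by rewrite divr_gt0.
near=> z; rewrite -linearB.
have : `|x - z| < (Re e / (`|C| + 1))%:C.
  by near: z; apply: cvgr_dist_lt => //; rewrite ltcR.
rewrite !l2_norm_lt// => Hx; apply: le_lt_trans (H _) _.
apply: (@le_lt_trans _ _ ((`|C| + 1) ^+ 2 * l2_sq (x - z))).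
  apply: ler_wpM2r; first exact: l2_sq_ge0.
  apply: le_trans (ler_norm C) _; move: (normr_ge0 C); nra.
by rewrite mulrC -ltr_pdivlMr ?exprn_gt0// -expr_div_n.
Unshelve. all: by end_near. Qed.

Lemma normc2D (a b : R[i]) : normc2 (a + b) <= 2 * (normc2 a + normc2 b).
Proof.
case: a b => [a1 a2] [b1 b2]; rewrite /normc2/=.
have := sqr_ge0 (a1 - b1); have := sqr_ge0 (a2 - b2); nra.
Qed.

Lemma normc2N (a : R[i]) : normc2 (- a) = normc2 a.
Proof. by case: a => a b; rewrite /normc2/= !sqrrN. Qed.

Lemma normc2_eq0 (a : R[i]) : normc2 a <= 0 -> a = 0.
Proof.
rewrite -normc2E => h; apply: Normc.eq0_normc; apply/eqP.
by rewrite -sqrf_eq0 eq_le h sqr_ge0.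
Qed.

(* Both sides are continuous and additive in [y], so only basis vectors matter. *)
Lemma l2_adjoint_basis (A : {linear l2 R -> l2 R}) (C : R) x z :
  (forall y, l2_sq (A y) <= C * l2_sq y) ->
  (forall m, l2_dot z (l2_basis m) = l2_dot x (A (l2_basis m))) ->
  forall y, l2_dot z y = l2_dot x (A y).
Proof.
move=> HA Hb y.
have trE N : l2_dot z (l2_trunc N y) = l2_dot x (A (l2_trunc N y)).
  rewrite l2_trunc_sum; elim: N => [|N IH].
    by rewrite !big_geq// linear0 l2_dotC l2_dot0l l2_dotC l2_dot0l.
  rewrite !big_nat_recr// linearD linearZ !l2_dotDr IH; congr (_ + _).
  by rewrite !l2_dotZr Hb.
apply/eqP; rewrite -subr_eq0; apply/eqP/normc2_eq0.
set M := 2 * (l2_sq z + l2_sq x * `|C|).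
have M0 : 0 <= M.
  by rewrite mulr_ge0// addr_ge0 ?l2_sq_ge0// mulr_ge0 ?l2_sq_ge0.
have B N : normc2 (l2_dot z y - l2_dot x (A y)) <= M * l2_sq (y - l2_trunc N y).
  have -> : l2_dot z y - l2_dot x (A y) =
    l2_dot z (y - l2_trunc N y) + - l2_dot x (A (y - l2_trunc N y)).
    by rewrite linearB !l2_dotBr trE; ring.
  apply: le_trans (normc2D _ _) _; rewrite normc2N /M -mulrA ler_wpM2l// mulrDl.
  apply: lerD; first exact: l2_dot_le.
  apply: le_trans (l2_dot_le _ _) _; rewrite -mulrA; apply: ler_wpM2l; first exact: l2_sq_ge0.
  apply: le_trans (HA _) _; apply: ler_wpM2r; [exact: l2_sq_ge0|exact: ler_norm].
apply/ler_addgt0Pr => e e0; rewrite add0r.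
have [N _ HN] := @l2_trunc_cvg R y (e / (M + 1)) (divr_gt0 e0 (ltr_wpDl M0 ltr01)).
apply: le_trans (B N) _.
have /ltW := HN N (leqnn N); rewrite ler_pdivlMr ?ltr_wpDl// => h.
apply: le_trans h; rewrite mulrC; apply: ler_wpM2l; first exact: l2_sq_ge0.
by rewrite lerDl.
Qed.

Lemma hs_map_basis K tau (HK : hs_bound K tau) n m :
  hs_map HK (l2_basis n) m = (K m n)%:C.
Proof.
rewrite [LHS]l2_dot_basisl; apply: conj_Creal.
by rewrite [hs_row HK m n]/((K m n)%:C) complex_real.
Qed.

Lemma hs_adjoint K tau (HK : hs_bound K tau) (HK' : hs_bound (fun m n => K n m) tau) :
  adjoint_map (hs_map HK) (hs_map HK').
Proof.
move=> x y; apply: (l2_adjoint_basis (l2_sq_hs_map HK')) => m.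
rewrite l2_dot_basisr [LHS]/=; congr (l2_dot x _); apply: l2_ext => n.
by rewrite hs_map_basis.
Qed.

End HilbertSchmidt.

(** * Jacobi operators with a bidiagonal factorization *)

Section L2Closure.
Variable R : realType.
Implicit Types (x y z : l2 R) (S : set (l2 R * l2 R)).

Lemma l2_nbhs_sq x (e : R) : 0 < e -> nbhs x [set z | l2_sq (x - z) < e].
Proof.
move=> e0.
have d0 : 0 < Num.sqrt e by rewrite sqrtr_gt0.
near=> z; rewrite /= -(sqr_sqrtr (ltW e0)) -l2_norm_lt//.
by near: z; apply: cvgr_dist_lt => //; rewrite ltcR.
Unshelve. all: by end_near. Qed.

Lemma l2_nbhsE x (A : set (l2 R)) : nbhs x A ->
  exists2 e : R, 0 < e & forall z, l2_sq (x - z) < e -> A z.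
Proof.
move=> /nbhs_normP[e /= e0 H].
have e0' : 0 < Re e by move: e0; rewrite ltcE => /andP[].
exists (Re e ^+ 2); first by rewrite exprn_gt0.
move=> z Hz; apply: H => /=.
have -> : e = (Re e)%:C by rewrite RRe_real// gtr0_real.
by rewrite l2_norm_lt.
Qed.

Lemma l2_closureP S x y : closure S (x, y) <->
  forall e : R, 0 < e -> exists x' y',
    [/\ S (x', y'), l2_sq (x - x') < e & l2_sq (y - y') < e].
Proof.
split=> [H e e0|H B [[P Q] /= [/l2_nbhsE[e e0 He] /l2_nbhsE[f f0 Hf]] PQ]].
  have [] := H ([set z | l2_sq (x - z) < e] `*` [set z | l2_sq (y - z) < e]).
    by exists ([set z | l2_sq (x - z) < e], [set z | l2_sq (y - z) < e]) => //;
      split; exact: l2_nbhs_sq.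
  by move=> [x' y'] [Sxy [/= hx hy]]; exists x', y'.
have m0 : 0 < Num.min e f by rewrite lt_min e0.
have [x' [y' [Sxy hx hy]]] := H _ m0.
exists (x', y'); split=> //; apply: PQ; split=> /=.
  by apply: He; rewrite (lt_le_trans hx)// ge_min lexx.
by apply: Hf; rewrite (lt_le_trans hy)// ge_min lexx orbT.
Qed.

Lemma square_summable_fin (u : nat -> R[i]) N :
  (forall n, (N <= n)%N -> u n = 0) -> u \in square_summable.
Proof.
move=> u0; apply/asboolP; apply: (@square_summableP _ _ (sqsum u N)) => n.
have [nN|Nn] := leqP n N; first exact: sqsum_nondecreasing.
rewrite !sqsumE (@big_cat_nat _ _ _ N) ?(ltnW Nn)//= [X in _ + X]big_nat_cond.
rewrite [X in _ + X]big1 ?addr0// => i /andP[/andP[Ni _] _].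
by rewrite u0// /normc2 expr0n addr0.
Qed.

Lemma real_complexJ (t : R) : (t%:C : R[i])^* = t%:C.
Proof. by apply: conj_Creal; rewrite complex_real. Qed.

Lemma cvg_real_complex (u : nat -> R) (l : R) : u @ \oo --> l ->
  (fun n => (u n)%:C : R[i]^o) @ \oo --> (l%:C : R[i]^o).
Proof. by move=> h; apply: cvg_complex => //=; exact: cvg_cst. Qed.

End L2Closure.

(* The inverse of the lower bidiagonal matrix with entries [sqrt (lam n)] at
   [(n, n)] and [sqrt (mu n)] at [(n, n - 1)], by forward substitution. *)
Fixpoint bidiag_inv (R : realType) (lam mu : nat -> R) (m n : nat) : R :=
  ((n == m)%:R - (if m is m'.+1 then Num.sqrt (mu m) * bidiag_inv lam mu m' n else 0))
  / Num.sqrt (lam m).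

(** * The closure of [L L^T] as the graph of an inverse *)

Section BidiagonalJacobi.
Variables (R : realType) (lam mu : nat -> R).
Hypotheses (lam_gt0 : forall n, 0 < lam n) (mu0 : mu 0 = 0)
  (mu_gt0 : forall n, 0 < mu n.+1).

Let a n := Num.sqrt (lam n * mu n.+1).
Let b n := lam n + mu n.
Let s n := Num.sqrt (lam n).
Let t n := Num.sqrt (mu n).

Local Notation T := (bidiag_inv lam mu).

Let s_neq0 n : s n != 0.
Proof. by rewrite gt_eqF// sqrtr_gt0. Qed.

(** This and [bidiag_invS] are the rows of [L T = 1]. *)
Lemma bidiag_inv0 n : s 0 * T 0 n = (n == 0)%:R.
Proof. by rewrite /= subr0 mulrC divfK//; exact: s_neq0. Qed.

Lemma bidiag_invS m n : s m.+1 * T m.+1 n + t m.+1 * T m n = (n == m.+1)%:R.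
Proof. by rewrite [T m.+1 n]/= mulrC divfK ?subrK//; exact: s_neq0. Qed.

Arguments bidiag_inv : simpl never.

Lemma bidiag_inv_gt m n : (m < n)%N -> T m n = 0.
Proof.
have := bidiag_invS; have := bidiag_inv0; move: T => U U0 US.
elim: m => [|m IH] mn.
  by apply: (mulfI (s_neq0 0)); rewrite mulr0 U0 gtn_eqF.
apply: (mulfI (s_neq0 m.+1)); rewrite mulr0.
by have := US m n; rewrite IH ?mulr0 ?addr0 ?gtn_eqF// ltnW.
Qed.

(** The identity [T L = 1], by induction on the row: multiplied by [s m.+1], row [m.+1] reduces to
    row [m] through [L T = 1]. *)
Lemma bidiag_inv_col m n : T m n * s n + T m n.+1 * t n.+1 = (m == n)%:R.
Proof.
have := bidiag_inv_gt; have := bidiag_invS; have := bidiag_inv0.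
move: T => U U0 US Ugt; elim: m => [|m IH].
  rewrite [U 0 n.+1]Ugt// mul0r addr0 mulrC.
  by case: n => [|n]; [rewrite U0|rewrite Ugt// mulr0].
apply: (mulfI (s_neq0 m.+1)); rewrite mulrDr !mulrA.
have E k : s m.+1 * U m.+1 k = (k == m.+1)%:R - t m.+1 * U m k.
  by rewrite -US addrK.
rewrite !E !mulrBl addrACA -opprD -!mulrA -mulrDr IH eqSS [m.+1 == n]eq_sym [m == n]eq_sym.
have [->|nm] := eqVneq n m.+1; first by rewrite !gtn_eqF//=; ring.
by have [->|_] := eqVneq n m => /=; ring.
Qed.

Variable tau : R.
Hypothesis T_bound : hs_bound T tau.
(** Column [n] of [T], cut after a row [m >= n], is mapped by [L] to the [n]-th basis vector plus
    this quantity at index [m.+1]. *)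
Hypothesis T_decay : forall n, (fun m => t m.+1 * T m n) @ \oo --> (0 : R).

Let T_boundT := hs_boundT T_bound.
Let A := hs_map T_bound.
Let A' := hs_map T_boundT.

Let mapE (w : l2 R) m : A w m = \sum_(0 <= n < m.+1) (T m n)%:C * w n.
Proof.
rewrite [LHS]l2_dotC (@l2_dot_fin _ _ _ m.+1); last first.
  by move=> n mn; rewrite [LHS]/((T m n)%:C) bidiag_inv_gt.
rewrite rmorph_sum; apply: eq_bigr => n _.
by rewrite rmorphM/= conjCK real_complexJ.
Qed.

Let map0 (w : l2 R) : (s 0)%:C * A w 0 = w 0.
Proof.
by rewrite mapE big_nat1 mulrA -rmorphM bidiag_inv0 rmorph1 mul1r.
Qed.

Let mapS (w : l2 R) m : (s m.+1)%:C * A w m.+1 + (t m.+1)%:C * A w m = w m.+1.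
Proof.
rewrite !mapE [X in (s _)%:C * X]big_nat_recr//= mulrDr !mulr_sumr addrAC -big_split/=.
rewrite big_nat_cond big1 ?add0r.
  rewrite mulrA -rmorphM.
  have := bidiag_invS m m.+1; rewrite [T m m.+1]bidiag_inv_gt// mulr0 addr0 eqxx => ->.
  by rewrite mul1r.
move=> i /andP[/andP[_ im] _]; rewrite !mulrA -mulrDl -!rmorphM -rmorphD/=.
by rewrite bidiag_invS ltn_eqF// rmorph0 mul0r.
Qed.

(** Forward substitution: [w = L v] has one solution. The equations are used entry by entry, so [v]
    can be any sequence. *)
Let map_uniq (v : nat -> R[i]) (w : l2 R) :
  w 0 = (s 0)%:C * v 0 -> (forall m, w m.+1 = (s m.+1)%:C * v m.+1 + (t m.+1)%:C * v m) ->
  forall n, A w n = v n.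
Proof.
move=> h0 hS; have sC n : (s n)%:C != 0 :> R[i].
  by rewrite -(rmorph0 (real_complex R)) (inj_eq (@complexI R)).
elim=> [|n IH]; [apply: (mulfI (sC 0)) | apply: (mulfI (sC n.+1))]; first by rewrite map0.
by have := mapS w n; rewrite hS IH => /addIr.
Qed.

Let mapT_back (v : l2 R) n : (s n)%:C * A' v n + (t n.+1)%:C * A' v n.+1 = v n.
Proof.
rewrite [A' v n]/(l2_dot _ _) [A' v n.+1]/(l2_dot _ _).
have -> (c : R) (x y : l2 R) : c%:C * l2_dot x y = l2_dot x (c%:C *: y).
  by rewrite l2_dotZr real_complexJ.
have -> (c : R) (x y : l2 R) : c%:C * l2_dot x y = l2_dot x (c%:C *: y).
  by rewrite l2_dotZr real_complexJ.
rewrite -l2_dotDr -l2_dot_basisr; congr (l2_dot _ _); apply: l2_ext => m.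
rewrite l2DE !l2ZE [hs_row _ _ _]/((T m n)%:C) [hs_row _ _ _]/((T m n.+1)%:C).
by rewrite -!rmorphM -rmorphD/= mulrC [t _ * _]mulrC bidiag_inv_col; case: eqP.
Qed.

(** The transpose [L^T] acting on sequences. *)
Let B (x : nat -> R[i]) n := (s n)%:C * x n + (t n.+1)%:C * x n.+1.

(** This is [L L^T] multiplied out, with [a k = s k * t k.+1]; the corner entry agrees because
    [mu 0 = 0]. *)
Lemma jacobi_action_factor x n : jacobi_action a b x n =
  (s n)%:C * B x n + (if n is m.+1 then (t n)%:C * B x m else 0).
Proof.
have aE k : a k = s k * t k.+1 by rewrite /a sqrtrM// ltW.
have lamE k : lam k = s k * s k by rewrite -expr2 sqr_sqrtr// ltW.
have muE k : mu k = t k * t k.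
  rewrite -expr2 sqr_sqrtr//; case: k => [|k]; first by rewrite mu0.
  exact: ltW.
rewrite /jacobi_action /B /b; case: n => [|n].
  by rewrite lamE mu0 aE addr0 !rmorphM/=; ring.
by rewrite lamE muE !aE rmorphD !rmorphM/=; ring.
Qed.

(** [T^T L^T x = x] for finitely supported [x]: tested on a basis vector, it becomes [L T = 1] once
    [L^T] is moved onto the column of [T]. *)
Let mapT_fin (x y : l2 R) N : (forall n, (N <= n)%N -> x n = 0) ->
  l2_seq y =1 B x -> A' y = x.
Proof.
move=> x0 yE; apply: l2_dot_basis_inj => m.
rewrite (hs_adjoint T_boundT T_bound) l2_dot_basisr.
rewrite (@l2_dot_fin _ _ _ N); last first.
  by move=> n Nn; rewrite yE /B !x0// ?mulr0 ?addr0// leqW.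
(* Summation by parts; the last summand is the boundary term, which vanishes at [M = N]. *)
have H M : \sum_(0 <= k < M) y k * (hs_map T_bound (l2_basis m) k)^* =
   \sum_(0 <= k < M) x k * (m == k)%:R +
   (if M is M'.+1 then (t M)%:C * x M * (T M' m)%:C else 0).
  elim: M => [|M IH]; first by rewrite !big_geq// addr0.
  rewrite !big_nat_recr// IH yE hs_map_basis real_complexJ /B.
  rewrite -[LHS]addrA -[RHS]addrA; congr (_ + _).
  have E : (m == M)%:R = (s M * T M m + (if M is M'.+1 then t M * T M' m else 0))%:C :> R[i].
    case: (M) => [|k]; first by rewrite bidiag_inv0 addr0 rmorph_nat.
    by rewrite bidiag_invS rmorph_nat.
  rewrite E; case: (M) => [|k]; rewrite ?addr0 ?rmorphD/= ?rmorphM/=; ring.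
rewrite H.
have -> : (if N is M'.+1 then (t N)%:C * x N * (T M' m)%:C else 0) = 0.
  by case: (N) x0 => // k x0; rewrite x0// mulr0 mul0r.
rewrite addr0; have [mN|Nm] := ltnP m N.
  rewrite (bigD1_seq m) ?mem_index_iota ?iota_uniq//= eqxx mulr1 big1 ?addr0//.
  by move=> i /negbTE; rewrite eq_sym => ->; rewrite mulr0.
rewrite x0// big_nat_cond big1// => i /andP[/andP[_ iN] _].
by rewrite gtn_eqF ?mulr0// (leq_trans iN).
Qed.

Let J0 := [set xy : l2 R * l2 R |
    finitely_supported xy.1 /\ l2_seq xy.2 = jacobi_action a b xy.1].

(** From [y = L (L^T x)], forward substitution gives [T y = L^T x], which is finitely supported, and
    [T^T] then returns [x]. *)
Let J0_inv x y : J0 (x, y) -> A' (A y) = x.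
Proof.
move=> [[N /= x0] yE].
have vP : B x \in square_summable.
  apply: (@square_summable_fin _ _ N) => n Nn.
  by rewrite /B !x0// ?mulr0 ?addr0// leqW.
have E : A y = L2 vP.
  apply: l2_ext => n; apply: map_uniq => [|m].
    by rewrite yE jacobi_action_factor addr0.
  by rewrite yE jacobi_action_factor.
by rewrite E; apply: (mapT_fin x0).
Qed.

Let J0_fin (x : l2 R) : finitely_supported x -> exists y, J0 (x, y).
Proof.
move=> [N x0]; have yP : jacobi_action a b x \in square_summable.
  apply: (@square_summable_fin _ _ N.+1) => -[//|n] Nn.
  by rewrite /jacobi_action !x0 ?mulr0 ?addr0// !leqW.
by exists (L2 yP); split => //; exists N.
Qed.

(** Density of the range. Cut [y] to [y'], then [T y'] to a finitely supported [v]. The vector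
    [w = L v] differs from [y'] in one entry, small by [T_decay], and [T^T v] is finitely
    supported. *)
Let J0_dense (y : l2 R) (e : R) : 0 < e -> exists2 w, J0 (A' (A w), w) & l2_sq (y - w) < e.
Proof.
move=> e0; have e4 : 0 < e / 4 by rewrite divr_gt0.
have [N _ HN] := @l2_trunc_cvg R y (e / 4) e4.
have {HN} := HN N (leqnn N); set y' := l2_trunc N y => Hy.
have y'0 n : (N <= n)%N -> y' n = 0 by rewrite l2_truncE ltnNge => ->.
(* Only the columns below [N] enter [A y'], so the decay of finitely many columns suffices, combined
   by Cauchy-Schwarz. *)
have [M NM HM] : exists2 M, (N <= M)%N & normc2 ((t M.+1)%:C * A y' M) < e / 4.
  have C : (fun M => sqsum y' N * \sum_(0 <= k < N) (t M.+1 * T M k) ^+ 2) @ \oo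
      --> (sqsum y' N * \sum_(0 <= k < N) 0 ^+ 2 : R).
    apply: cvgM; first exact: cvg_cst.
    apply: cvg_big => [|k _]; first exact: add_continuous.
    by under eq_fun do rewrite expr2; rewrite expr2; apply: cvgM; exact: T_decay.
  rewrite big1 ?mulr0 in C; last by move=> k _; rewrite expr0n.
  near \oo => M; have NM : (N <= M)%N by near: M; exact: nbhs_infty_ge.
  exists M => //.
  have H : sqsum y' N * \sum_(0 <= k < N) (t M.+1 * T M k) ^+ 2 < e / 4.
    apply: le_lt_trans (ler_norm _) _; rewrite -normrN -sub0r.
    by near: M; exact: (cvgrPdist_lt _ _).1 C _ e4.
  apply: le_lt_trans H; rewrite [leRHS]mulrC.
  rewrite mapE.
  have -> : \sum_(0 <= i < M.+1) (T M i)%:C * y' i = \sum_(0 <= i < N) (T M i)%:C * y' i.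
    rewrite (@big_cat_nat _ _ _ N) ?leqW//= [X in _ + X]big_nat_cond.
    rewrite [X in _ + X]big1 ?addr0// => i /andP[/andP[Ni _] _].
    by rewrite ltnNge Ni mulr0.
  rewrite [X in normc2 X]mulr_sumr.
  have -> : \sum_(0 <= i < N) (t M.+1)%:C * ((T M i)%:C * y' i) =
      \sum_(0 <= i < N) (t M.+1 * T M i)%:C * ((y' i)^*)^*.
    by apply: eq_bigr => i _; rewrite conjCK rmorphM mulrA.
  apply: le_trans (normc2_sum_le _ (fun i => (y' i)^*) N) _.
  rewrite !sqsumE; under eq_bigr do rewrite normc2_real.
  by under [X in _ * X]eq_bigr do rewrite normc2J.
pose v := l2_trunc M.+1 (A y').
(* The entry of [L v] at [M.+1] is [t M.+1 * A y' M], whereas [y'] is [0] there; all other entries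
   agree. *)
pose w := y' + ((t M.+1)%:C * A y' M) *: l2_basis M.+1.
have wE0 : w 0 = (s 0)%:C * v 0.
  by rewrite l2DE l2ZE mulr0 addr0 l2_truncE map0.
have wES m : w m.+1 = (s m.+1)%:C * v m.+1 + (t m.+1)%:C * v m.
  rewrite l2DE l2ZE [l2_basis _ _]/((m.+1 == M.+1)%:R) !l2_truncE eqSS.
  have [mM|mM|->] := ltngtP m M.
  - by rewrite !ltnS mM (ltnW mM) mapS l2_truncE mulr0 addr0.
  - have h1 : (m < M)%N = false by rewrite ltnNge ltnW.
    have h2 : (m < M.+1)%N = false by rewrite ltnS leqNgt mM.
    have h3 : (m.+1 < N)%N = false.
      by apply/negbTE; rewrite -leqNgt leqW// (leq_trans NM)// ltnW.
    by rewrite ltnS h1 h2 h3 !mulr0 !addr0.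
  - have h3 : (M.+1 < N)%N = false by apply/negbTE; rewrite -leqNgt leqW.
    by rewrite ltnS ltnn ltnSn h3 add0r mulr0 add0r mulr1.
have AwE : A w = v by apply: l2_ext => n; exact: map_uniq.
exists w.
  rewrite AwE; split.
    exists M.+1 => m Mm; transitivity (l2_dot v (hs_row T_boundT m)); first by [].
    rewrite (@l2_dot_fin _ v _ M.+1); last by move=> n Mn; rewrite l2_truncE ltnNge Mn.
    rewrite big_nat_cond big1// => i /andP[/andP[_ iM] _].
    by rewrite [hs_row _ _ _]/((T i m)%:C) bidiag_inv_gt ?conjC0 ?mulr0// (leq_trans iM).
  suff E n : w n = jacobi_action a b (A' v) n by apply/funext.
  rewrite jacobi_action_factor /B; case: n => [|n].
    by rewrite mapT_back addr0 wE0.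
  by rewrite !mapT_back wES.
rewrite (_ : y - w = (y - y') - ((t M.+1)%:C * A y' M) *: l2_basis M.+1); last first.
  by rewrite /w opprD addrA.
apply: le_lt_trans (l2_sqD_le _ _) _.
rewrite -scaleNr l2_sqZ normc2N (@l2_sq_fin _ (l2_basis M.+1) M.+2); last first.
  by move=> n Mn; rewrite [LHS]/((n == M.+1)%:R) gtn_eqF.
rewrite big_nat_recr//= big_nat_cond big1.
  rewrite add0r eqxx /normc2/= expr1n expr0n addr0 mulr1.
  by move: Hy HM; rewrite -/(normc2 _); lra.
move=> i /andP[/andP[_ iM] _]; rewrite ltn_eqF// /normc2/=.
by rewrite expr0n addr0.
Unshelve. all: by end_near. Qed.

Let G : {linear l2 R -> l2 R} := A' \o A.

Let G_sq_le y : l2_sq (G y) <= tau ^+ 2 * l2_sq y.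
Proof.
apply: le_trans (l2_sq_hs_map T_boundT (A y)) _.
rewrite expr2 -mulrA ler_wpM2l ?(hs_bound_ge0 T_bound)//.
exact: l2_sq_hs_map.
Qed.

Let G_sym x y : l2_dot (G x) y = l2_dot x (G y).
Proof.
transitivity (l2_dot (A x) (A y)); first exact: (hs_adjoint T_boundT T_bound).
exact: (hs_adjoint T_bound T_boundT).
Qed.

Let G_dot x : l2_dot (G x) x = (l2_sq (A x))%:C.
Proof. by rewrite -l2_dotxx; exact: (hs_adjoint T_boundT T_bound). Qed.

(** [G] is bounded and inverts [J0], so [x = G y] survives the closure; conversely [(G y, y)] is
    approximated because the range of [J0] is dense. *)
Let jacobi_graph x y : jacobi_operator a b (x, y) <-> x = G y.
Proof.
split=> [/l2_closureP H|->]; last first.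
  apply/l2_closureP => e e0.
  (* This radius keeps both the error in [y] and [tau ^+ 2] times that error below [e]. *)
  have d0 : 0 < e / (tau ^+ 2 + 1) by rewrite divr_gt0// ltr_wpDl// sqr_ge0.
  have [w Jw Hw] := @J0_dense y _ d0.
  exists (G w), w; split => //.
    rewrite -linearB (le_lt_trans (G_sq_le _))//.
    move: Hw; rewrite ltr_pdivlMr ?ltr_wpDl ?sqr_ge0//; apply: le_lt_trans.
    by rewrite mulrC ler_wpM2l ?l2_sq_ge0// lerDl.
  apply: lt_le_trans Hw _; rewrite ler_pdivrMr ?ltr_wpDl ?sqr_ge0//.
  by rewrite ler_peMr ?(ltW e0)// lerDr sqr_ge0.
apply/eqP; rewrite -subr_eq0; apply/eqP/l2_sq_eq0/eqP.
rewrite eq_le l2_sq_ge0 andbT; apply/ler_addgt0Pr => e e0; rewrite add0r.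
pose c := 2 * (1 + tau ^+ 2).
have c0 : 0 < c by rewrite mulr_gt0// ltr_pwDl// sqr_ge0.
have [x' [y' [J hx hy]]] := H (e / c) (divr_gt0 e0 c0).
have Ex' : G y' = x' := J0_inv J.
rewrite (_ : x - G y = (x - x') + G (y' - y)); last first.
  by rewrite linearB Ex' addrA subrK.
apply: le_trans (l2_sqD_le _ _) _.
have hy2 : l2_sq (G (y' - y)) <= tau ^+ 2 * (e / c).
  apply: le_trans (G_sq_le _) _; rewrite ler_wpM2l ?sqr_ge0//.
  by rewrite -opprB -scaleN1r l2_sqZ normc2N /normc2/= expr1n expr0n addr0 mul1r ltW.
have -> : e = 2 * (e / c + tau ^+ 2 * (e / c)).
  by rewrite -[X in X + _]mul1r -mulrDl mulrA -/c mulrC divfK// gt_eqF.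
by rewrite ler_wpM2l// lerD// ltW.
Qed.

(** Truncations lie in the domain and are dense. An element of the adjoint is identified by testing
    it on the pairs [(G e_n, e_n)] of the graph; the other inclusion is the symmetry of [G]. *)
Lemma bidiag_self_adjoint : self_adjoint (jacobi_operator a b).
Proof.
split.
  move=> O [x Ox] oO; have /l2_nbhsE[e e0 He] : nbhs x O.
    by rewrite nbhsE/=; exists O.
  have [N _ HN] := @l2_trunc_cvg R x e e0.
  exists (l2_trunc N x); split; first by apply: He; exact: (HN N (leqnn N)).
  have [|y Jy] := @J0_fin (l2_trunc N x).
    by exists N => n Nn; rewrite l2_truncE ltnNge Nn.
  by exists y; apply: subset_closure.
apply/seteqP; split=> -[u v].
  move=> H; apply/jacobi_graph; apply: l2_dot_basis_inj => n.
  rewrite G_sym l2_dotC [RHS]l2_dotC; congr (_^*).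
  by rewrite (H (G (l2_basis n)))//; exact/jacobi_graph.
by move=> /jacobi_graph -> x w /jacobi_graph ->; rewrite G_sym.
Qed.

Lemma bidiag_positive : positive_op (jacobi_operator a b).
Proof.
move=> x y /jacobi_graph ->.
by rewrite -G_sym G_dot ler0c l2_sq_ge0.
Qed.

(** The inverse [G = T^T T] is positive, hence its own absolute value, and its trace is the sum of
    the squared norms of the columns of [T]. *)
Lemma bidiag_inverse_trace_class :
  exists2 A : {linear l2 R -> l2 R},
    op_inverse (jacobi_operator a b) A & trace_class A.
Proof.
have Gc : continuous G := l2_bounded_continuous G_sq_le.
exists G => //; split=> //; exists G.
  split=> // [x|]; first by rewrite G_dot ler0c l2_sq_ge0.
  by exists G.
rewrite (_ : series _ = (fun N =>
  (\sum_(0 <= n < N) l2_sq (A (l2_basis n)))%:C : R[i]^o)); last first.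
  apply/funext => N; rewrite /series/= rmorph_sum/=; apply: eq_bigr => n _.
  exact: G_dot.
suff : cvgn (fun N => \sum_(0 <= n < N) l2_sq (A (l2_basis n))).
  by move=> /cvg_ex[l Hl]; apply/cvg_ex; exists l%:C; exact: cvg_real_complex.
apply: nondecreasing_is_cvgn.
  by apply: nondecreasing_series => n _ _; exact: l2_sq_ge0.
exists tau => _ [N _ <-]; apply: le_trans (hs_row_sum_le T_boundT N).
apply: ler_sum => n _; rewrite le_eqVlt; apply/orP; left; apply/eqP.
congr l2_sq; apply: l2_ext => m; exact: hs_map_basis.
Qed.

End BidiagonalJacobi.

(** * Orthogonal polynomials and their integrals *)

Section Tridiagonal.
Variable K : comNzRingType.
Implicit Types (a b u v : nat -> K).

(** Stated over a ring because it is applied to real, complex and polynomial sequences. *)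
Definition tridiag a b u n : K :=
  (if n is m.+1 then a m * u m else 0) + b n * u n + a n * u n.+1.

(** Discrete Green formula: the diagonal parts cancel and the off-diagonal parts telescope. *)
Lemma tridiag_green a b u v n :
  \sum_(0 <= k < n.+1) (tridiag a b u k * v k - u k * tridiag a b v k) =
  a n * (u n.+1 * v n - u n * v n.+1).
Proof.
elim: n => [|n IH]; first by rewrite big_nat1 /tridiag; ring.
by rewrite big_nat_recr// IH /tridiag/=; ring.
Qed.

(** The sum includes index [N], where [tridiag a b u] may still be nonzero. *)
Lemma tridiag_green_fin a b u v N : (forall n, (N <= n)%N -> u n = 0) ->
  \sum_(0 <= k < N.+1) tridiag a b u k * v k =
  \sum_(0 <= k < N.+1) u k * tridiag a b v k.
Proof.
move=> u0; apply/eqP; rewrite -subr_eq0 -sumrB tridiag_green !u0//.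
by rewrite !mul0r subr0 mulr0.
Qed.

End Tridiagonal.

Section PolyIntegral.
Variables (R : realType) (nu : probability R R).
Implicit Types (f g : {poly R}).

Definition poly_integrable f := nu.-integrable setT (fun x => (f.[x])%:E).

Definition poly_mean f : R := \int[nu]_x f.[x].

Lemma poly_integrableD f g :
  poly_integrable f -> poly_integrable g -> poly_integrable (f + g).
Proof.
move=> If Ig; have := integrableD measurableT If Ig.
by apply: eq_integrable => // x _ /=; rewrite hornerD.
Qed.

Lemma poly_integrableZ c f : poly_integrable f -> poly_integrable (c *: f).
Proof.
move=> If; have := integrableZl measurableT c If.
by apply: eq_integrable => // x _ /=; rewrite hornerZ.
Qed.

Lemma poly_integrable0 : poly_integrable 0.
Proof.
have := integrable0 nu setT.
by apply: eq_integrable => // x _ /=; rewrite horner0.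
Qed.

Lemma poly_integrable_sum (I : eqType) (r : seq I) (F : I -> {poly R}) :
  (forall i, i \in r -> poly_integrable (F i)) -> poly_integrable (\sum_(i <- r) F i).
Proof.
elim: r => [|i r IH] H; first by rewrite big_nil; exact: poly_integrable0.
rewrite big_cons; apply: poly_integrableD; first by apply: H; rewrite mem_head.
by apply: IH => j jr; apply: H; rewrite in_cons jr orbT.
Qed.

Lemma poly_meanD f g : poly_integrable f -> poly_integrable g ->
  poly_mean (f + g) = poly_mean f + poly_mean g.
Proof.
move=> If Ig; rewrite /poly_mean -RintegralD//.
by apply: eq_Rintegral => x _; rewrite hornerD.
Qed.

Lemma poly_meanZ c f : poly_integrable f -> poly_mean (c *: f) = c * poly_mean f.
Proof.
move=> If; rewrite /poly_mean -RintegralZl//.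
by apply: eq_Rintegral => x _; rewrite hornerZ.
Qed.

Lemma poly_mean0 : poly_mean 0 = 0.
Proof. by rewrite -[0](scale0r 0) poly_meanZ ?mul0r//; exact: poly_integrable0. Qed.

Lemma poly_mean_sum (I : eqType) (r : seq I) (F : I -> {poly R}) :
  (forall i, i \in r -> poly_integrable (F i)) ->
  poly_mean (\sum_(i <- r) F i) = \sum_(i <- r) poly_mean (F i).
Proof.
elim: r => [|i r IH] H; first by rewrite !big_nil poly_mean0.
rewrite !big_cons poly_meanD ?IH//.
- by move=> j jr; apply: H; rewrite in_cons jr orbT.
- by apply: H; rewrite mem_head.
- by apply: poly_integrable_sum => j jr; apply: H; rewrite in_cons jr orbT.
Qed.

Lemma poly_mean1 : poly_mean 1 = 1.
Proof.
rewrite /poly_mean; under eq_Rintegral do rewrite hornerC.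
by rewrite Rintegral_cst//= probability_setT/= mul1r.
Qed.

End PolyIntegral.

(** * Orthonormal polynomials of a Jacobi matrix *)

Section Moments.
Variables (R : realType) (a b : nat -> R) (p : nat -> {poly R}).
Hypothesis a_gt0 : forall n, 0 < a n.
Hypothesis p0 : p 0 = 1.
Hypothesis Xp : forall n, 'X * p n =
  p n.+1 + b n *: p n + (if n is m.+1 then a m ^+ 2 *: p m else 0).

Let kappa n : R := \prod_(0 <= i < n) a i.

Let kappaS n : kappa n.+1 = kappa n * a n.
Proof. by rewrite /kappa big_nat_recr. Qed.

Let kappa_gt0 n : 0 < kappa n.
Proof. by elim: n => [|n IH]; [rewrite /kappa big_geq|rewrite kappaS mulr_gt0]. Qed.

(** The orthonormal polynomials: the product of the first [n] entries [a i] is the norm of [p n] for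
    every orthogonality measure. *)
Definition onp n : {poly R} := (\prod_(0 <= i < n) a i)^-1 *: p n.

Lemma onp0 : onp 0 = 1.
Proof. by rewrite /onp big_geq// invr1 scale1r p0. Qed.

Let pE n : p n = kappa n *: onp n.
Proof. by rewrite scalerA divff ?scale1r// gt_eqF. Qed.

Lemma onp_rec n : 'X * onp n =
  (if n is m.+1 then a m *: onp m else 0) + b n *: onp n + a n *: onp n.+1.
Proof.
rewrite /onp -scalerAr Xp -!/(kappa _) !scalerDr !scalerA.
have K0 m : kappa m != 0 by rewrite gt_eqF.
have a0 m : a m != 0 by rewrite gt_eqF.
rewrite addrC [X in _ + X = _]addrC addrA; congr (_ + _ + _).
- case: n => [|n]; first by rewrite scaler0.
  rewrite -!/(kappa _) kappaS !scalerA; congr (_ *: _); field.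
  by rewrite K0 a0.
- by rewrite mulrC.
- by rewrite kappaS; congr (_ *: _); field; rewrite K0 a0.
Qed.

Lemma onp_tridiag x n : tridiag a b (fun k => (onp k).[x]) n = x * (onp n).[x].
Proof.
have := congr1 (horner^~ x) (onp_rec n); rewrite hornerM hornerX => ->.
rewrite /tridiag !hornerD !hornerZ; congr (_ + _ + _).
by case: n => [|n]; rewrite ?hornerZ ?horner0.
Qed.

(** Since [a n] is nonzero, row [n] of the eigenvalue equation determines entry [n.+1]; the
    induction carries two consecutive entries. *)
Lemma tridiag_uniq x (u : nat -> R) N :
  (forall n, (n < N)%N -> tridiag a b u n = x * u n) ->
  forall n, (n <= N)%N -> u n = u 0 * (onp n).[x].
Proof.
move=> H; have G n : (n <= N)%N -> u n = u 0 * (onp n).[x] /\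
    ((n < N)%N -> u n.+1 = u 0 * (onp n.+1).[x]).
  elim: n => [|n IH] nN.
    split=> [|N0]; first by rewrite onp0 hornerC mulr1.
    have := H 0 N0; have := onp_tridiag x 0; rewrite /tridiag !add0r onp0 hornerC.
    rewrite !mulr1 => h1 h2; apply: (mulfI (lt0r_neq0 (a_gt0 0))).
    have -> : a 0 * u 1 = x * u 0 - b 0 * u 0 by rewrite -h2; ring.
    have -> : a 0 * (u 0 * (onp 1).[x]) = u 0 * (x - b 0) by rewrite -[in RHS]h1; ring.
    by ring.
  have [IH1 /(_ nN) IH2] := IH (ltnW nN); split=> // nN2.
  have := H n.+1 nN2; have := onp_tridiag x n.+1; rewrite /tridiag IH1 IH2 => h1 h2.
  apply: (mulfI (lt0r_neq0 (a_gt0 n.+1))).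
  have -> : a n.+1 * u n.+2 = x * (u 0 * (onp n.+1).[x]) - a n * (u 0 * (onp n).[x])
    - b n.+1 * (u 0 * (onp n.+1).[x]) by rewrite -h2; ring.
  have -> : a n.+1 * (u 0 * (onp n.+2).[x]) = u 0 * (x * (onp n.+1).[x]
     - a n * (onp n).[x] - b n.+1 * (onp n.+1).[x]) by rewrite -h1; ring.
  by ring.
by move=> n nN; have [] := G n nN.
Qed.

Definition onp_comb (c : nat -> R) N : {poly R} := \sum_(0 <= n < N) c n *: onp n.

(** Multiplication by ['X] acts on coefficients as the same symmetric matrix: Green's formula in
    [{poly R}] with constant polynomials for [a], [b], [c] and [onp] as the second sequence. *)
Lemma onp_combX c N : (forall n, (N <= n)%N -> c n = 0) ->
  'X * onp_comb c N = onp_comb (tridiag a b c) N.+1.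
Proof.
move=> c0.
have -> : onp_comb c N = \sum_(0 <= n < N.+1) c n *: onp n.
  by rewrite big_nat_recr//= c0// scale0r addr0.
have := @tridiag_green_fin {poly R} (fun n => (a n)%:P) (fun n => (b n)%:P)
  (fun n => (c n)%:P) onp N.
rewrite mulr_sumr /onp_comb => E.
transitivity (\sum_(0 <= k < N.+1) (c k)%:P *
    tridiag (fun n => (a n)%:P) (fun n => (b n)%:P) onp k).
  apply: eq_bigr => k _; rewrite -scalerAr onp_rec -mul_polyC; congr (_ * _).
  by rewrite /tridiag !mul_polyC; case: (k) => // m; rewrite mul_polyC.
rewrite -E; last by move=> n /c0 ->.
apply: eq_bigr => k _; rewrite -mul_polyC; congr (_ * _).
rewrite /tridiag !polyCD !polyCM; congr (_ + _ + _).
by case: (k) => // m; rewrite polyCM.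
Qed.

Section Orthogonality.
Variable nu : probability R R.
Hypothesis nu_orth : orthogonal_wrt p nu.

Lemma onp_integrable m n : poly_integrable nu (onp m * onp n).
Proof.
have [H _ _] := nu_orth; rewrite /onp -scalerAl -scalerAr.
by do 2 apply: poly_integrableZ; exact: H.
Qed.

Let p_int m n : poly_integrable nu (p m * p n).
Proof. by have [H _ _] := nu_orth; exact: H. Qed.

Let p_orth m n : m != n -> poly_mean nu (p m * p n) = 0.
Proof. by have [_ H _] := nu_orth => mn; rewrite /poly_mean /Rintegral H. Qed.

Let mean_Xp n m : poly_mean nu ('X * p n * p m) =
  poly_mean nu (p n.+1 * p m) + b n * poly_mean nu (p n * p m) +
  (if n is k.+1 then a k ^+ 2 * poly_mean nu (p k * p m) else 0).
Proof.
have Ib : poly_integrable nu (b n *: (p n * p m)) by exact: poly_integrableZ.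
have I1 : poly_integrable nu (p n.+1 * p m + b n *: (p n * p m)).
  exact: poly_integrableD.
rewrite Xp !mulrDl -scalerAl; case: n Ib I1 => [|n] Ib I1.
  by rewrite mul0r !addr0 poly_meanD// poly_meanZ.
have Ia : poly_integrable nu (a n ^+ 2 *: (p n * p m)) by exact: poly_integrableZ.
by rewrite -scalerAl poly_meanD// poly_meanD// !poly_meanZ.
Qed.

(** The mean of ['X * p n * p n.+1] is computed twice: expanding ['X * p n] leaves the square of
    [p n.+1], expanding ['X * p n.+1] leaves [a n ^+ 2] times that of [p n]. *)
Let p_mean_sqr n : poly_mean nu (p n * p n) = kappa n ^+ 2.
Proof.
elim: n => [|n IH]; first by rewrite p0 mulr1 poly_mean1 /kappa big_geq// expr1n.
have <- : poly_mean nu ('X * p n * p n.+1) = poly_mean nu (p n.+1 * p n.+1).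
  rewrite mean_Xp (@p_orth n n.+1) ?ltn_eqF// mulr0 addr0.
  case: n {IH} => [|n]; first by rewrite addr0.
  by rewrite (@p_orth n n.+2) ?ltn_eqF// ?mulr0 ?addr0.
rewrite mulrAC mean_Xp IH (@p_orth n.+2 n) ?gtn_eqF//.
rewrite (@p_orth n.+1 n) ?gtn_eqF//.
by rewrite mulr0 !add0r kappaS exprMn mulrC.
Qed.

Lemma onp_mean m n : poly_mean nu (onp m * onp n) = (m == n)%:R.
Proof.
rewrite /onp -scalerAl -scalerAr !poly_meanZ//; last exact: poly_integrableZ.
have [->|mn] := eqVneq m n; last by rewrite p_orth// !mulr0.
rewrite p_mean_sqr -!/(kappa n) /=; field.
by rewrite gt_eqF.
Qed.

Lemma onp_comb_integrable c d M N :
  poly_integrable nu (onp_comb c M * onp_comb d N).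
Proof.
rewrite mulr_suml; apply: poly_integrable_sum => i _.
rewrite mulr_sumr; apply: poly_integrable_sum => j _.
rewrite -scalerAl -scalerAr; do 2 apply: poly_integrableZ.
exact: onp_integrable.
Qed.

Lemma onp_comb_sqr_mean c N :
  poly_mean nu (onp_comb c N * onp_comb c N) = \sum_(0 <= n < N) c n ^+ 2.
Proof.
have int1 i j : poly_integrable nu ((c i *: onp i) * (c j *: onp j)).
  by rewrite -scalerAl -scalerAr; do 2 apply: poly_integrableZ; exact: onp_integrable.
rewrite {1}/onp_comb mulr_suml poly_mean_sum; last first.
  by move=> i _; rewrite mulr_sumr; apply: poly_integrable_sum => j _.
rewrite big_nat_cond [RHS]big_nat_cond; apply: eq_bigr => i /andP[/andP[_ iN] _].
rewrite mulr_sumr poly_mean_sum//.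
have E j : poly_mean nu ((c i *: onp i) * (c j *: onp j)) = c i * c j * (i == j)%:R.
  rewrite -scalerAl -scalerAr scalerA poly_meanZ ?onp_mean//; exact: onp_integrable.
rewrite (bigD1_seq i) ?mem_index_iota ?iota_uniq//= E eqxx mulr1 expr2.
by rewrite big1 ?addr0// => j ji; rewrite E eq_sym (negbTE ji) mulr0.
Qed.

(** As [onp 0 = 1], the mean is the inner product with [onp 0]; the bound [N.+1] keeps that term in
    the sum. *)
Lemma onp_comb_mean c N : poly_integrable nu (onp_comb c N.+1) /\
  poly_mean nu (onp_comb c N.+1) = c 0.
Proof.
have int1 i : poly_integrable nu (c i *: onp i).
  by apply: poly_integrableZ; rewrite -[onp i]mulr1 -onp0; exact: onp_integrable.
split; first by apply: poly_integrable_sum => i _.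
rewrite poly_mean_sum//.
have E j : poly_mean nu (c j *: onp j) = c j * (j == 0)%:R.
  rewrite poly_meanZ; last by rewrite -[onp j]mulr1 -onp0; exact: onp_integrable.
  by rewrite -{1}[onp j]mulr1 -onp0 onp_mean.
rewrite big_nat_recl// E mulr1 big1 ?addr0// => j _; by rewrite E mulr0.
Qed.

End Orthogonality.

End Moments.

(** * Comparison of atoms *)

Section IndicatorMean.
Variables (R : realType) (nu : probability R R).

Lemma probability_indic_mean (A : set R) : measurable A ->
  \int[nu]_x (\1_A x : R) = fine (nu A).
Proof. by move=> mA; rewrite /Rintegral integral_indic// setIT. Qed.

Lemma poly_mean_le_indic (f g : {poly R}) (k : R) (A : set R) :
  measurable A -> poly_integrable nu f -> poly_integrable nu g ->
  (forall x, f.[x] <= k * \1_A x + g.[x]) ->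
  poly_mean nu f <= k * fine (nu A) + poly_mean nu g.
Proof.
move=> mA If Ig H.
have IA : nu.-integrable setT (EFin \o (fun x => k * \1_A x : R)).
  have := integrableZl measurableT k (integrable_indic nu mA).
  by apply: eq_integrable => // x _ /=; rewrite EFinM.
rewrite -probability_indic_mean// -RintegralZl//; last exact: integrable_indic.
rewrite /poly_mean -RintegralD//; apply: le_Rintegral => //.
have := integrableD measurableT IA Ig.
by apply: eq_integrable => // x _ /=; rewrite EFinD.
Qed.

End IndicatorMean.

Section JacobiAction.
Variables (R : realType) (a b : nat -> R).

Lemma jacobi_action_tridiag (x : nat -> R[i]) :
  jacobi_action a b x = tridiag (fun n => (a n)%:C) (fun n => (b n)%:C) x.
Proof. by []. Qed.

Lemma Re_tridiag (u : nat -> R[i]) n :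
  Re (jacobi_action a b u n) = tridiag a b (fun k => Re (u k)) n.
Proof.
have ReM (k : R) z : Re (k%:C * z) = k * Re z.
  by case: z => z1 z2; rewrite /= mul0r subr0.
rewrite jacobi_action_tridiag /tridiag !raddfD/= !ReM; congr (_ + _ + _) => //.
by case: n => [|n] /=; rewrite ?ReM.
Qed.

Lemma Im_tridiag (u : nat -> R[i]) n :
  Im (jacobi_action a b u n) = tridiag a b (fun k => Im (u k)) n.
Proof.
have ImM (k : R) z : Im (k%:C * z) = k * Im z.
  by case: z => z1 z2; rewrite /= mul0r addr0.
rewrite jacobi_action_tridiag /tridiag !raddfD/= !ImM; congr (_ + _ + _) => //.
by case: n => [|n] /=; rewrite ?ImM.
Qed.

End JacobiAction.

Section Uniqueness.
Variables (R : realType) (a b : nat -> R) (p : nat -> {poly R}).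
Hypothesis a_gt0 : forall n, 0 < a n.
Hypothesis p0 : p 0 = 1.
Hypothesis Xp : forall n, 'X * p n =
  p n.+1 + b n *: p n + (if n is m.+1 then a m ^+ 2 *: p m else 0).

Local Notation P := (onp a p).

(** The kernel [F], with coefficients [P_n(x)], has value [S] at [x] and mean square [S]; hence
    [S ^+ 2 * m <= S]. *)
Lemma christoffel_le (nu : probability R R) (x : R) N : orthogonal_wrt p nu ->
  fine (nu [set x]) * \sum_(0 <= n < N) (P n).[x] ^+ 2 <= 1.
Proof.
move=> nu_orth; set m := fine _; set S := \sum_(_ <= _ < _) _.
have S0 : 0 <= S by apply: sumr_ge0 => i _; exact: sqr_ge0.
pose F := onp_comb a p (fun n => (P n).[x]) N.
have Fx : F.[x] = S.
  by rewrite horner_sum; apply: eq_bigr => i _; rewrite hornerZ expr2.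
have IF := onp_comb_integrable a nu_orth (fun n => (P n).[x]) (fun n => (P n).[x]) N N.
have EF : poly_mean nu (F * F) = S := onp_comb_sqr_mean a_gt0 p0 Xp nu_orth _ N.
have : poly_mean nu 0 <= - S ^+ 2 * m + poly_mean nu (F * F).
  apply: poly_mean_le_indic => //; first exact: poly_integrable0.
  move=> y; rewrite horner0 hornerM -expr2 indicE.
  have [/set_mem/= ->|_] := boolP (y \in [set x]); last by rewrite mulr0 add0r sqr_ge0.
  by rewrite Fx mulr1 addNr.
rewrite poly_mean0 EF => H.
have [->|S1] := eqVneq S 0; first by rewrite mulr0.
have {}S1 : 0 < S by rewrite lt_def S1.
rewrite -(ler_pM2l S1) mulr1; move: H; lra.
Qed.

(** For [F] with coefficients [c]: on the ball [F <= t / 2 + F ^+ 2 / (2 * t)]; outside, the same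
    with [s], and there [F ^+ 2] is at most [((y - x) * F) ^+ 2 / d ^+ 2]. The mean of [F] is [c 0],
    and [tridiag a b c - x * c] holds the coefficients of [('X - x%:P) * F]. *)
Lemma ball_mass_lower_bound (nu : probability R R) (x s t d : R) (c : nat -> R) N :
  orthogonal_wrt p nu -> 0 < s -> 0 < t -> 0 < d ->
  (forall n, (N.+1 <= n)%N -> c n = 0) ->
  c 0 <= t / 2 * fine (nu (ball x d)) + (2 * t)^-1 * (\sum_(0 <= n < N.+1) c n ^+ 2)
    + s / 2 + (2 * s * d ^+ 2)^-1 * \sum_(0 <= n < N.+2) (tridiag a b c n - x * c n) ^+ 2.
Proof.
move=> nu_orth s0 t0 d0 c0.
pose F := onp_comb a p c N.+1.
pose H := onp_comb a p (fun n => tridiag a b c n - x * c n) N.+2.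
have HE : H = ('X - x%:P) * F.
  rewrite mulrBl (onp_combX a_gt0 Xp c0) /F.
  have -> : onp_comb a p c N.+1 = onp_comb a p c N.+2.
    by rewrite /onp_comb [RHS]big_nat_recr//= c0// scale0r addr0.
  rewrite /onp_comb mulr_sumr -sumrB; apply: eq_bigr => i _.
  by rewrite [LHS]scalerBl mul_polyC [X in _ = _ - X]scalerA.
have [IF1 <-] := onp_comb_mean a_gt0 p0 Xp nu_orth c N.
have IF := onp_comb_integrable a nu_orth c c N.+1 N.+1.
have IH := onp_comb_integrable a nu_orth (fun n => tridiag a b c n - x * c n)
  (fun n => tridiag a b c n - x * c n) N.+2 N.+2.
rewrite -(onp_comb_sqr_mean a_gt0 p0 Xp nu_orth c N.+1).
rewrite -(onp_comb_sqr_mean a_gt0 p0 Xp nu_orth (fun n => tridiag a b c n - x * c n) N.+2).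
rewrite -/F -/H.
have I1 : poly_integrable nu (s / 2)%:P.
  rewrite -[_%:P]alg_polyC; apply: poly_integrableZ.
  have := onp_integrable a nu_orth 0 0; by rewrite (onp0 a p0) mulr1.
have I2 : poly_integrable nu ((2 * t)^-1 *: (F * F)) by exact: poly_integrableZ.
have I3 : poly_integrable nu ((2 * s * d ^+ 2)^-1 *: (H * H)) by exact: poly_integrableZ.
have := @poly_mean_le_indic R nu F ((2 * t)^-1 *: (F * F) + (s / 2)%:P +
   (2 * s * d ^+ 2)^-1 *: (H * H)) (t / 2) (ball x d).
have I12 : poly_integrable nu ((2 * t)^-1 *: (F * F) + (s / 2)%:P) by exact: poly_integrableD.
rewrite (poly_meanD I12 I3) (poly_meanD I2 I1) !poly_meanZ//.
have -> : poly_mean nu (s / 2)%:P = s / 2.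
  rewrite -[_%:P]alg_polyC poly_meanZ ?poly_mean1 ?mulr1//.
  have := onp_integrable a nu_orth 0 0; by rewrite (onp0 a p0) mulr1.
rewrite !addrA; apply.
- exact: measurable_realfun.measurable_ball.
- exact: IF1.
- exact: poly_integrableD.
move=> y; rewrite !hornerD !hornerZ !hornerM hornerC HE hornerM hornerXsubC.
set f := F.[y]; rewrite indicE.
have [/set_mem/= B|/negP B] := boolP (y \in (ball x d : set R)).
  rewrite mulr1.
  have h : f <= t / 2 + (2 * t)^-1 * (f * f).
    rewrite -subr_ge0 (_ : _ - _ = (f - t) ^+ 2 / (2 * t)).
      by rewrite divr_ge0 ?sqr_ge0// mulr_ge0// ltW.
    by field; rewrite gt_eqF.
  have h2 : 0 <= (2 * s * d ^+ 2)^-1 * ((y - x) * f * ((y - x) * f)).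
    by rewrite mulr_ge0 -?expr2 ?sqr_ge0// invr_ge0 !mulr_ge0 ?sqr_ge0// ltW.
  by move: h h2 (ltW s0); lra.
rewrite mulr0 add0r.
have yd : d ^+ 2 <= (y - x) ^+ 2.
  rewrite -[leRHS]real_normK ?num_real// lerXn2r ?nnegrE ?(ltW d0)//.
  rewrite leNgt; apply/negP => h; apply: B; apply/mem_set.
  by rewrite /ball/= distrC.
have h : f <= s / 2 + (2 * s)^-1 * (f * f).
  rewrite -subr_ge0 (_ : _ - _ = (f - s) ^+ 2 / (2 * s)).
    by rewrite divr_ge0 ?sqr_ge0// mulr_ge0// ltW.
  by field; rewrite gt_eqF.
have h1 : 0 <= (2 * t)^-1 * (f * f).
  by rewrite mulr_ge0 -?expr2 ?sqr_ge0// invr_ge0 mulr_ge0// ltW.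
have h2 : (2 * s)^-1 * (f * f) <= (2 * s * d ^+ 2)^-1 * ((y - x) * f * ((y - x) * f)).
  rewrite -subr_ge0 [X in 0 <= X](_ : _ = f ^+ 2 * ((y - x) ^+ 2 - d ^+ 2) / (2 * s * d ^+ 2)).
    apply: divr_ge0; first by rewrite mulr_ge0 ?sqr_ge0 ?subr_ge0.
    by rewrite mulr_ge0 ?sqr_ge0// mulr_ge0// ltW.
  by field; rewrite !gt_eqF.
by move: h h1 h2; lra.
Qed.

Hypothesis sa : self_adjoint (jacobi_operator a b).

(** By self-adjointness it is enough that the pair lies in the adjoint. Against finitely supported
    vectors this is Green's formula; Cauchy-Schwarz extends it to the closure. *)
Lemma formal_eigenvector (phi : l2 R) (x : R) :
  (forall n, tridiag (fun n => (a n)%:C) (fun n => (b n)%:C) phi n = x%:C * phi n) ->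
  jacobi_operator a b (phi, x%:C *: phi).
Proof.
move=> Hphi; have [_ <-] := sa => u w /l2_closureP H.
have E u' w' : finitely_supported (u' : l2 R) -> l2_seq w' = jacobi_action a b u' ->
    l2_dot w' phi = l2_dot u' (x%:C *: phi).
  move=> [N u0] wE.
  rewrite (@l2_dot_fin _ w' _ N.+1); last first.
    by move=> [//|n] Nn; rewrite wE /jacobi_action !u0 ?mulr0 ?addr0// !leqW.
  rewrite (@l2_dot_fin _ u' _ N.+1); last by move=> n Nn; rewrite u0// ltnW.
  rewrite wE jacobi_action_tridiag tridiag_green_fin//; apply: eq_bigr => k _.
  congr (_ * _); rewrite l2ZE -Hphi /tridiag !rmorphD !rmorphM/= !real_complexJ.
  by congr (_ + _ + _); case: (k) => [|k']; rewrite ?conjC0// rmorphM/= real_complexJ.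
apply/eqP; rewrite -subr_eq0; apply/eqP/normc2_eq0.
set M := 2 * (l2_sq phi + l2_sq (x%:C *: phi)).
have M0 : 0 <= M by rewrite mulr_ge0// addr_ge0// l2_sq_ge0.
apply/ler_addgt0Pr => e e0; rewrite add0r.
have d0 : 0 < e / (M + 1) by rewrite divr_gt0// ltr_wpDl.
have [u' [w' [[/= fu' wE] hu hw]]] := H _ d0.
have -> : l2_dot w phi - l2_dot u (x%:C *: phi) =
  l2_dot (w - w') phi + - l2_dot (u - u') (x%:C *: phi).
  by rewrite !l2_dotBl (E u' w')//; ring.
apply: le_trans (normc2D _ _) _; rewrite normc2N.
apply: (@le_trans _ _ (M * (e / (M + 1)))); last first.
  by rewrite mulrA ler_pdivrMr ?ltr_wpDl// mulrC ler_pM2l// lerDl.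
rewrite /M -mulrA ler_wpM2l// mulrDl; apply: lerD;
  (apply: le_trans (l2_dot_le _ _) _; rewrite mulrC; apply: ler_wpM2l;
   [exact: l2_sq_ge0|exact: ltW]).
Qed.

(** The eigenvector [phi] has first entry [r] with [r ^+ 2 = mu{x}]. Its finitely supported
    approximants turn [ball_mass_lower_bound] into [r <= V / (2 * r) + r / 2] up to order [e], where
    [V] is the [nu]-mass of a ball; so [r ^+ 2 <= V]. *)
Lemma atom_le (mu nu : probability R R) : orthogonal_wrt p mu -> orthogonal_wrt p nu ->
  forall x : R, (mu [set x] <= nu [set x])%E.
Proof.
move=> mu_orth nu_orth x.
have fmu : mu [set x] \is a fin_num by apply: fin_num_measure; exact: measurable_set1.
have fnu A : measurable A -> nu A \is a fin_num by move=> mA; exact: fin_num_measure.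
rewrite -(fineK fmu); set m := fine _.
have m0 : 0 <= m by apply: fine_ge0; exact: measure_ge0.
have [->//|m1] := eqVneq m 0; have {}m1 : 0 < m by rewrite lt_def m1.
pose r := Num.sqrt m.
have r0 : 0 < r by rewrite sqrtr_gt0.
have r2 : r ^+ 2 = m by rewrite sqr_sqrtr.
pose f n := r * (P n).[x].
have f1 N : \sum_(0 <= n < N) f n ^+ 2 <= 1.
  under eq_bigr do rewrite exprMn r2.
  by rewrite -mulr_sumr; exact: christoffel_le.
have phiP : (fun n => (f n)%:C) \in square_summable.
  apply/asboolP; apply: (@square_summableP _ _ 1) => N.
  by rewrite sqsumE; under eq_bigr do rewrite normc2_real.
pose phi := L2 phiP.
have Jphi : jacobi_operator a b (phi, x%:C *: phi).
  apply: formal_eigenvector => n.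
  have : tridiag a b f n = x * f n.
    rewrite /f mulrCA -(onp_tridiag a_gt0 Xp) /tridiag.
    by case: n => [|n]; ring.
  move=> /(congr1 (real_complex R)); rewrite rmorphM/= => <-.
  by rewrite /tridiag !rmorphD !rmorphM/=; case: n => [|n]; rewrite ?rmorph0 ?rmorphM.
have f0 : f 0 = r by rewrite /f (onp0 a p0) hornerC mulr1.
have ball_ge d : 0 < d -> m <= fine (nu (ball x d)).
  move=> d0; set V := fine _.
  (* The coefficients of [e]: [1] from [c 0 >= r - e], [3 * r / 2] from the norm of [c], [1 / 2]
     from [s = e], and the last from the part outside the ball. *)
  pose K := 1 + 3 * r / 2 + 1 / 2 + (1 + x ^+ 2) / d ^+ 2.
  have K0 : 0 < K.
    rewrite /K; have : 0 <= (1 + x ^+ 2) / d ^+ 2.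
      by rewrite divr_ge0 ?sqr_ge0// addr_ge0 ?sqr_ge0.
    by move: (ltW r0); lra.
  suff H e : 0 < e -> e <= 1 -> r / 2 - V / (2 * r) <= e * K.
    have : r / 2 - V / (2 * r) <= 0.
      rewrite leNgt; apply/negP; set D := _ - _ => D0.
      have e0 : 0 < Num.min 1 (D / (2 * K)) by rewrite lt_min ltr01/= divr_gt0// mulr_gt0.
      have := H _ e0; rewrite ge_min lexx => /(_ isT) h.
      have : Num.min 1 (D / (2 * K)) * K <= D / 2.
        apply: (@le_trans _ _ (D / (2 * K) * K)).
          by rewrite ler_pM2r// ge_min lexx orbT.
        by rewrite le_eqVlt; apply/orP; left; apply/eqP; field; rewrite gt_eqF.
      by move=> h'; have := le_trans h h'; rewrite -/D; lra.
    rewrite subr_le0 ler_pdivlMr ?mulr_gt0// => h; rewrite -r2; move: h.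
    by rewrite (_ : r / 2 * (2 * r) = r ^+ 2)//; field.
  move=> e0 e1; have e20 : 0 < e ^+ 2 by rewrite exprn_gt0.
  have /l2_closureP/(_ _ e20)[u [w [[/= [N u0] wE] hu hw]]] := Jphi.
  pose c n := Re (u n).
  have c0 n : (N.+1 <= n)%N -> c n = 0 by move=> Nn; rewrite /c u0// ltnW.
  have JcE n : tridiag a b c n = Re (w n).
    by rewrite wE Re_tridiag.
  have Re_sq (z : R[i]) : Re z ^+ 2 <= normc2 z by rewrite lerDl sqr_ge0.
  have S1 M : \sum_(0 <= n < M) (c n - f n) ^+ 2 <= e ^+ 2.
    apply: le_trans (ltW hu); apply: le_trans (sqsum_le _ M); rewrite sqsumE.
    apply: ler_sum => n _; apply: le_trans (Re_sq _).
    by rewrite l2BE raddfB/= -sqrrN opprB.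
  have S2 M : \sum_(0 <= n < M) (tridiag a b c n - x * f n) ^+ 2 <= e ^+ 2.
    apply: le_trans (ltW hw); apply: le_trans (sqsum_le _ M); rewrite sqsumE.
    apply: ler_sum => n _; apply: le_trans (Re_sq _).
    rewrite l2BE l2ZE raddfB/= -JcE -sqrrN opprB.
    by rewrite !mul0r subr0.
  (* Young's inequality with weight [e] makes the excess of the norm over [1] of order [e]. *)
  have S3 M : \sum_(0 <= n < M) c n ^+ 2 <= 1 + 2 * e + e ^+ 2.
    apply: (@le_trans _ _ (\sum_(0 <= n < M)
        ((1 + e) * f n ^+ 2 + (1 + e^-1) * (c n - f n) ^+ 2))).
      apply: ler_sum => n _; rewrite -subr_ge0.
      rewrite (_ : _ - _ = (e * f n - (c n - f n)) ^+ 2 / e).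
        by rewrite divr_ge0 ?sqr_ge0// ltW.
      by field; rewrite gt_eqF.
    rewrite big_split/= -!mulr_sumr.
    apply: (@le_trans _ _ ((1 + e) * 1 + (1 + e^-1) * e ^+ 2)).
      by apply: lerD; rewrite ler_wpM2l// addr_ge0 ?invr_ge0// ltW.
    by rewrite le_eqVlt; apply/orP; left; apply/eqP; field; rewrite gt_eqF.
  have S4 M : \sum_(0 <= n < M) (tridiag a b c n - x * c n) ^+ 2 <=
      2 * (1 + x ^+ 2) * e ^+ 2.
    apply: (@le_trans _ _ (\sum_(0 <= n < M)
        (2 * (tridiag a b c n - x * f n) ^+ 2 + 2 * x ^+ 2 * (c n - f n) ^+ 2))).
      apply: ler_sum => n _.
      have := sqr_ge0 ((tridiag a b c n - x * f n) + x * (c n - f n)); lra.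
    rewrite big_split/= -!mulr_sumr.
    have := S1 M; have := S2 M; have := sqr_ge0 x; nra.
  have c0r : r - e <= c 0.
    have := S1 1; rewrite big_nat1 f0 => h.
    rewrite leNgt; apply/negP => h'; nra.
  have ri0 : 0 < r^-1 by rewrite invr_gt0.
  have := ball_mass_lower_bound x nu_orth e0 ri0 d0 c0; rewrite -/V => B.
  have {}B : c 0 <= r^-1 / 2 * V + (2 * r^-1)^-1 * (1 + 2 * e + e ^+ 2) + e / 2 +
      (2 * e * d ^+ 2)^-1 * (2 * (1 + x ^+ 2) * e ^+ 2).
    apply: le_trans B _; apply: lerD; last first.
      by rewrite ler_wpM2l// invr_ge0 !mulr_ge0 ?sqr_ge0// ltW.
    rewrite lerD2r lerD2l ler_wpM2l//.
    by rewrite invr_ge0 mulr_ge0// ltW.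
  have E1 : (2 * e * d ^+ 2)^-1 * (2 * (1 + x ^+ 2) * e ^+ 2) = e * ((1 + x ^+ 2) / d ^+ 2).
    by field; rewrite !gt_eqF.
  have E2 : (2 * r^-1)^-1 = r / 2 by field; rewrite gt_eqF.
  have E3 : r^-1 / 2 * V = V / (2 * r) by field; rewrite gt_eqF.
  move: B; rewrite E1 E2 E3 /K.
  have er : r / 2 * e ^+ 2 <= r / 2 * e.
    by rewrite ler_wpM2l ?divr_ge0 ?(ltW r0)// expr2 ler_piMl// ltW.
  by move: c0r er; set z := _ / d ^+ 2; lra.
(* Continuity from above along shrinking balls carries the bound to the point [x]. *)
pose F n := ball x (n.+1%:R^-1 : R).
have mF n : measurable (F n) by exact: measurable_realfun.measurable_ball.
have capF : \bigcap_n F n = [set x].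
  apply/seteqP; split=> [y Fy|y -> n _]; last by apply: ballxx; rewrite invr_gt0.
  apply/eqP; rewrite eq_sym -subr_eq0 -normr_eq0 eq_le normr_ge0 andbT.
  apply/ler_addgt0Pr => e e0; rewrite add0r.
  near \oo => n.
  have : `|x - y| < n.+1%:R^-1 by exact: Fy.
  move=> /ltW/le_trans; apply; apply: ltW; near: n; exact: near_infty_natSinv_lt (PosNum e0).
have C : nu \o F @ \oo --> nu [set x].
  rewrite -capF; apply: nonincreasing_cvg_mu => //.
  - by rewrite ltey_eq fnu.
  - by rewrite capF; exact: measurable_set1.
  - move=> n k nk; apply/subsetPset; apply: le_ball.
    by rewrite lef_pV2 ?posrE// ler_nat.
rewrite -(cvg_lim _ C)//; apply: lime_ge.
  by apply/cvg_ex; eexists; exact: C.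
near=> n; rewrite -[(nu \o F) n](@fineK _ (nu (F n))) ?fnu// lee_fin.
by apply: ball_ge; rewrite invr_gt0.
Unshelve. all: by end_near. Qed.

End Uniqueness.

(** * Discrete orthogonality measures *)

Section DiscreteMeasure.
Variables (R : realType) (w : nat -> {nonneg R}) (x : nat -> R).

Definition discrete_measure : set R -> \bar R :=
  mseries (fun j => mscale (w j) (dirac (x j) : {measure set R -> \bar R})) 0.

HB.instance Definition _ := Measure.on discrete_measure.

Lemma eseries_real_cvg (u : nat -> R) (l : R) : series u @ \oo --> l ->
  (\sum_(j <oo) (u j)%:E = l%:E)%E.
Proof.
move=> H; have Hc : cvgn (series u) by apply/cvg_ex; exists l.
rewrite (_ : (fun n => _) = EFin \o series u).
  by rewrite EFin_lim//; congr (_%:E); exact: cvg_lim.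
by apply/funext => n; rewrite /series/= sumEFin.
Qed.

Lemma discrete_measureE (A : set R) (l : R) :
  series (fun j => (w j)%:num * \1_A (x j)) @ \oo --> l -> discrete_measure A = l%:E.
Proof.
move=> /eseries_real_cvg <-; apply: eq_eseriesr => j _.
by rewrite /mscale/= indicE EFinM.
Qed.

Lemma discrete_measure_integral (f : {poly R}) (l : R) : (forall y, 0 <= f.[y]) ->
  series (fun j => (w j)%:num * f.[x j]) @ \oo --> l ->
  (\int[discrete_measure]_y (f.[y])%:E = l%:E)%E.
Proof.
move=> f0 /eseries_real_cvg <-.
have mf : measurable_fun setT (EFin \o (horner f : R -> R)).
  apply/measurable_EFinP; apply: continuous_measurable_fun.
  exact: continuous_horner.
rewrite ge0_integral_measure_series//; last by move=> y _; rewrite lee_fin.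
apply: eq_eseriesr => j _; rewrite ge0_integral_mscale//; last by move=> y _; rewrite lee_fin.
by rewrite integral_dirac// diracE mem_set//= mul1e EFinM.
Qed.

End DiscreteMeasure.

(** * Determinacy from an atomic orthogonality measure *)

Section AtomicUnique.
Variables (R : realType) (a b : nat -> R) (p : nat -> {poly R}).
Hypothesis a_gt0 : forall n, 0 < a n.
Hypothesis p0 : p 0 = 1.
Hypothesis Xp : forall n, 'X * p n =
  p n.+1 + b n *: p n + (if n is m.+1 then a m ^+ 2 *: p m else 0).

Local Notation P := (onp a p).

Lemma atomic_le (mu nu : probability R R) (x : nat -> R) :
  (forall y : R, (mu [set y] <= nu [set y])%E) -> mu (\bigcup_j [set x j]) = 1%E ->
  forall X, measurable X -> (mu X <= nu X)%E.
Proof.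
move=> Hle H1 X mX; set C := \bigcup_j [set x j].
have mF j : measurable (X `&` [set x j]).
  by apply: measurableI => //; exact: measurable_set1.
have mC : measurable C by apply: bigcup_measurable => j _; exact: measurable_set1.
have muC : mu (~` C) = 0%E by rewrite probability_setC// H1 subee.
have -> : mu X = mu (X `&` C).
  apply/eqP; rewrite eq_le; apply/andP; split; last first.
    by apply: le_measure; rewrite ?inE//; exact: measurableI.
  rewrite -{1}(setIT X) -(setUCr C) setIUr (le_trans (measureU2 _ _ _))//.
  - exact: measurableI.
  - by apply: measurableI => //; exact: measurableC.
  rewrite [X in (_ + X <= _)%E](_ : _ = 0%E) ?adde0//.
  apply/eqP; rewrite eq_le measure_ge0 andbT -muC.
  apply: le_measure; rewrite ?inE//.
  - by apply: measurableI => //; exact: measurableC.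
  - exact: measurableC.
apply: (@le_trans _ _ (nu (X `&` C))); last first.
  by apply: le_measure; rewrite ?inE//; exact: measurableI.
(* The points [x j] may repeat; disjointification leaves a single point or nothing at each index. *)
rewrite setI_bigcupr seqDU_bigcup_eq.
set F := fun j => X `&` [set x j].
have mD j : measurable (seqDU F j).
  apply: measurableD; first exact: mF.
  by apply: bigsetU_measurable => k _; exact: mF.
rewrite !measure_bigcup//; try exact: trivIset_seqDU.
apply: lee_nneseries => // j _.
have [->|->] : seqDU F j = set0 \/ seqDU F j = [set x j].
  apply: subset_set1; apply: subset_trans (@subDsetl _ _ _) _; exact: subIsetr.
- by rewrite !measure0.
- exact: Hle.
Qed.

(** The inequality [mu X <= nu X] holds for the complement as well, and both total masses are
    [1]. *)
Lemma atomic_determinate (mu nu : probability R R) (x : nat -> R) :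
  self_adjoint (jacobi_operator a b) ->
  orthogonal_wrt p mu -> orthogonal_wrt p nu -> mu (\bigcup_j [set x j]) = 1%E ->
  forall X, measurable X -> nu X = mu X.
Proof.
move=> sa mu_orth nu_orth H1.
have le X : measurable X -> (mu X <= nu X)%E.
  by apply: (@atomic_le _ _ x) => // y; exact: (atom_le a_gt0 p0 Xp sa).
move=> X mX; apply/eqP; rewrite eq_le le// andbT.
have := le _ (measurableC mX); rewrite !probability_setC//.
have fm : mu X \is a fin_num by exact: fin_num_measure.
have fn : nu X \is a fin_num by exact: fin_num_measure.
by rewrite -(fineK fm) -(fineK fn) -!EFinB !lee_fin lerD2l lerN2.
Qed.

(** [discrete_measure_integral] covers nonnegative integrands, hence squares; the products
    [P m * P n] follow by polarization. *)
Lemma discrete_orthogonal (w x : nat -> R) : (forall j, 0 <= w j) ->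
  (forall m n, series (fun j => w j * ((P m).[x j] * (P n).[x j])) @ \oo --> ((m == n)%:R : R)) ->
  exists2 mu : probability R R, orthogonal_wrt p mu & mu (\bigcup_j [set x j]) = 1%E.
Proof.
move=> w0 H; pose wn j := NngNum (w0 j).
pose d := discrete_measure wn x.
have w1 : series w @ \oo --> (1 : R).
  rewrite (_ : w = fun j => w j * ((P 0).[x j] * (P 0).[x j])); first exact: H.
  by apply/funext => j; rewrite (onp0 a p0) hornerC !mulr1.
have C1 A : (forall j, A (x j)) -> d A = 1%E.
  move=> Ax; apply: discrete_measureE.
  rewrite (_ : (fun j => _) = w)//; apply/funext => j.
  by rewrite indicE mem_set//= mulr1.
have dT : d setT = 1%E by exact: C1.
pose mu : probability R R := HB.pack d (Measure_isProbability.Build _ _ _ d dT).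
have sq f l : series (fun j => w j * f.[x j] ^+ 2) @ \oo --> l ->
    poly_integrable mu (f * f) /\ poly_mean mu (f * f) = l.
  move=> Hf; have E : (\int[mu]_y ((f * f).[y])%:E = l%:E)%E.
    apply: discrete_measure_integral => [y|]; first by rewrite hornerM -expr2 sqr_ge0.
    by under eq_fun do rewrite hornerM -expr2.
  split; last by rewrite /poly_mean /Rintegral E.
  apply/integrableP; split.
    apply/measurable_EFinP; apply: continuous_measurable_fun.
    exact: continuous_horner.
  rewrite (_ : (\int[mu]_y _)%E = l%:E) ?ltry// -E; apply: eq_integral => y _.
  by rewrite gee0_abs// lee_fin hornerM -expr2 sqr_ge0.
have sqP n : poly_integrable mu (P n * P n) /\ poly_mean mu (P n * P n) = 1.
  apply: sq; rewrite (_ : 1 = (n == n)%:R); last by rewrite eqxx.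
  by under eq_fun do rewrite expr2; exact: H.
have PP m n : poly_integrable mu (P m * P n) /\ poly_mean mu (P m * P n) = (m == n)%:R.
  have [Im Em] := sqP m; have [In En] := sqP n.
  have [Is Es] : poly_integrable mu ((P m + P n) * (P m + P n)) /\
     poly_mean mu ((P m + P n) * (P m + P n)) = 1 + 2 * (m == n)%:R + 1.
    apply: sq.
    have := H m m; have := H n n; have := H m n; rewrite !eqxx => h1 h2 h3.
    rewrite (_ : series _ = fun N => series (fun j => w j * ((P m).[x j] * (P m).[x j])) N
       + 2 * series (fun j => w j * ((P m).[x j] * (P n).[x j])) N
       + series (fun j => w j * ((P n).[x j] * (P n).[x j])) N).
      by apply: cvgD => //; apply: cvgD => //; apply: cvgM => //; exact: cvg_cst.
    apply/funext => N; rewrite /series/= mulr_sumr -!big_split/=.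
    by apply: eq_bigr => j _; rewrite hornerD; ring.
  have -> : P m * P n = 2^-1 *: ((P m + P n) * (P m + P n) + (-1) *: (P m * P m)
     + (-1) *: (P n * P n)).
    rewrite !scaleN1r (_ : _ - _ - _ = 2 *: (P m * P n)).
      by rewrite scalerA mulVf ?scale1r// pnatr_eq0.
    by rewrite scaler_nat; ring.
  have I1 : poly_integrable mu ((-1) *: (P m * P m)) by exact: poly_integrableZ.
  have I2 : poly_integrable mu ((-1) *: (P n * P n)) by exact: poly_integrableZ.
  have I3 := poly_integrableD Is I1; have I4 := poly_integrableD I3 I2.
  split; first exact: poly_integrableZ.
  rewrite poly_meanZ// (poly_meanD I3 I2) (poly_meanD Is I1) !poly_meanZ// Es Em En.
  by field.
have k0 n : 0 < \prod_(0 <= i < n) a i.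
  by elim: n => [|n IH]; [rewrite big_geq|rewrite big_nat_recr//= mulr_gt0].
have pE n : p n = (\prod_(0 <= i < n) a i) *: P n.
  by rewrite scalerA divff ?scale1r// gt_eqF.
have pI m n : poly_integrable mu (p m * p n).
  rewrite !pE -scalerAl -scalerAr; do 2 apply: poly_integrableZ.
  by have [] := PP m n.
have pM m n : (\int[mu]_y ((p m * p n).[y])%:E)%E =
   ((\prod_(0 <= i < m) a i) * (\prod_(0 <= i < n) a i) * (m == n)%:R)%:E.
  rewrite -[LHS]fineK; last by apply: integrable_fin_num => //; exact: pI.
  congr (_%:E); have [I E] := PP m n.
  rewrite -[LHS]/(poly_mean mu (p m * p n)) !pE -scalerAl -scalerAr.
  rewrite !poly_meanZ ?E ?mulrA//; exact: poly_integrableZ.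
exists mu; last by apply: C1 => j; exists j.
split=> //.
- by move=> m n /negbTE mn; rewrite pM mn mulr0.
- by move=> n; rewrite pM eqxx mulr1 lte_fin mulr_gt0.
Qed.

End AtomicUnique.

(** * Finite quadratures *)

Section FiniteQuadrature.
Variables (R : realType) (lam mu : nat -> R).
Hypotheses (lam_gt0 : forall n, 0 < lam n) (mu0 : mu 0 = 0)
  (mu_gt0 : forall n, 0 < mu n.+1).

Let a n := Num.sqrt (lam n * mu n.+1).
Let b n := lam n + mu n.
Let s n := Num.sqrt (lam n).
Let t n := Num.sqrt (mu n).
Local Notation T := (bidiag_inv lam mu).

Variable tau : R.
Hypothesis T_bound : hs_bound T tau.

Let a_gt0 n : 0 < a n.
Proof. by rewrite sqrtr_gt0 mulr_gt0. Qed.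

Lemma mulcJ_normc2 (z : R[i]) : z * z^* = (normc2 z)%:C.
Proof. by case: z => x y; rewrite /normc2/=; simpc; congr (_ +i* _); ring. Qed.

(* Diagonalizes the inverse [T^T T] of the truncated matrix rather than the
   truncated matrix itself: its trace is the Hilbert-Schmidt norm of [T]. *)
Lemma finite_eigenbasis N : exists (e : 'I_N.+1 -> R) (U : 'M[R[i]]_N.+1),
  [/\ forall i, 0 < e i, \sum_i e i <= tau,
      forall m n, \sum_i (U i m)^* * U i n = (m == n)%:R &
      forall i n, (n < N)%N -> U i (inord n) =
        (e i)%:C * jacobi_action a b (fun k => U i (inord k)) n].
Proof.
pose Tm : 'M[R[i]]_N.+1 := \matrix_(k, i) (T k i)%:C.
pose M := Tm^T *m Tm.
have TmJ : map_mx Num.conj Tm = Tm.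
  by apply/matrixP => i j; rewrite !mxE real_complexJ.
have MJ : map_mx Num.conj M^T = M.
  by rewrite /M trmx_mul trmxK map_mxM/= -map_trmx TmJ.
have Mn : M \is normalmx by apply/normalmxP; rewrite MJ.
set U := spectralmx M; pose D := spectral_diag M.
have Uu : U \is unitarymx := spectral_unitarymx M.
pose U' := map_mx Num.conj U^T.
have UU' : U *m U' = 1%:M by apply/unitarymxP.
have U'U : U' *m U = 1%:M by exact: mulmx1C.
have ME : M = U' *m diag_mx D *m U.
  by rewrite {1}(orthomx_spectralP Mn) invmx_unitary.
have UM : U *m M = diag_mx D *m U by rewrite ME !mulmxA UU' mul1mx.
(* Row [i] of [V] is the truncated [T] applied to row [i] of [U]. Below, [V V^* = D] shows that the
   eigenvalues are squared norms, hence real. *)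
pose V := U *m Tm^T.
have VTm : V *m Tm = diag_mx D *m U by rewrite -mulmxA UM.
have VV' : V *m map_mx Num.conj V^T = diag_mx D.
  rewrite /V trmx_mul trmxK map_mxM/= TmJ !mulmxA -[U *m _ *m _]mulmxA UM.
  by rewrite -mulmxA UU' mulmx1.
have mxeq (A B : 'M[R[i]]_N.+1) : A = B -> forall i j, A i j = B i j by move=> ->.
pose e i := \sum_k normc2 (V i k).
have DE i : D 0 i = (e i)%:C.
  have := mxeq _ _ VV' i i; rewrite !mxE eqxx mulr1n => <-.
  rewrite /e rmorph_sum; apply: eq_bigr => k _.
  by rewrite [X in _ * X]mxE [V^T _ _]mxE mulcJ_normc2.
pose u i n := U i (inord n); pose v i n := V i (inord n).
have vE i k : (k <= N)%N -> v i k = \sum_j U i j * (T k j)%:C.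
  by move=> kN; rewrite /v mxE; apply: eq_bigr => j _; rewrite !mxE inordK.
have deltaE i k : (k <= N)%N -> \sum_(j < N.+1) U i j * ((j == k :> nat)%:R : R)%:C = u i k.
  move=> kN; rewrite (bigD1 (inord k))//= inordK// eqxx rmorph1 mulr1 big1 ?addr0// => j jk.
  rewrite (_ : (j == k :> nat) = false) ?rmorph0 ?mulr0//.
  by apply/negbTE; apply: contra jk => /eqP <-; rewrite inord_val.
have Lv0 i : (s 0)%:C * v i 0 = u i 0.
  rewrite vE// mulr_sumr -deltaE//; apply: eq_bigr => j _.
  by rewrite mulrCA -rmorphM (bidiag_inv0 mu lam_gt0).
have LvS i k : (k < N)%N -> (s k.+1)%:C * v i k.+1 + (t k.+1)%:C * v i k = u i k.+1.
  move=> kN; rewrite !vE ?(ltnW kN)// !mulr_sumr -big_split/= -deltaE//.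
  apply: eq_bigr => j _; rewrite ![_%:C * (U i j * _)]mulrCA -mulrDr -!rmorphM -rmorphD/=.
  by rewrite (bidiag_invS mu lam_gt0).
(* [L^T] applied to [e u = T^T v] returns [v] by [T L = 1]; entry [n.+1] is read, whence [n < N]. *)
have Bu i n : (n < N)%N ->
    (e i)%:C * ((s n)%:C * u i n + (t n.+1)%:C * u i n.+1) = v i n.
  move=> nN; have E k : (k <= N)%N -> (e i)%:C * u i k = \sum_j V i j * (T j k)%:C.
    move=> kN; have := mxeq _ _ VTm i (inord k).
    rewrite mul_diag_mx !mxE DE => <-; apply: eq_bigr => j _.
    by rewrite [Tm _ _]mxE inordK.
  rewrite mulrDr ![(e i)%:C * (_ * _)]mulrCA !E ?(ltnW nN)// !mulr_sumr -big_split/=.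
  rewrite (bigD1 (inord n))//= big1 ?addr0.
    rewrite ![_%:C * (V _ _ * _)]mulrCA -mulrDr -!rmorphM -rmorphD/=.
    rewrite mulrC [s n * _]mulrC [t _ * _]mulrC (bidiag_inv_col mu lam_gt0).
    by rewrite inordK ?eqxx ?mul1r// ltnW.
  move=> j jn; rewrite ![_%:C * (V _ _ * _)]mulrCA -mulrDr -!rmorphM -rmorphD/=.
  rewrite [s n * _]mulrC [t _ * _]mulrC (bidiag_inv_col mu lam_gt0).
  rewrite (_ : (j == n :> nat) = false) ?rmorph0 ?mulr0//.
  by apply/negbTE; apply: contra jn => /eqP <-; rewrite inord_val.
have Unorm i : \sum_j U i j * (U i j)^* = 1.
  transitivity ((U *m U') i i); last by rewrite UU' mxE eqxx.
  rewrite mxE; by apply: eq_bigr => j _; rewrite !mxE.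
(* If [e i = 0], row [i] of [V] is zero, and then so is row [i] of [U] by [L v = u], against its
   unit norm. *)
have e0 i : 0 < e i.
  rewrite lt_def sumr_ge0 ?andbT//; last by move=> k _; exact: normc2_ge0.
  apply/negP => /eqP ei0.
  have V0 k : V i k = 0.
    apply: normc2_eq0; rewrite -ei0 /e (bigD1 k)//= lerDl.
    by apply: sumr_ge0 => l _; exact: normc2_ge0.
  have v0 k : v i k = 0 by exact: V0.
  have U0 j : U i j = 0.
    rewrite -[j]inord_val -/(u i j); have := ltn_ord j; case: (nat_of_ord j) => [|k] kN.
      by rewrite -Lv0 v0 mulr0.
    by rewrite -LvS// !v0 !mulr0 addr0.
  have := Unorm i; rewrite big1; last by move=> j _; rewrite U0 mul0r.
  by move/eqP; rewrite eq_sym oner_eq0.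
exists e, U; split=> //.
- rewrite -lecR rmorph_sum/=.
  have -> : \sum_i (e i)%:C = \tr (diag_mx D).
    by rewrite mxtrace_diag; apply: eq_bigr => i _; rewrite DE.
  have -> : \tr (diag_mx D) = \tr M by rewrite ME -mulmxA mxtrace_mulC -mulmxA UU' mulmx1.
  have -> : \tr M = (\sum_(0 <= i < N.+1) \sum_(0 <= k < N.+1) T k i ^+ 2)%:C.
    rewrite rmorph_sum/= big_mkord; apply: eq_bigr => i _.
    rewrite mxE rmorph_sum/= big_mkord; apply: eq_bigr => k _.
    by rewrite !mxE -rmorphM.
  by rewrite lecR; exact: (hs_boundT T_bound).
- move=> m n; have := mxeq _ _ U'U m n; rewrite !mxE => <-.
  by apply: eq_bigr => j _; rewrite !mxE.
- move=> i n nN.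
  rewrite -/(u i n) (jacobi_action_factor lam_gt0 mu0 mu_gt0)/= mulrDr mulrCA.
  rewrite -/(s _) -/(t _) -/(u i n) -/(u i n.+1) Bu//; case: n nN => [|n] nN.
    by rewrite mulr0 addr0 Lv0.
  by rewrite mulrCA -/(t n.+1) -/(s n) -/(u i n) Bu ?(ltnW nN)// LvS// ltnW.
Qed.

Variable p : nat -> {poly R}.
Hypothesis p0 : p 0 = 1.
Hypothesis Xp : forall n, 'X * p n =
  p n.+1 + b n *: p n + (if n is m.+1 then a m ^+ 2 *: p m else 0).
Local Notation P := (onp a p).

(** Row [i] of [U] solves the recurrence at [(e i)^-1], so it is its first entry times [P_n] there.
    Orthonormality of the columns of [U] becomes discrete orthogonality with weights
    [normc2 (U i ord0)]. [U] is complex, hence the separate real and imaginary parts. *)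
Lemma finite_quadrature N : exists e w : 'I_N.+1 -> R,
  [/\ forall i, 0 < e i, \sum_i e i <= tau, forall i, 0 <= w i &
      forall m n, (m <= N)%N -> (n <= N)%N ->
        \sum_i w i * ((P m).[(e i)^-1] * (P n).[(e i)^-1]) = (m == n)%:R].
Proof.
have [e [U [e0 etau UU HU]]] := finite_eigenbasis N.
exists e, (fun i => normc2 (U i ord0)); split=> // [i|m n mN nN].
  exact: normc2_ge0.
have ReE i k : (k <= N)%N -> Re (U i (inord k)) = Re (U i ord0) * (P k).[(e i)^-1].
  move=> kN.
  have := @tridiag_uniq R a b p a_gt0 p0 Xp (e i)^-1 (fun k => Re (U i (inord k))) N.
  have -> : (inord 0 : 'I_N.+1) = ord0 by apply: val_inj; rewrite /= inordK.
  apply=> // l lN; rewrite -Re_tridiag HU//.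
  case: (jacobi_action _ _ _ _) => z1 z2; rewrite /= mul0r subr0 mulrA mulVf ?mul1r//.
  by rewrite gt_eqF.
have ImE i k : (k <= N)%N -> Im (U i (inord k)) = Im (U i ord0) * (P k).[(e i)^-1].
  move=> kN.
  have := @tridiag_uniq R a b p a_gt0 p0 Xp (e i)^-1 (fun k => Im (U i (inord k))) N.
  have -> : (inord 0 : 'I_N.+1) = ord0 by apply: val_inj; rewrite /= inordK.
  apply=> // l lN; rewrite -Im_tridiag HU//.
  case: (jacobi_action _ _ _ _) => z1 z2; rewrite /= mul0r addr0 mulrA mulVf ?mul1r//.
  by rewrite gt_eqF.
have := congr1 (@complex.Re R) (UU (inord m) (inord n)).
have -> : (inord m == inord n :> 'I_N.+1) = (m == n) by rewrite -val_eqE/= !inordK.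
have -> : Re ((m == n)%:R : R[i]) = (m == n)%:R by case: (m == n).
move=> <-; rewrite raddf_sum; apply: eq_bigr => i _ /=.
have ReMJ (z z' : R[i]) : Re (z^* * z') = Re z * Re z' + Im z * Im z'.
  by case: z z' => z1 z2 [z3 z4] /=; rewrite mulNr opprK.
rewrite ReMJ !ReE// !ImE// /normc2; ring.
Qed.

(** In decreasing order, [j.+1] times [e j] is at most the sum of the first [j.+1] values, hence at
    most [tau]. Padding with zeros gives sequences on [nat] with a bound independent of [N]. *)
Lemma sorted_quadrature N : exists e w : nat -> R,
  [/\ forall j, 0 <= e j <= tau / j.+1%:R, forall j, 0 <= w j,
      forall j, (j <= N)%N -> 0 < e j,
      forall j, (N < j)%N -> e j = 0 /\ w j = 0 &
      forall m n, (m <= N)%N -> (n <= N)%N ->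
        \sum_(0 <= j < N.+1) w j * ((P m).[(e j)^-1] * (P n).[(e j)^-1]) = (m == n)%:R].
Proof.
have [e [w [e0 etau w0 H]]] := finite_quadrature N.
pose r := [rel x y : R * R | y.1 <= x.1].
pose l := sort r [seq (e i, w i) | i <- index_enum 'I_N.+1].
have rT : total r by move=> x y /=; exact: le_total.
have rTr : transitive r by move=> x y z /= h1 h2; exact: le_trans h2 h1.
have sl : size l = N.+1.
  by rewrite size_sort size_map -[index_enum _]enumT size_enum_ord.
have sumE (f : R * R -> R) : \sum_(0 <= j < N.+1) f (nth (0, 0) l j) = \sum_i f (e i, w i).
  rewrite -[in LHS]sl -(big_nth _ predT).
  rewrite (perm_big [seq (e i, w i) | i <- index_enum 'I_N.+1]) ?perm_sort//.
  by rewrite big_map.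
have lP x : x \in l -> 0 < x.1 /\ 0 <= x.2.
  by rewrite mem_sort => /mapP[i _ ->]; split; [exact: e0|exact: w0].
have ge0 j : 0 <= (nth (0, 0) l j).1 /\ 0 <= (nth (0, 0) l j).2.
  have [jN|Nj] := ltnP j (size l); last by rewrite nth_default.
  by have [/ltW] := lP _ (mem_nth (0, 0) jN).
exists (fun j => (nth (0, 0) l j).1), (fun j => (nth (0, 0) l j).2); split.
- move=> j; have [-> _] := ge0 j; rewrite /= ler_pdivlMr//.
  have [jN|Nj] := ltnP j (size l); last first.
    by rewrite nth_default// mul0r (hs_bound_ge0 T_bound).
  apply: le_trans etau; rewrite -(sumE (fun x => x.1)).
  rewrite (@big_cat_nat _ _ _ j.+1) ?sl -?sl//=.
  apply: (@le_trans _ _ (\sum_(0 <= i < j.+1) (nth (0, 0) l i).1)); last first.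
    by rewrite lerDl; apply: sumr_ge0 => i _; have [] := ge0 i.
  rewrite mulr_natr -[X in _ *+ X]subn0 -sumr_const_nat.
  rewrite big_nat_cond [leRHS]big_nat_cond; apply: ler_sum => i /andP[/andP[_ ij] _].
  have rR : reflexive r by move=> x /=; exact: lexx.
  have iN : (i < size l)%N := leq_ltn_trans (ij : (i <= j)%N) jN.
  exact: (@sorted_leq_nth _ r rTr rR (0, 0) l (sort_sorted rT _) i j iN jN ij).
- by move=> j; have [] := ge0 j.
- by move=> j jN; have [] := lP _ (@mem_nth _ (0, 0) l j _); rewrite ?sl.
- by move=> j Nj; rewrite nth_default ?sl.
- move=> m n mN nN; rewrite -H//.
  exact: (sumE (fun x => x.2 * ((P m).[x.1^-1] * (P n).[x.1^-1]))).
Qed.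

(** The quadrature form of [b n] being the mean of ['X * P n ^+ 2]. Expanding ['X * P n] involves
    [P n.+1], whence [n < N]. It later controls the contribution of large nodes. *)
Lemma quadrature_energy N (e w : nat -> R) n : (n < N)%N ->
  (forall m n, (m <= N)%N -> (n <= N)%N ->
    \sum_(0 <= j < N.+1) w j * ((P m).[(e j)^-1] * (P n).[(e j)^-1]) = (m == n)%:R) ->
  \sum_(0 <= j < N.+1) (e j)^-1 * (w j * (P n).[(e j)^-1] ^+ 2) = b n.
Proof.
move=> nN H.
have E j : (e j)^-1 * (w j * (P n).[(e j)^-1] ^+ 2) =
  (if n is m.+1 then a m * (w j * ((P m).[(e j)^-1] * (P n).[(e j)^-1])) else 0) +
  b n * (w j * ((P n).[(e j)^-1] * (P n).[(e j)^-1])) +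
  a n * (w j * ((P n.+1).[(e j)^-1] * (P n).[(e j)^-1])).
  transitivity (w j * (P n).[(e j)^-1] * ((e j)^-1 * (P n).[(e j)^-1])); first by ring.
  by rewrite -(onp_tridiag a_gt0 Xp) /tridiag; case: (n) => [|m]; ring.
under eq_bigr do rewrite E.
rewrite !big_split/= -!mulr_sumr !H ?(ltnW nN)// eqxx gtn_eqF// mulr1 mulr0 addr0.
case: n nN {E} => [|m] mN; first by rewrite big1 ?add0r.
by rewrite -mulr_sumr H ?ltn_eqF ?mulr0 ?add0r// ltnW// ltnW.
Qed.

End FiniteQuadrature.

(** * Passage to the limit *)

(** The image of an ultrafilter is an ultrafilter, here containing a compact interval. *)
Lemma ultra_bounded_cvg (R : realType) (U : set_system nat) (u : nat -> R) (c : R) :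
  UltraFilter U -> (\forall N \near U, `|u N| <= c) -> exists l : R, u @ U --> l.
Proof.
move=> UU Hc; have : compact `[- c, c] by exact: segment_compact.
rewrite compact_ultra => /(_ (u @ U)).
have UuU : UltraFilter (u @ U).
  split; first exact: fmap_proper_filter.
  move=> G GF uG; apply/seteqP; split=> [A GA|//].
  have [//|UnA] := in_ultra_setVsetC (u @^-1` A) UU.
  have GnA : G (~` A) by exact: uG.
  have G0 : G set0 by rewrite -(setICr A); exact: filterI.
  by case: (@filter_not_empty _ G GF).
have UA : (u @ U) `[- c, c]%classic.
  by apply: filterS Hc => N /=; rewrite in_itv/= ler_norml.
by move=> /(_ UuU UA) [l [_ Hl]]; exists l.
Qed.

Section LimitQuadrature.
Variables (R : realType) (lam mu : nat -> R).
Hypotheses (lam_gt0 : forall n, 0 < lam n) (mu0 : mu 0 = 0)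
  (mu_gt0 : forall n, 0 < mu n.+1).

Let a n := Num.sqrt (lam n * mu n.+1).
Let b n := lam n + mu n.

Variable tau : R.
Hypothesis T_bound : hs_bound (bidiag_inv lam mu) tau.

Let a_gt0 n : 0 < a n.
Proof. by rewrite sqrtr_gt0 mulr_gt0. Qed.

Variable p : nat -> {poly R}.
Hypothesis p0 : p 0 = 1.
Hypothesis Xp : forall n, 'X * p n =
  p n.+1 + b n *: p n + (if n is m.+1 then a m ^+ 2 *: p m else 0).
Local Notation P := (onp a p).

Let tau0 : 0 <= tau := hs_bound_ge0 T_bound.

(** Limits are taken of [y N j n], the root of the weight times [P_n] at the node, which stays
    bounded while the node may go to infinity. The energy identity makes the tails in [j] small
    uniformly in [N]. *)
Lemma limit_quadrature : exists w x : nat -> R, (forall j, 0 <= w j) /\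
  forall m n, series (fun j => w j * ((P m).[x j] * (P n).[x j])) @ \oo
    --> ((m == n)%:R : R).
Proof.
have [e /choice[w Hew]] := choice (sorted_quadrature lam_gt0 mu0 mu_gt0 T_bound p0 Xp).
pose y N j n : R := Num.sqrt (w N j) * (P n).[(e N j)^-1].
have e_bd N j : 0 <= e N j <= tau / j.+1%:R by have [H _ _ _ _] := Hew N.
have w0 N j : 0 <= w N j by have [_ H _ _ _] := Hew N.
have e0 N j : (j <= N)%N -> 0 < e N j by have [_ _ H _ _] := Hew N; exact: H.
have ew_out N j : (N < j)%N -> e N j = 0 /\ w N j = 0.
  by have [_ _ _ H _] := Hew N; exact: H.
have orth N m n : (m <= N)%N -> (n <= N)%N ->
    \sum_(0 <= j < N.+1) w N j * ((P m).[(e N j)^-1] * (P n).[(e N j)^-1]) = (m == n)%:R.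
  by have [_ _ _ _ H] := Hew N; exact: H.
have yy N j m n : y N j m * y N j n = w N j * ((P m).[(e N j)^-1] * (P n).[(e N j)^-1]).
  by rewrite /y -[in RHS](sqr_sqrtr (w0 N j)); ring.
have y_orth N m n : (m <= N)%N -> (n <= N)%N ->
    \sum_(0 <= j < N.+1) y N j m * y N j n = (m == n)%:R.
  by move=> mN nN; rewrite -(orth N)//; apply: eq_bigr => j _.
have y_energy N n : (n < N)%N -> \sum_(0 <= j < N.+1) (e N j)^-1 * y N j n ^+ 2 = b n.
  move=> nN; apply: etrans (quadrature_energy lam_gt0 mu_gt0 Xp nN (orth N)).
  by apply: eq_bigr => j _; rewrite expr2 yy expr2.
have y_out N j n : (N < j)%N -> y N j n = 0.
  by move=> /ew_out[_ wN]; rewrite /y wN sqrtr0 mul0r.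
have en_ge0 N j n : 0 <= (e N j)^-1 * y N j n ^+ 2.
  by rewrite mulr_ge0 ?sqr_ge0// invr_ge0; case/andP: (e_bd N j).
have y_e N j n : (n < N)%N -> y N j n ^+ 2 <= e N j * b n.
  move=> nN; have [jN|Nj] := leqP j N; last first.
    by rewrite y_out// (ew_out _ _ Nj).1 mul0r expr0n.
  rewrite -(y_energy N n nN) (bigD1_seq j) ?mem_index_iota ?iota_uniq//=.
  rewrite mulrDr mulrA divff ?mul1r ?gt_eqF ?e0// lerDl.
  rewrite mulr_ge0 ?(ltW (e0 _ _ jN))//; apply: sumr_ge0 => i _; exact: en_ge0.
(* From index [J] on, the reciprocal nodes are at most [tau / J.+1%:R], so the energy [b n] bounds
   the squares there. *)
have y_tail N J n : (n < N)%N -> (J <= N)%N ->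
    \sum_(J <= j < N.+1) y N j n ^+ 2 <= tau / J.+1%:R * b n.
  move=> nN JN; rewrite -(y_energy N n nN) mulr_sumr.
  rewrite [leRHS](@big_cat_nat _ _ _ J) ?(leqW JN)//=.
  apply: (@le_trans _ _ (\sum_(J <= j < N.+1) tau / J.+1%:R * ((e N j)^-1 * y N j n ^+ 2))).
    rewrite big_nat_cond [leRHS]big_nat_cond; apply: ler_sum => j /andP[/andP[Jj jN] _].
    have ej := e0 N j jN.
    have E : y N j n ^+ 2 = e N j * ((e N j)^-1 * y N j n ^+ 2).
      by rewrite mulrA divff ?mul1r// gt_eqF.
    rewrite [leLHS]E ler_wpM2r ?en_ge0//.
    have /andP[_ h] := e_bd N j; apply: le_trans h _; rewrite ler_wpM2l//.
    by rewrite lef_pV2 ?posrE// ler_nat.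
  rewrite lerDr; apply: sumr_ge0 => j _; rewrite mulr_ge0 ?en_ge0//.
  by rewrite divr_ge0.
(* Multiplied through by [e N j], the eigenvalue equation passes to the limit even when [e N j]
   tends to [0]. *)
have y_tri N j n : y N j n = e N j * tridiag a b (y N j) n.
  have [jN|Nj] := leqP j N; last by rewrite y_out// (ew_out _ _ Nj).1 mul0r.
  have -> : tridiag a b (y N j) n = (e N j)^-1 * y N j n.
    rewrite /y mulrCA -(onp_tridiag a_gt0 Xp) /tridiag.
    by case: n => [|n]; ring.
  by rewrite mulrA divff ?mul1r// gt_eqF// e0.
have y_le1 N j n : (n <= N)%N -> `|y N j n| <= 1.
  move=> nN; have [jN|Nj] := leqP j N; last by rewrite y_out// normr0.
  rewrite -(@ler_pXn2r _ 2) ?nnegrE// expr1n real_normK ?num_real//.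
  have E : \sum_(0 <= j < N.+1) y N j n * y N j n = 1 by rewrite y_orth// eqxx.
  rewrite -[leRHS]E (bigD1_seq j) ?mem_index_iota ?iota_uniq//= expr2 lerDl.
  by apply: sumr_ge0 => i _; rewrite -expr2 sqr_ge0.
(* One ultrafilter finer than [\oo] provides the limits of all these bounded sequences at once. *)
have [U [UU oU]] := @ultraFilterLemma nat \oo _.
have UP : ProperFilter U := @ultra_proper _ _ UU.
have big k : \forall N \near U, (k <= N)%N by apply: oU; exact: nbhs_infty_ge.
have /choice[el Hel] j : exists l : R, (fun N => e N j) @ U --> l.
  apply: (@ultra_bounded_cvg _ _ _ (tau / j.+1%:R)) => //.
  by near=> N; have /andP[h1 h2] := e_bd N j; rewrite ger0_norm.
have /choice[yl Hyl] jn : exists l : R, (fun N => y N jn.1 jn.2) @ U --> l.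
  case: jn => j n /=; apply: (@ultra_bounded_cvg _ _ _ 1) => //.
  by apply: filterS (big n) => N nN; exact: y_le1.
have lim_le (u : nat -> R) (l k : R) : u @ U --> l -> (\forall N \near U, u N <= k) -> l <= k.
  move=> ul uk; rewrite -(cvg_lim (@Rhausdorff R) ul); apply: limr_le => //.
  by apply/cvg_ex; exists l.
pose z j n := yl (j, n).
have Hz j n : (fun N => y N j n) @ U --> z j n by exact: (Hyl (j, n)).
have z_e j n : z j n ^+ 2 <= el j * b n.
  rewrite -subr_le0; apply: (lim_le (fun N => y N j n ^+ 2 - e N j * b n)).
    apply: cvgB; first by rewrite expr2; under eq_fun do rewrite expr2; exact: cvgM.
    by apply: cvgM => //; exact: cvg_cst.
  by apply: filterS (big n.+1) => N nN; rewrite subr_le0; exact: y_e.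
have z_tri j n : z j n = el j * tridiag a b (z j) n.
  have C : (fun N => e N j * tridiag a b (y N j) n) @ U --> el j * tridiag a b (z j) n.
    apply: cvgM => //; rewrite /tridiag.
    apply: cvgD; last by apply: cvgM => //; exact: cvg_cst.
    apply: cvgD; last by apply: cvgM => //; exact: cvg_cst.
    by case: n => [|n]; [exact: cvg_cst|apply: cvgM => //; exact: cvg_cst].
  have := @cvg_unique _ (@Rhausdorff R) (y ^~ j ^~ n @ U) _ (z j n) _ (Hz j n).
  apply; rewrite (_ : (fun N => _) = (fun N => e N j * tridiag a b (y N j) n))//.
  by apply/funext => N.
(* If [el j = 0], the node has gone to infinity; [z_e] then makes every [z j n] vanish, so index [j]
   gets weight [0] in the limit. *)
have z_onp j n : z j n = z j 0 * (P n).[(el j)^-1].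
  have [ej|ej] := eqVneq (el j) 0.
    have z0 k : z j k = 0.
      by apply/eqP; rewrite -sqrf_eq0 eq_le sqr_ge0 andbT -(mul0r (b k)) -ej.
    by rewrite !z0 mul0r.
  apply: (tridiag_uniq a_gt0 p0 Xp (N := n)) => // k _.
  by rewrite [in RHS]z_tri mulrA mulVf ?mul1r.
exists (fun j => z j 0 ^+ 2), (fun j => (el j)^-1); split=> [j|m n]; first exact: sqr_ge0.
rewrite (_ : (fun j => _) = (fun j => z j m * z j n)); last first.
  by apply/funext => j; rewrite (z_onp j m) (z_onp j n); ring.
pose c := (b m + b n) / 2 * tau.
have b0 k : 0 <= b k.
  rewrite /b addr_ge0 ?(ltW (lam_gt0 _))//; case: k => [|k]; first by rewrite mu0.
  exact: ltW.
have c0 : 0 <= c by rewrite /c mulr_ge0// divr_ge0// addr_ge0.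
(* At fixed [J] the tail bound holds for all large [N] and survives the limit along [U]; only then
   does [J] grow. *)
have close J : `|\sum_(0 <= j < J) z j m * z j n - (m == n)%:R| <= c / J.+1%:R.
  have tail N : (J <= N)%N -> (m < N)%N -> (n < N)%N ->
      `|\sum_(0 <= j < J) y N j m * y N j n - (m == n)%:R| <= c / J.+1%:R.
    move=> JN mN nN; rewrite -(y_orth N m n (ltnW mN) (ltnW nN)).
    rewrite [X in _ - X](@big_cat_nat _ _ _ J) ?(leqW JN)//= opprD addrA subrr add0r normrN.
    apply: le_trans (ler_norm_sum _ _ _) _.
    apply: (@le_trans _ _ (\sum_(J <= j < N.+1) (y N j m ^+ 2 + y N j n ^+ 2) / 2)).
      apply: ler_sum => j _; rewrite normrM.
      rewrite -[y N j m ^+ 2]real_normK ?num_real// -[y N j n ^+ 2]real_normK ?num_real//.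
      have := sqr_ge0 (`|y N j m| - `|y N j n|); lra.
    rewrite -mulr_suml big_split/=.
    have -> : c / J.+1%:R = (tau / J.+1%:R * b m + tau / J.+1%:R * b n) / 2.
      by rewrite /c; ring.
    by rewrite ler_wpM2r// lerD// y_tail.
  have C : (fun N => `|\sum_(0 <= j < J) y N j m * y N j n - (m == n)%:R|) @ U -->
     `|\sum_(0 <= j < J) z j m * z j n - (m == n)%:R|.
    apply: cvg_norm; apply: cvgB; last exact: cvg_cst.
    by apply: cvg_big => [|j _]; [exact: add_continuous|exact: cvgM].
  apply: (lim_le _ _ _ C).
  near=> N; apply: tail; near: N; exact: big.
apply/cvgrPdist_le => eps eps0; near=> J.
rewrite distrC; apply: le_trans (close J) _.
rewrite ler_pdivrMr// mulrC -ler_pdivrMr//; apply: ltW.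
apply: lt_le_trans (_ : J%:R <= _); last by rewrite ler_nat.
near: J; exact: nbhs_infty_gtr.
Unshelve. all: by end_near. Qed.

End LimitQuadrature.

(** * The modified q-Laguerre coefficients *)

Section QPochhammer.
Variables (R : realType) (q : R).
Hypotheses (q_gt0 : 0 < q) (q_lt1 : q < 1).

Lemma qpoch0 (z : R) : qpoch q z 0 = 1.
Proof. by rewrite /qpoch big_geq. Qed.

Lemma qpochS (z : R) n : qpoch q z n.+1 = qpoch q z n * (1 - z * q ^+ n).
Proof. by rewrite /qpoch big_nat_recr. Qed.

Lemma qpoch_recl (z : R) n : qpoch q z n.+1 = (1 - z) * qpoch q (z * q) n.
Proof.
rewrite /qpoch big_nat_recl// expr0 mulr1; congr (_ * _).
by apply: eq_bigr => i _; rewrite exprS mulrA.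
Qed.

Lemma qpow_le1 n : q ^+ n <= 1.
Proof. by rewrite exprn_ile1// ltW. Qed.

Lemma qpow_ge0 n : 0 <= q ^+ n.
Proof. by rewrite exprn_ge0// ltW. Qed.

Lemma qpow_lt1 n : q ^+ n.+1 < 1.
Proof. by rewrite exprn_ilt1// ltW. Qed.

Lemma qfactor_ge0 z n : 0 <= z <= 1 -> 0 <= 1 - z * q ^+ n.
Proof.
move=> /andP[z0 z1]; rewrite subr_ge0.
by rewrite (le_trans (ler_piMr z0 (qpow_le1 n))).
Qed.

Lemma qfactor_gt0 z n : 0 <= z < 1 -> 0 < 1 - z * q ^+ n.
Proof.
move=> /andP[z0 z1]; rewrite subr_gt0.
by rewrite (le_lt_trans (ler_piMr z0 (qpow_le1 n))).
Qed.

Lemma qpoch_ge0 z n : 0 <= z <= 1 -> 0 <= qpoch q z n.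
Proof. by move=> z01; apply: prodr_ge0 => i _; exact: qfactor_ge0. Qed.

Lemma qpoch_gt0 z n : 0 <= z < 1 -> 0 < qpoch q z n.
Proof.
move=> z01; elim: n => [|n IH]; first by rewrite qpoch0.
by rewrite qpochS mulr_gt0// qfactor_gt0.
Qed.

Lemma qpoch_nonincreasing z : 0 <= z <= 1 -> nonincreasing_seq (qpoch q z).
Proof.
move=> z01; apply/nonincreasing_seqP => n; rewrite qpochS.
rewrite ler_piMr ?qpoch_ge0// gerBl mulr_ge0 ?qpow_ge0//.
by case/andP: z01.
Qed.

Lemma qpoch_inf_cvg z : 0 <= z <= 1 -> qpoch q z @ \oo --> qpoch_inf q z.
Proof.
move=> z01; apply: nonincreasing_is_cvgn; first exact: qpoch_nonincreasing.
by exists 0 => _ [n _ <-]; exact: qpoch_ge0.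
Qed.

Lemma qpoch_inf_ge0 z : 0 <= z <= 1 -> 0 <= qpoch_inf q z.
Proof.
move=> z01; apply: limr_ge; first by apply/cvg_ex; eexists; exact: qpoch_inf_cvg.
by near=> n; exact: qpoch_ge0.
Unshelve. all: by end_near. Qed.

Lemma qpoch_inf_le z n : 0 <= z <= 1 -> qpoch_inf q z <= qpoch q z n.
Proof.
move=> z01; apply: nonincreasing_cvgn_ge; first exact: qpoch_nonincreasing.
by apply/cvg_ex; eexists; exact: qpoch_inf_cvg.
Qed.

Lemma qshift01 z : 0 <= z <= 1 -> 0 <= z * q <= 1.
Proof.
move=> /andP[z0 z1]; rewrite mulr_ge0 ?(ltW q_gt0)//=.
by rewrite (le_trans _ z1)// ler_piMr// ltW.
Qed.

Lemma qpoch_inf_recl z : 0 <= z <= 1 -> qpoch_inf q z = (1 - z) * qpoch_inf q (z * q).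
Proof.
move=> z01; apply: cvg_lim => //.
have C : (fun n => qpoch q z n.+1) @ \oo --> (1 - z) * qpoch_inf q (z * q).
  under eq_fun do rewrite qpoch_recl.
  by apply: cvgM; [exact: cvg_cst|exact/qpoch_inf_cvg/qshift01].
by rewrite -(cvg_shiftS (qpoch q z)).
Qed.

Lemma qpoch_inf_anti z z' : 0 <= z -> z <= z' -> z' <= 1 ->
  qpoch_inf q z' <= qpoch_inf q z.
Proof.
move=> z0 zz' z1.
have z01 : 0 <= z <= 1 by rewrite z0 (le_trans zz').
have z01' : 0 <= z' <= 1 by rewrite z1 (le_trans z0).
apply: (ler_cvg_to (qpoch_inf_cvg z01') (qpoch_inf_cvg z01)).
near=> n; apply: ler_prod => i _; rewrite qfactor_ge0//= lerD2l lerN2.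
by rewrite ler_wpM2r// qpow_ge0.
Unshelve. all: by end_near. Qed.

Lemma sum_qpow_le n : \sum_(0 <= k < n) q ^+ k <= (1 - q)^-1.
Proof.
have q1 : 0 < 1 - q by rewrite subr_gt0.
rewrite -[leRHS]mul1r ler_pdivlMr//.
have -> : (\sum_(0 <= k < n) q ^+ k) * (1 - q) = 1 - q ^+ n.
  elim: n => [|n IH]; first by rewrite big_geq// mul0r expr0 subrr.
  by rewrite big_nat_recr//= mulrDl IH exprS; ring.
by rewrite gerBl qpow_ge0.
Qed.

(** A product of factors [1 - u_k] is at least one minus the sum of the [u_k]; with
    [u_k = z * q ^+ k] the sum is geometric. *)
Lemma qpoch_inf_lower z : 0 <= z <= 1 -> 1 - z / (1 - q) <= qpoch_inf q z.
Proof.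
move=> z01; have /andP[z0 z1] := z01.
apply: limr_ge; first by apply/cvg_ex; eexists; exact: qpoch_inf_cvg.
near=> n; apply: (@le_trans _ _ (1 - z * \sum_(0 <= k < n) q ^+ k)).
  by rewrite lerD2l lerN2 ler_wpM2l// sum_qpow_le.
elim: (n) => [|k IH]; first by rewrite qpoch0 big_geq// mulr0 subr0.
rewrite big_nat_recr//= qpochS.
have h : qpoch q z k <= 1.
  by rewrite -(qpoch0 z); apply: qpoch_nonincreasing.
have : 0 <= z * q ^+ k by rewrite mulr_ge0// qpow_ge0.
move: IH h; set S := \sum_(_ <= _ < _) _; set P := qpoch _ _ _; set c := q ^+ k.
nra.
Unshelve. all: by end_near. Qed.

(** The lower bound is positive only for small arguments; [qpoch_inf_recl] first splits off finitely
    many positive factors, replacing [z] by [z * q ^+ n]. *)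
Lemma qpoch_inf_gt0 z : 0 <= z < 1 -> 0 < qpoch_inf q z.
Proof.
move=> /andP[z0 z1].
have H n : qpoch_inf q (z * q ^+ n) > 0 -> qpoch_inf q z > 0.
  elim: n => [|n IH]; first by rewrite expr0 mulr1.
  move=> h; apply: IH; rewrite qpoch_inf_recl -?mulrA -?exprSr.
    by rewrite mulr_gt0// qfactor_gt0// z0.
  by rewrite mulr_ge0 ?qpow_ge0//= (le_trans (ler_piMr z0 (qpow_le1 n)))// ltW.
have q1 : 0 < 1 - q by rewrite subr_gt0.
have C : (fun n => q ^+ n) @ \oo --> (0 : R).
  by apply: cvg_expr; rewrite ger0_norm// ltW.
near \oo => n; apply: (H n); apply: lt_le_trans (qpoch_inf_lower _); last first.
  by rewrite mulr_ge0 ?qpow_ge0//= (le_trans (ler_piMr z0 (qpow_le1 n)))// ltW.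
rewrite subr_gt0 ltr_pdivrMr// mul1r.
apply: (@le_lt_trans _ _ (q ^+ n)); first by rewrite ler_piMl ?qpow_ge0// ltW.
rewrite -[ltLHS]ger0_norm ?qpow_ge0// -normrN -sub0r.
by near: n; exact: (cvgrPdist_lt _ _).1 C _ q1.
Unshelve. all: by end_near. Qed.

End QPochhammer.

(** * The ratios [r_n] and estimates for [lambda_n], [mu_n] and [T] *)

Section QGamma.
Variables (R : realType) (q alpha : R).
Hypotheses (q_gt0 : 0 < q) (q_lt1 : q < 1) (alpha_gtN1 : -1 < alpha).

Let Q : R := q `^ (alpha + 1).

Let Q_gt0 : 0 < Q. Proof. exact: powR_gt0. Qed.

Let Q_lt1 : Q < 1.
Proof.
rewrite /Q /powR gt_eqF// expR_lt1 pmulr_rlt0 ?ln_lt0 ?q_gt0//.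
by rewrite -ltrBlDr sub0r.
Qed.

Let x n : R := q ^+ n.
Let x_gt0 n : 0 < x n. Proof. by rewrite exprn_gt0. Qed.
Let x_le1 n : x n <= 1. Proof. exact: qpow_le1. Qed.
Let xS n : x n.+1 = x n * q. Proof. exact: exprSr. Qed.

Let gam n : R := qpoch_inf q (x n) / qpoch_inf q (x n * Q).

Lemma qlaguerre_gammaE n : qlaguerre_gamma q n%:R (alpha + 1) = gam n.
Proof.
rewrite /qlaguerre_gamma powR_mulrn ?(ltW q_gt0)// powRD; last first.
  by apply/implyP => _; rewrite gt_eqF.
by rewrite powR_mulrn ?(ltW q_gt0).
Qed.

Let xQ01 n : 0 <= x n * Q < 1.
Proof.
rewrite mulr_ge0 ?(ltW (x_gt0 n)) ?(ltW Q_gt0)//=.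
by rewrite (le_lt_trans _ Q_lt1)// ler_piMl// ltW.
Qed.

Let den_gt0 n : 0 < qpoch_inf q (x n * Q).
Proof. exact: qpoch_inf_gt0. Qed.

Let x01 n : 0 <= x n <= 1.
Proof. by rewrite (ltW (x_gt0 n)) x_le1. Qed.

Let xQ01' n : 0 <= x n * Q <= 1.
Proof. by have /andP[-> /ltW ->] := xQ01 n. Qed.

Let gam_rec n : gam n * (1 - x n * Q) = gam n.+1 * (1 - x n).
Proof.
have h : 1 - x n * Q != 0 by rewrite subr_eq0 eq_sym lt_eqF//; have /andP[] := xQ01 n.
rewrite /gam (qpoch_inf_recl q_gt0 q_lt1 (x01 n)) (qpoch_inf_recl q_gt0 q_lt1 (xQ01' n)).
rewrite xS [x n * Q * q]mulrAC; have := den_gt0 n.+1; rewrite xS => /lt0r_neq0 h2.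
by field; rewrite h h2.
Qed.

Let gam_ge0 n : 0 <= gam n.
Proof. by rewrite divr_ge0 ?(ltW (den_gt0 n))// qpoch_inf_ge0. Qed.

(** The first factors give the strict inequality [1 - x n < 1 - x n * Q]; the remaining products
    compare weakly. *)
Let gam_lt1 n : gam n < 1.
Proof.
rewrite ltr_pdivrMr// mul1r.
rewrite (qpoch_inf_recl q_gt0 q_lt1 (x01 n)) (qpoch_inf_recl q_gt0 q_lt1 (xQ01' n)).
have d0 := den_gt0 n.+1; rewrite xS in d0.
have h1 : qpoch_inf q (x n * q) <= qpoch_inf q (x n * Q * q).
  apply: qpoch_inf_anti => //.
  - by have /andP[] := qshift01 q_gt0 q_lt1 (xQ01' n).
  - rewrite mulrAC ler_piMr ?(ltW Q_lt1)//.
    by have /andP[] := qshift01 q_gt0 q_lt1 (x01 n).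
  - by have /andP[] := qshift01 q_gt0 q_lt1 (x01 n).
apply: (@le_lt_trans _ _ ((1 - x n) * qpoch_inf q (x n * Q * q))).
  by rewrite ler_wpM2l// subr_ge0.
rewrite ltr_pM2r; last by rewrite mulrAC.
by rewrite ltrD2l ltrN2 gtr_pMr.
Qed.

Let g n := 1 - gam n.

Let g_gt0 n : 0 < g n. Proof. by rewrite subr_gt0. Qed.

(** The denominator of [gam n] is at most [1], so [gam n >= qpoch_inf q (x n)]. *)
Let g_le n : g n <= x n / (1 - q).
Proof.
have h := qpoch_inf_lower q_gt0 q_lt1 (x01 n).
rewrite /g lerBlDr -lerBlDl; apply: le_trans h _.
rewrite ler_pdivlMr// ler_piMr ?qpoch_inf_ge0//.
by apply: le_trans (qpoch_inf_le q_gt0 q_lt1 0 (xQ01' n)) _; rewrite qpoch0.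
Qed.

Let g_decr n : g n.+1 <= g n.
Proof.
rewrite lerD2l lerN2.
have h : 0 < 1 - x n * Q by rewrite subr_gt0; have /andP[] := xQ01 n.
rewrite -(ler_pM2r h) gam_rec ler_wpM2l ?gam_ge0// lerD2l lerN2.
by rewrite ler_piMr ?(ltW (x_gt0 n))// ltW.
Qed.

Lemma qlag_rE n : qlag_r q alpha n = g n.+1 / g n.
Proof. by rewrite /qlag_r !qlaguerre_gammaE. Qed.

Lemma qlag_r_gt0 n : 0 < qlag_r q alpha n.
Proof. by rewrite qlag_rE divr_gt0. Qed.

Lemma qlag_r_le1 n : qlag_r q alpha n <= 1.
Proof. by rewrite qlag_rE ler_pdivrMr// mul1r. Qed.

Definition qlag_c n : R := q * (1 - q ^+ n) / (q ^+ n ^+ 2 * q `^ (alpha + 1)).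
Definition qlag_d n : R :=
  (1 - q ^+ n * q `^ (alpha + 1)) / (q ^+ n ^+ 2 * q `^ (alpha + 1)).

Lemma qlag_lambdaE n : qlag_lambda q alpha n = qlag_d n / qlag_r q alpha n.
Proof.
rewrite /qlag_lambda /qlag_d -!/Q -!/(x n); congr (_ / _).
have -> : q `^ (n%:R + alpha + 1) = x n * Q.
  by rewrite -addrA powRD ?powR_mulrn ?(ltW q_gt0)//; apply/implyP => _; rewrite gt_eqF.
have -> : q `^ (- 2 * n%:R - alpha - 1) = (x n ^+ 2 * Q)^-1.
  rewrite (_ : _ - 1 = - ((2 * n%:R) + (alpha + 1))); last by ring.
  rewrite powRN powRD; last by apply/implyP => _; rewrite gt_eqF.
  by rewrite -natrM powR_mulrn ?(ltW q_gt0)// mulnC exprM.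
by rewrite mulrC.
Qed.

Lemma qlag_muE n : qlag_mu q alpha n = qlag_c n * qlag_r q alpha n.
Proof.
rewrite /qlag_mu /qlag_c -!/Q -!/(x n); congr (_ * _).
have -> : q `^ (- 2 * n%:R - alpha) = q * (x n ^+ 2 * Q)^-1.
  rewrite (_ : _ - _ = 1 - ((2 * n%:R) + (alpha + 1))); last by ring.
  rewrite powRD; last by apply/implyP => _; rewrite gt_eqF.
  rewrite powRr1 ?(ltW q_gt0)// powRN powRD; last by apply/implyP => _; rewrite gt_eqF.
  by rewrite -natrM powR_mulrn ?(ltW q_gt0)// mulnC exprM.
by rewrite mulrAC.
Qed.

(** Equivalent to the Riccati relation [c_(n+1) (1 - r_(n+1)) = d_n (1 / r_n - 1)]. By [gam_rec],
    [gam n] and [gam n.+2] are multiples of [gam n.+1], which leaves a rational identity. *)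
Lemma qlag_cdE n :
  qlag_c n.+1 + qlag_d n = qlag_mu q alpha n.+1 + qlag_lambda q alpha n.
Proof.
rewrite qlag_muE qlag_lambdaE !qlag_rE /qlag_c /qlag_d -!/Q (exprSr q).
have X0 := lt0r_neq0 (x_gt0 n); have q0 := lt0r_neq0 q_gt0.
have Q0 := lt0r_neq0 Q_gt0; have g1 := lt0r_neq0 (g_gt0 n.+1).
have g0 := lt0r_neq0 (g_gt0 n).
have f1 : 1 - x n * q != 0 by rewrite -xS lt0r_neq0// subr_gt0 qpow_lt1.
have f2 : 1 - x n * Q != 0 by rewrite lt0r_neq0// subr_gt0; have /andP[] := xQ01 n.
have G0 : gam n = gam n.+1 * (1 - x n) / (1 - x n * Q) by rewrite -gam_rec mulfK.
have G2 : gam n.+2 = gam n.+1 * (1 - x n * q * Q) / (1 - x n * q).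
  by rewrite -xS gam_rec mulfK// xS.
rewrite -[RHS]addrC [X in _ = X + _](_ : _ = qlag_d n * (g n / g n.+1)); last first.
  by rewrite invf_div.
rewrite /g in g1 *; rewrite /qlag_d G0 G2 -!/(x n) -!/Q.
by field; rewrite ?g1 ?X0 ?Q0 ?q0 ?f1 ?f2.
Qed.

Lemma qlag_lambda_gt0 n : 0 < qlag_lambda q alpha n.
Proof.
rewrite qlag_lambdaE divr_gt0 ?qlag_r_gt0// divr_gt0//.
  by rewrite subr_gt0; have /andP[] := xQ01 n.
by rewrite mulr_gt0// exprn_gt0// x_gt0.
Qed.

Lemma qlag_mu_gt0 n : 0 < qlag_mu q alpha n.+1.
Proof.
rewrite qlag_muE mulr_gt0 ?qlag_r_gt0// divr_gt0//.
  by rewrite mulr_gt0// subr_gt0 qpow_lt1.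
by rewrite mulr_gt0// exprn_gt0// x_gt0.
Qed.

Lemma qlag_mu0 : qlag_mu q alpha 0 = 0.
Proof. by rewrite qlag_muE /qlag_c expr0 subrr mulr0 !mul0r. Qed.

(** Without denominators: [(1 - x n) * r ^+ 2 <= 1 - x n * Q], from [r <= 1] and [Q < 1]. *)
Lemma qlag_mu_lambda_le n : qlag_mu q alpha n <= q * qlag_lambda q alpha n.
Proof.
rewrite qlag_muE qlag_lambdaE /qlag_c /qlag_d -!/Q -!/(x n).
set r := qlag_r q alpha n.
have r0 : 0 < r := qlag_r_gt0 n; have r1 : r <= 1 := qlag_r_le1 n.
have D0 : 0 < x n ^+ 2 * Q by rewrite mulr_gt0// exprn_gt0.
set D := x n ^+ 2 * Q in D0 *.
rewrite -!mulrA ler_pM2l// [leLHS]mulrCA [leRHS]mulrCA ler_pM2l ?invr_gt0//.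
have xQx : x n * Q <= x n by rewrite ler_piMr ?(ltW (x_gt0 n))// ltW.
apply: (@le_trans _ _ (1 - x n)); first by rewrite ler_piMr ?subr_ge0.
rewrite ler_pdivlMr//; apply: (@le_trans _ _ (1 - x n)).
  by rewrite ler_piMr ?subr_ge0.
by rewrite lerD2l lerN2.
Qed.

Lemma qlag_lambdaV_le n : (qlag_lambda q alpha n)^-1 <= Q / (1 - Q) * (x n ^+ 2).
Proof.
rewrite qlag_lambdaE /qlag_d -!/Q -!/(x n) invf_div.
have D0 : 0 < x n ^+ 2 * Q by rewrite mulr_gt0// exprn_gt0.
have N0 : 0 < 1 - x n * Q by rewrite subr_gt0; have /andP[] := xQ01 n.
have Q1 : 0 < 1 - Q by rewrite subr_gt0.
have -> : qlag_r q alpha n / ((1 - x n * Q) / (x n ^+ 2 * Q)) =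
    qlag_r q alpha n * (x n ^+ 2 * Q / (1 - x n * Q)).
  by field; rewrite !gt_eqF.
apply: (@le_trans _ _ (x n ^+ 2 * Q / (1 - x n * Q))).
  by rewrite ler_piMl ?qlag_r_le1// divr_ge0// ltW.
rewrite mulrAC -mulrA [leRHS]mulrC ler_wpM2l ?sqr_ge0//.
rewrite mulrC ler_wpM2l ?(ltW Q_gt0)// lef_pV2 ?posrE//.
by rewrite lerD2l lerN2 ler_piMl ?(ltW Q_gt0).
Qed.

Local Notation T := (bidiag_inv (qlag_lambda q alpha) (qlag_mu q alpha)).

Let T_diag n : T n n ^+ 2 = (qlag_lambda q alpha n)^-1.
Proof.
have l0 := qlag_lambda_gt0 n.
have : Num.sqrt (qlag_lambda q alpha n) * T n n = 1.
  case: n l0 => [|n] l0; first by rewrite (bidiag_inv0 _ qlag_lambda_gt0).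
  have := bidiag_invS (qlag_mu q alpha) qlag_lambda_gt0 n n.+1.
  by rewrite (bidiag_inv_gt _ qlag_lambda_gt0 (ltnSn n)) mulr0 addr0 eqxx.
move=> /(congr1 (fun z => z ^+ 2)); rewrite exprMn sqr_sqrtr ?(ltW l0)// expr1n => h.
by apply: (mulfI (lt0r_neq0 l0)); rewrite h divff// gt_eqF.
Qed.

Let T_rec m n : (n <= m)%N ->
  T m.+1 n ^+ 2 = qlag_mu q alpha m.+1 / qlag_lambda q alpha m.+1 * T m n ^+ 2.
Proof.
move=> nm; have := bidiag_invS (qlag_mu q alpha) qlag_lambda_gt0 m n.
rewrite ltn_eqF// => /eqP; rewrite addr_eq0 => /eqP/(congr1 (fun z => z ^+ 2)).
have l0 := qlag_lambda_gt0 m.+1.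
rewrite sqrrN !exprMn !sqr_sqrtr ?(ltW l0) ?(ltW (qlag_mu_gt0 m))// => h.
by apply: (mulfI (lt0r_neq0 l0)); rewrite h; field; rewrite gt_eqF.
Qed.

(** The squared diagonal entry is of order [q ^+ n ^+ 2], and each step down the column multiplies
    the square by [mu / lambda <= q]. *)
Let T_sq_le m n : T m n ^+ 2 <= Q / (1 - Q) * (q ^+ m * q ^+ n).
Proof.
have C0 : 0 <= Q / (1 - Q) by rewrite divr_ge0 ?(ltW Q_gt0)// subr_ge0 ltW.
have [nm|mn] := leqP n m; last first.
  rewrite (bidiag_inv_gt _ qlag_lambda_gt0)// expr0n.
  by rewrite mulr_ge0// mulr_ge0// qpow_ge0.
rewrite -(subnK nm); elim: (m - n)%N => [|k IH].
  by rewrite add0n T_diag -expr2 qlag_lambdaV_le.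
rewrite addSn T_rec ?leq_addl// (exprSr q).
have h : qlag_mu q alpha (k + n).+1 / qlag_lambda q alpha (k + n).+1 <= q.
  by rewrite ler_pdivrMr ?qlag_lambda_gt0// qlag_mu_lambda_le.
apply: (@le_trans _ _ (q * T (k + n) n ^+ 2)); first by rewrite ler_wpM2r ?sqr_ge0.
apply: (@le_trans _ _ (q * (Q / (1 - Q) * (q ^+ (k + n) * q ^+ n)))).
  by rewrite ler_wpM2l ?(ltW q_gt0).
by rewrite le_eqVlt; apply/orP; left; apply/eqP; ring.
Qed.

Lemma qlag_hs_bound : hs_bound T (Q / (1 - Q) * ((1 - q)^-1 * (1 - q)^-1)).
Proof.
have C0 : 0 <= Q / (1 - Q) by rewrite divr_ge0 ?(ltW Q_gt0)// subr_ge0 ltW.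
have S0 n : 0 <= \sum_(0 <= i < n) q ^+ i by apply: sumr_ge0 => i _; exact: qpow_ge0.
move=> M N; apply: (@le_trans _ _
   (\sum_(0 <= m < M) \sum_(0 <= n < N) Q / (1 - Q) * (q ^+ m * q ^+ n))).
  by apply: ler_sum => m _; apply: ler_sum => n _; exact: T_sq_le.
under eq_bigr do rewrite -mulr_sumr -mulr_sumr.
rewrite -mulr_sumr -mulr_suml ler_wpM2l// ler_pM// sum_qpow_le//.
Qed.

(** [T_sq_le] is too weak here, as [mu] grows like [q ^- m] squared. Instead the square [K]
    satisfies the same first-order recursion as the explicit [h], so it is a multiple of [h], and
    [h] is of order [q ^+ m]. *)
Lemma qlag_decay n :
  (fun m => Num.sqrt (qlag_mu q alpha m.+1) * T m n) @ \oo --> (0 : R).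
Proof.
pose K m := qlag_mu q alpha m.+1 * T m n ^+ 2.
(* [h m.+1 / h m = mu_(m+2) / lambda_(m+1)], which telescopes. *)
pose h m := (q ^+ m)^-1 * qpoch q q m.+1 / qpoch q Q m.+1 * (g m.+1 * g m.+2).
have Q01 : 0 <= Q < 1 by rewrite (ltW Q_gt0).
have q01 : 0 <= q < 1 by rewrite (ltW q_gt0).
have h_gt0 m : 0 < h m.
  by rewrite !mulr_gt0 ?invr_gt0 ?exprn_gt0 ?qpoch_gt0.
have hS m : h m.+1 * qlag_lambda q alpha m.+1 = qlag_mu q alpha m.+2 * h m.
  rewrite /h qlag_muE qlag_lambdaE !qlag_rE /qlag_c /qlag_d -!/Q !(qpochS _ _ m.+1) !exprSr.
  have W0 := lt0r_neq0 (qpoch_gt0 q_gt0 q_lt1 m.+1 Q01).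
  have X0 : q ^+ m != 0 by rewrite gt_eqF// exprn_gt0.
  have f0 : 1 - Q * (q ^+ m * q) != 0.
    by rewrite -exprSr gt_eqF// qfactor_gt0.
  have f0' : 1 - q ^+ m * q * Q != 0 by rewrite [_ * Q]mulrC.
  have g1 := lt0r_neq0 (g_gt0 m.+1); have g2 := lt0r_neq0 (g_gt0 m.+2).
  have g3 := lt0r_neq0 (g_gt0 m.+3).
  have Q0 := lt0r_neq0 Q_gt0; have q0 := lt0r_neq0 q_gt0.
  by field; rewrite X0 W0 f0 g1 g2 Q0 q0.
have KS m : (n <= m)%N -> K m.+1 * h m = K m * h m.+1.
  move=> nm; have l0 := lt0r_neq0 (qlag_lambda_gt0 m.+1).
  rewrite /K T_rec// -[h m.+1](mulfK l0) hS.
  by field.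
have Kh k : K (k + n)%N = K n / h n * h (k + n)%N.
  elim: k => [|k IH]; first by rewrite add0n divfK// gt_eqF.
  apply: (mulIf (lt0r_neq0 (h_gt0 (k + n)%N))).
  by rewrite addSn KS ?leq_addl// IH; ring.
pose c := qpoch_inf q Q.
have c0 : 0 < c by exact: qpoch_inf_gt0.
have q1 : 0 < 1 - q by rewrite subr_gt0.
pose E := K n / h n * (c^-1 * (q ^+ 3 / (1 - q) ^+ 2)).
have K0 m : 0 <= K m by rewrite mulr_ge0 ?sqr_ge0// ltW// qlag_mu_gt0.
(* Each of the two factors [g] contributes [q ^+ m] against one [(q ^+ m)^-1]; the quotient of
   [qpoch] values is at most [c^-1]. *)
have h_le m : h m <= c^-1 * (q ^+ 3 / (1 - q) ^+ 2) * q ^+ m.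
  have -> : c^-1 * (q ^+ 3 / (1 - q) ^+ 2) * q ^+ m =
     ((q ^+ m)^-1 / c) * (x m.+1 / (1 - q) * (x m.+2 / (1 - q))).
    rewrite /x !exprSr; field.
    by rewrite !gt_eqF ?exprn_gt0.
  rewrite /h; apply: ler_pM.
  - by rewrite ltW// !mulr_gt0 ?invr_gt0 ?exprn_gt0 ?qpoch_gt0.
  - by rewrite ltW// mulr_gt0.
  - rewrite -mulrA ler_wpM2l ?invr_ge0 ?qpow_ge0//.
    rewrite ler_pdivrMr ?qpoch_gt0//.
    apply: (@le_trans _ _ 1).
      rewrite -(qpoch0 q q); apply: qpoch_nonincreasing => //.
      by rewrite (ltW q_gt0) ltW.
    by rewrite mulrC ler_pdivlMr// mul1r qpoch_inf_le// (ltW Q_gt0) ltW.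
  - by apply: ler_pM; rewrite ?(ltW (g_gt0 _))// g_le.
have KE m : (n <= m)%N -> K m <= E * q ^+ m.
  move=> nm; rewrite -(subnK nm) Kh /E -[leRHS]mulrA ler_wpM2l//.
  by rewrite divr_ge0// ltW.
have C : (fun m => E * q ^+ m) @ \oo --> (0 : R).
  rewrite -(mulr0 E); apply: cvgM; first exact: cvg_cst.
  by apply: cvg_expr; rewrite ger0_norm// ltW.
apply/cvgr0Pnorm_lt => e e0.
have e20 : 0 < e ^+ 2 by rewrite exprn_gt0.
near=> m.
rewrite -(@ltr_pXn2r _ 2) ?nnegrE ?(ltW e0)// real_normK ?num_real//.
rewrite exprMn sqr_sqrtr ?(ltW (qlag_mu_gt0 _))//.
have nm : (n <= m)%N by near: m; exact: nbhs_infty_ge.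
apply: le_lt_trans (KE m nm) _; apply: le_lt_trans (ler_norm _) _.
rewrite -normrN -sub0r; near: m; exact: (cvgrPdist_lt _ _).1 C _ e20.
Unshelve. all: by end_near. Qed.

End QGamma.

(** * The three-term recurrence *)

Section QLaguerreCoef.
Variables (R : realType) (q : R).
Hypotheses (q_gt0 : 0 < q) (q_lt1 : q < 1).

(** The coefficient of ['X^k] with [B] for the real power of exponent [beta + 1]: raising [beta] by
    one becomes [B * q], and only integer powers remain. *)
Definition qlag_coef (B : R) n k : R :=
  (-1) ^+ n * (q ^+ n / (q ^+ (n * n) * B ^+ n)) * qpoch q B n *
  (qpoch q (q ^- n) k / (qpoch q B k * qpoch q q k) * q ^+ (k * k.-1)./2) *
  (q ^+ n * B) ^+ k.

(** The factor of index [n] vanishes; hence [qlag_coef] is also right beyond the degree. *)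
Lemma qpoch_negpow_eq0 n k : (n < k)%N -> qpoch q (q ^- n) k = 0.
Proof.
move=> nk; rewrite /qpoch (bigD1_seq n) ?mem_index_iota ?iota_uniq//=.
by rewrite mulVf ?subrr ?mul0r// gt_eqF// exprn_gt0.
Qed.

Lemma coef_qlaguerre beta n k :
  (qlaguerre q beta n)`_k = qlag_coef (q `^ (beta + 1)) n k.
Proof.
pose c j := qpoch q (q ^- n) j / (qpoch q (q `^ (beta + 1)) j * qpoch q q j)
  * q ^+ (j * j.-1)./2 * (q `^ (n%:R + beta + 1)) ^+ j.
have -> : qlaguerre q beta n = ((-1) ^+ n * q `^ (- (n%:R * (n%:R + beta))) *
    qpoch q (q `^ (beta + 1)) n) *: \poly_(j < n.+1) c j.
  rewrite /qlaguerre; congr (_ *: _); rewrite poly_def big_mkord.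
  by apply: eq_bigr => j _; rewrite exprZn scalerA.
rewrite coefZ coef_poly /qlag_coef.
have qP (u v : R) : q `^ (u + v) = q `^ u * q `^ v.
  by apply: powRD; apply/implyP => _; rewrite gt_eqF.
have -> : q `^ (- (n%:R * (n%:R + beta))) =
    q ^+ n / (q ^+ (n * n) * q `^ (beta + 1) ^+ n).
  rewrite (_ : - _ = n%:R - (n%:R * n%:R + (beta + 1) * n%:R)); last by ring.
  rewrite (qP n%:R) powRN powR_mulrn ?(ltW q_gt0)//.
  rewrite (qP (n%:R * n%:R)) -natrM powR_mulrn ?(ltW q_gt0)//.
  by rewrite powRrM powR_mulrn ?powR_ge0.
case: ltnP => [_|nk]; last by rewrite qpoch_negpow_eq0// !(mul0r, mulr0).
rewrite /c -addrA (qP n%:R) powR_mulrn ?(ltW q_gt0)//.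
by rewrite !mulrA.
Qed.

Lemma qpoch_shift (B : R) n : B != 1 ->
  qpoch q (B * q) n = qpoch q B n * (1 - B * q ^+ n) / (1 - B).
Proof.
by move=> B1; rewrite -qpochS qpoch_recl [X in X / _]mulrC mulfK// subr_eq0 eq_sym.
Qed.

Variable B : R.
Hypotheses (B_gt0 : 0 < B) (B_lt1 : B < 1).

Let B01 : 0 <= B < 1. Proof. by rewrite (ltW B_gt0). Qed.
Let q01 : 0 <= q < 1. Proof. by rewrite (ltW q_gt0). Qed.
Let pB0 k : qpoch q B k != 0. Proof. by rewrite gt_eqF// qpoch_gt0. Qed.
Let pq0 k : qpoch q q k != 0. Proof. by rewrite gt_eqF// qpoch_gt0. Qed.
Let x0 k : q ^+ k != 0. Proof. by rewrite gt_eqF// exprn_gt0. Qed.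
Let fB0 k : 1 - B * q ^+ k != 0. Proof. by rewrite gt_eqF// qfactor_gt0. Qed.
Let fq0 k : 1 - q * q ^+ k != 0. Proof. by rewrite gt_eqF// qfactor_gt0. Qed.
Let B0 : B != 0. Proof. by rewrite gt_eqF. Qed.
Let B1 : B != 1. Proof. by rewrite lt_eqF. Qed.
Let B1' : 1 - B != 0. Proof. by rewrite subr_eq0 eq_sym. Qed.
Let q0 : q != 0. Proof. by rewrite gt_eqF. Qed.

Let qpow_sqrS n : q ^+ (n.+1 * n.+1) = q ^+ (n * n) * q ^+ n * q ^+ n * q.
Proof. by rewrite mulSn mulnS !exprD exprS; ring. Qed.

Let half_tri k : ((k.+1 * k)./2 = (k * k.-1)./2 + k)%N.
Proof.
case: k => [|k]; first by [].
rewrite [k.+1.-1]/=.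
have -> : (k.+2 * k.+1 = k.+1 * k + k.+1.*2)%N.
  by rewrite -addnn mulSn [X in (_ + X)%N]mulnS; ring.
by rewrite halfD odd_double andbF add0n doubleK.
Qed.

(** All shifted symbols are rewritten over those with [B] and [q ^- n.+1]; what remains is a
    rational identity. *)
Lemma qlag_coef_lower n k :
  qlag_coef B n.+1 k = qlag_coef (B * q) n.+1 k +
    q * (1 - q ^+ n.+1) / ((q ^+ n.+1) ^+ 2 * B) * qlag_coef (B * q) n k.
Proof.
rewrite /qlag_coef !qpoch_shift// !qpochS.
have y1 : 1 - (q ^+ n.+1)^-1 != 0.
  by rewrite subr_eq0 eq_sym invr_eq1 lt_eqF// qpow_lt1.
have -> : qpoch q (q ^- n) k =
    qpoch q (q ^- n.+1) k * (1 - q ^- n.+1 * q ^+ k) / (1 - q ^- n.+1).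
  rewrite -qpochS qpoch_recl [X in X / _]mulrC mulfK//; congr (qpoch q _ k).
  by rewrite exprS invfM mulrAC mulVf ?mul1r.
rewrite qpow_sqrS.
have -> : (q ^+ n.+1 * (B * q)) ^+ k = (q ^+ n.+1 * B) ^+ k * q ^+ k by rewrite mulrA exprMn.
have -> : (q ^+ n * (B * q)) ^+ k = (q ^+ n.+1 * B) ^+ k.
  by congr (_ ^+ k); rewrite exprSr; ring.
have -> : (B * q) ^+ n.+1 = B ^+ n * B * (q ^+ n * q) by rewrite exprMn !exprSr.
have -> : (B * q) ^+ n = B ^+ n * q ^+ n by rewrite exprMn.
rewrite (exprSr B) (exprSr (-1)) (exprSr q).
have Bn0 : B ^+ n != 0 by rewrite expf_neq0.
have := fB0 k; have := pB0 k; have := pq0 k; have := x0 n; have := x0 (n * n).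
move: y1; rewrite (exprSr q).
have X1 : q ^+ n * q - 1 != 0 by rewrite -exprSr subr_eq0 lt_eqF// qpow_lt1.
set Z := (_ * B) ^+ k; set W := q ^+ _./2.
move: (qpoch q B n) (qpoch q B k) (qpoch q q k) (q ^+ k) (q ^+ (n * n)) Z W.
move: (q ^+ n) (B ^+ n) ((-1) ^+ n) Bn0 X1 => x Bn S Bn0 X1 pn pk fk y X Z W y1 h1 h2 h3 h4 h5.
by field; rewrite B1' h3 h5 h4 q0 h2 X1 Bn0 h1 B0.
Qed.

Lemma qlag_coef_raise n k :
  qlag_coef (B * q) n k = qlag_coef B n.+1 k.+1 +
    (1 - q ^+ n * B) / ((q ^+ n) ^+ 2 * B) * qlag_coef B n k.+1.
Proof.
rewrite /qlag_coef !qpoch_shift// [qpoch q (q ^- n.+1) k.+1]qpoch_recl.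
have -> : q ^- n.+1 * q = q ^- n by rewrite exprSr invfM mulfVK.
rewrite !qpochS qpow_sqrS half_tri exprD.
have -> : (q ^+ n * (B * q)) ^+ k = (q ^+ n * B) ^+ k * q ^+ k by rewrite mulrA exprMn.
have -> : (q ^+ n.+1 * B) ^+ k.+1 = (q ^+ n * B) ^+ k * q ^+ k * (q ^+ n * B * q).
  by rewrite (exprSr q) mulrAC exprMn !(exprSr _ k); ring.
have -> : (q ^+ n * B) ^+ k.+1 = (q ^+ n * B) ^+ k * (q ^+ n * B) by rewrite exprSr.
have -> : (B * q) ^+ n = B ^+ n * q ^+ n by rewrite exprMn.
rewrite (exprSr B) (exprSr (-1)) (exprSr q).
have Bn0 : B ^+ n != 0 by rewrite expf_neq0.
have := fB0 k; have := pB0 k; have := pq0 k; have := x0 n; have := x0 (n * n).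
have := fq0 k; have := x0 k.
set Z := (_ * B) ^+ k; set W := q ^+ _./2; set e := qpoch q _ k.
move: (qpoch q B n) (qpoch q B k) (qpoch q q k) (q ^+ k) (q ^+ (n * n)) Z W e.
move: (q ^+ n) (B ^+ n) ((-1) ^+ n) Bn0 => x Bn S Bn0 pn pk fk y X Z W e h1 h2 h3 h4 h5 h6 h7.
by field; rewrite h2 h5 h7 h6 h4 Bn0 h3 B0 q0 B1'.
Qed.

(** The constant coefficient in the raising relation, left out by the shifted index of
    [qlag_coef_raise]: a multiple of ['X] has none. *)
Lemma qlag_coef_raise0 n :
  qlag_coef B n.+1 0 + (1 - q ^+ n * B) / ((q ^+ n) ^+ 2 * B) * qlag_coef B n 0 = 0.
Proof.
rewrite /qlag_coef !qpoch0 qpochS qpow_sqrS (exprSr B) (exprSr (-1)) (exprSr q).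
have Bn0 : B ^+ n != 0 by rewrite expf_neq0.
have := x0 n; have := x0 (n * n).
move: (qpoch q B n) (q ^+ (n * n)) (q ^+ n) (B ^+ n) ((-1) ^+ n) Bn0.
move=> pn X x Bn S Bn0 h1 h2.
by field; rewrite Bn0 h2 B0 h1 q0.
Qed.

End QLaguerreCoef.

(** * Recurrence of the modified polynomials *)

Section ModifiedQLaguerre.
Variables (R : realType) (q alpha : R).
Hypotheses (q_gt0 : 0 < q) (q_lt1 : q < 1) (alpha_gtN1 : -1 < alpha).

Let Q : R := q `^ (alpha + 1).
Let Q_gt0 : 0 < Q. Proof. exact: powR_gt0. Qed.
Let Q_lt1 : Q < 1.
Proof.
rewrite /Q /powR gt_eqF// expR_lt1 pmulr_rlt0 ?ln_lt0 ?q_gt0//.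
by rewrite -ltrBlDr sub0r.
Qed.

Let QS : q `^ (alpha + 1 + 1) = Q * q.
Proof.
by rewrite powRD ?powRr1 ?(ltW q_gt0)//; apply/implyP => _; rewrite gt_eqF.
Qed.

Local Notation pA := (qlaguerre q alpha).
Local Notation pB := (qlaguerre q (alpha + 1)).
Local Notation c := (qlag_c q alpha).
Local Notation d := (qlag_d q alpha).
Local Notation r := (qlag_r q alpha).
Local Notation l := (qlag_lambda q alpha).
Local Notation m := (qlag_mu q alpha).
Local Notation pt := (modified_qlaguerre q alpha).

Let lower n : pA n.+1 = pB n.+1 + c n.+1 *: pB n.
Proof.
apply/polyP => k; rewrite coefD [(_ *: pB n)`_k]coefZ !coef_qlaguerre// QS.
exact: (qlag_coef_lower q_gt0 q_lt1 Q_gt0 Q_lt1).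
Qed.

Let raise n : 'X * pB n = pA n.+1 + d n *: pA n.
Proof.
apply/polyP => k; rewrite coefXM coefD [(_ *: pA n)`_k]coefZ !coef_qlaguerre// QS.
case: k => [|k] /=.
  by rewrite (qlag_coef_raise0 q_gt0 Q_gt0).
exact: (qlag_coef_raise q_gt0 q_lt1 Q_gt0 Q_lt1).
Qed.

Let p0E beta : qlaguerre q beta 0 = 1.
Proof.
apply/polyP => k; rewrite coef_qlaguerre// coef1 /qlag_coef.
case: k => [|k]; first by rewrite !(muln0, mul0n) /= !(expr0, qpoch0, mulr1, mul1r, invr1).
by rewrite qpoch_negpow_eq0// !(mul0r, mulr0).
Qed.

Let pt0 : pt 0 = 1.
Proof. by rewrite /modified_qlaguerre !p0E -scalerDl addrC subrK scale1r. Qed.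

Let ptS n : pt n.+1 = pB n.+1 + m n.+1 *: pB n.
Proof.
rewrite /modified_qlaguerre lower scalerDr scalerA [_ * c _]mulrC -qlag_muE//.
by rewrite addrAC -scalerDl [_ + (1 - _)]addrC subrK scale1r.
Qed.

Let r0 n : r n != 0. Proof. by rewrite gt_eqF// qlag_r_gt0. Qed.

(** Both sides are expanded in the [pB]: at [pB n] the coefficients agree by [qlag_cdE], at the
    preceding index because [d n * c n = l n * m n], the factors [r n] cancelling. *)
Let X_pB n : 'X * pB n = pt n.+1 + l n *: pt n.
Proof.
have dE k : d k = l k * r k by rewrite qlag_lambdaE// divfK.
rewrite raise lower ptS; case: n => [|n].
  rewrite pt0 !p0E -!addrA; congr (_ + _).
  by rewrite -!scalerDl qlag_cdE.
rewrite lower ptS !scalerDr !scalerA -!addrA; congr (_ + _).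
rewrite !addrA -!scalerDl qlag_cdE//; congr (_ + _ *: _).
by rewrite dE qlag_muE//; ring.
Qed.

Lemma modified_qlaguerre0 : pt 0 = 1. Proof. exact: pt0. Qed.

(** [ptS] followed by [X_pB] is the product of two bidiagonal matrices, which gives the diagonal
    [l n + m n] and the coefficients [l n * m n.+1]; for [n = 0] both families start at [1]. *)
Lemma modified_qlaguerre_rec n : 'X * pt n = pt n.+1 + qlag_b q alpha n *: pt n +
  (if n is k.+1 then qlag_a q alpha k ^+ 2 *: pt k else 0).
Proof.
case: n => [|n].
  have := X_pB 0; rewrite p0E pt0 => ->.
  by rewrite /qlag_b qlag_mu0// !addr0.
have -> : 'X * pt n.+1 = 'X * pB n.+1 + m n.+1 *: ('X * pB n).
  by rewrite ptS mulrDr scalerAr.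
rewrite (X_pB n.+1) (X_pB n) /qlag_b /qlag_a sqr_sqrtr; last first.
  by apply: mulr_ge0; apply: ltW; [exact: qlag_lambda_gt0|exact: qlag_mu_gt0].
move: (pt n.+2) (pt n.+1) (pt n) => u v w.
by rewrite scalerDr scalerA scalerDl [l n * _]mulrC !addrA.
Qed.

End ModifiedQLaguerre.

Theorem theorem5p9 (R : realType) (q alpha : R)
    (q_gt0 : 0 < q) (q_lt1 : q < 1) (alpha_gtN1 : -1 < alpha) :
  [/\ hamburger_determinate (modified_qlaguerre q alpha),
      self_adjoint (modified_qlaguerre_jacobi q alpha),
      positive_op (modified_qlaguerre_jacobi q alpha) &
      exists2 A : {linear l2 R -> l2 R},
        op_inverse (modified_qlaguerre_jacobi q alpha) A & trace_class A].
Proof.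
have lam_gt0 := qlag_lambda_gt0 q_gt0 q_lt1 alpha_gtN1.
have mu_gt0 := qlag_mu_gt0 q_gt0 q_lt1 alpha_gtN1.
have mu0 := qlag_mu0 alpha q_gt0.
have bound := qlag_hs_bound q_gt0 q_lt1 alpha_gtN1.
have decay := @qlag_decay R q alpha q_gt0 q_lt1 alpha_gtN1.
have a_gt0 n : 0 < qlag_a q alpha n by rewrite sqrtr_gt0 mulr_gt0.
have p0 := modified_qlaguerre0 alpha q_gt0.
have Xp := modified_qlaguerre_rec q_gt0 q_lt1 alpha_gtN1.
have sa : self_adjoint (modified_qlaguerre_jacobi q alpha).
  exact: (bidiag_self_adjoint lam_gt0 mu0 mu_gt0 bound decay).
split=> //.
- have [w [x [w0 H]]] := limit_quadrature lam_gt0 mu0 mu_gt0 bound p0 Xp.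
  have [mu mu_orth mu1] := discrete_orthogonal a_gt0 p0 w0 H.
  exists mu => // nu nu_orth.
  exact: (atomic_determinate a_gt0 p0 Xp sa mu_orth nu_orth mu1).
- exact: (bidiag_positive lam_gt0 mu0 mu_gt0 bound decay).
- exact: (bidiag_inverse_trace_class lam_gt0 mu0 mu_gt0 bound decay).
Qed.
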